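(* Let $\nu$ be a supernatural number and let $\mathscr{K}(\nu)$ be the class of all pairs $\langle C([0,1],\mathbb{M}_n), \tau\rangle$, where $n$ is a natural number formally dividing $\nu$ and $\tau$ is a faithful trace on $C([0,1],\mathbb{M}_n)$ (this is a Fraïssé class). Then the Fraïssé limit of $\mathscr{K}(\nu)$ is $\langle \mathbb{M}_\nu,\mathrm{tr}\rangle$, where $\mathbb{M}_\nu$ is the UHF algebra associated to $\nu$ and $\mathrm{tr}$ is its unique trace.
   Context: A supernatural number is a formal product $\nu=\prod_{p\text{ prime}}p^{n_p}$ with each $n_p\in\{0,1,2,\dots\}\cup\{\infty\}$ and $\sum_p n_p=\infty$. A natural number $n$ formally divides $\nu$ if for each prime $p$ the exponent of $p$ in $n$ is at most $n_p$. $\mathbb{M}_\nu$ is the UHF algebra whose associated supernatural number (Glimm's complete invariant) is $\nu$, i.e. a natural number $n$ formally divides $\nu$ iff $\mathbb{M}_n$ embeds unitally in $\mathbb{M}_\nu$. Traces are normalized (tracial states). The structures considered are pairs $\langle A,\tau\rangle$ with $A$ a unital C*-algebra and $\tau$ a trace on $A$, with metric $d(a,b)=\|a-b\|$. An embedding (morphism) is an injective unital trace-preserving $*$-homomorphism; isomorphisms and automorphisms are also trace-preserving. A Fraïssé class $\mathscr{K}$ is a class of finitely generated such structures satisfying the joint embedding, near amalgamation, weak Polish and Cauchy continuity properties; such a class has a Fraïssé limit which is unique up to isomorphism. A Fraïssé limit of $\mathscr{K}$ is a separable structure $M$ such that: (1) ($\mathscr{K}$-structure) for any finite $F\subseteq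 M$ and $\varepsilon>0$ there is an embedding $\varphi$ of a member of $\mathscr{K}$ into $M$ such that the $\varepsilon$-neighborhood of the image of $\varphi$ includes $F$; (2) ($\mathscr{K}$-universal) every member of $\mathscr{K}$ embeds into $M$; (3) (approximately $\mathscr{K}$-homogeneous) for any $A\in\mathscr{K}$, $a_1,\dots,a_n\in A$, embeddings $\varphi,\psi\colon A\to M$ and $\varepsilon>0$, there is an automorphism $\alpha$ of $M$ with $d(\alpha\varphi(a_i),\psi(a_i))<\varepsilon$ for $i=1,\dots,n$. *)

(* Defs.v *)
From HB Require Import structures.
From mathcomp Require Import all_boot all_order all_algebra.
From mathcomp Require Import all_classical all_reals all_analysis.
From mathcomp Require Import complex.
From mathcomp Require Import ring lra.

Set Implicit Arguments.
Unset Strict Implicit.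
Unset Printing Implicit Defensive.

Import Order.TTheory GRing.Theory Num.Theory.
Import numFieldNormedType.Exports.
Import ComplexField.Normc.


Local Open Scope classical_set_scope.
Local Open Scope ring_scope.
Local Open Scope complex_scope.
Local Open Scope sesquilinear_scope.

(* MathComp-Analysis puts the norm topology on abstract numeric fields only;
   R[i] needs its own instance, from which 'M[R[i]]_n gets its topology. *)
HB.instance Definition _ (R : realType) := PseudoPointedMetric.copy R[i] R[i]^o.

Section EuclideanNorm.
Variables (R : realType).
Implicit Types (z : R[i]).

Lemma normc_ge0 z : 0 <= normc z.
Proof. by case: z => a b; exact: sqrtr_ge0. Qed.

Definition l2norm n (v : 'cV[R[i]]_n) : R :=
  Num.sqrt (\sum_i (normc (v i 0)) ^+ 2).

Lemma l2norm_ge0 n (v : 'cV[R[i]]_n) : 0 <= l2norm v.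
Proof. exact: sqrtr_ge0. Qed.

Lemma l2norm_sqr n (v : 'cV[R[i]]_n) :
  ((l2norm v) ^+ 2)%:C = dotmx v^T v^T.
Proof.
rewrite sqr_sqrtr; last by apply: sumr_ge0 => i _; exact: sqr_ge0.
rewrite dotmxE mxE rmorph_sum; apply: eq_bigr => i _.
by rewrite !mxE -normCK rmorphXn.
Qed.

Lemma l2normE n (v : 'cV[R[i]]_n) : (l2norm v)%:C = sqrtC (dotmx v^T v^T).
Proof. by rewrite -l2norm_sqr rmorphXn sqrCK// ler0c l2norm_ge0. Qed.

Lemma l2norm_CS n (u v : 'cV[R[i]]_n) :
  normc (dotmx u^T v^T) <= l2norm u * l2norm v.
Proof.
by rewrite -lecR rmorphM /= !l2normE; exact: (CauchySchwarz_sqrt (@dotmx _ n)).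
Qed.

Lemma l2normD n (u v : 'cV[R[i]]_n) : l2norm (u + v) <= l2norm u + l2norm v.
Proof.
rewrite -lecR rmorphD /= !l2normE linearD.
exact: (triangle_lerif (@dotmx _ n)).
Qed.

Lemma l2normZ n z (v : 'cV[R[i]]_n) : l2norm (z *: v) = normc z * l2norm v.
Proof.
rewrite /l2norm; under eq_bigr do rewrite mxE normcM exprMn.
by rewrite -mulr_sumr sqrtrM ?sqr_ge0// sqrtr_sqr ger0_norm ?normc_ge0.
Qed.

Lemma normc_le_l2norm n (v : 'cV[R[i]]_n) i : normc (v i 0) <= l2norm v.
Proof.
rewrite -[leLHS]ger0_norm ?normc_ge0// -sqrtr_sqr ler_wsqrtr//.
by rewrite (bigD1 i)//= lerDl sumr_ge0// => j _; exact: sqr_ge0.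
Qed.

Lemma l2norm_le_sum n (v : 'cV[R[i]]_n) : l2norm v <= \sum_i normc (v i 0).
Proof.
have s0 (P : pred 'I_n) : 0 <= \sum_(i | P i) normc (v i 0).
  by apply: sumr_ge0 => i _; exact: normc_ge0.
rewrite -[leRHS]ger0_norm// -sqrtr_sqr ler_wsqrtr//.
rewrite expr2 mulr_suml; apply: ler_sum => i _.
by rewrite expr2 ler_wpM2l ?normc_ge0// (bigD1 i)//= lerDl.
Qed.

Lemma l2norm_delta n (j : 'I_n) : l2norm (delta_mx j 0 : 'cV[R[i]]_n) = 1.
Proof.
rewrite /l2norm (bigD1 j)//= big1 ?addr0 => [|i /negPf ij]; last first.
  by rewrite mxE ij -[normc _]/(normc 0) normc0 expr0n.
by rewrite mxE !eqxx -[normc _]/(normc 1) normc1 expr1n sqrtr1.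
Qed.

Lemma l2norm0 n : l2norm (0 : 'cV[R[i]]_n) = 0.
Proof. by rewrite -(scale0r 0) l2normZ normc0 mul0r. Qed.

Lemma l2norm_eq0 n (v : 'cV[R[i]]_n) : l2norm v = 0 -> v = 0.
Proof.
move=> v0; apply/colP => i; rewrite mxE; apply: eq0_normc; apply/eqP.
by rewrite eq_le normc_ge0 andbT -v0 normc_le_l2norm.
Qed.

End EuclideanNorm.

HB.lock Definition opnorm (R : realType) (n : nat) (A : 'M[R[i]]_n) : R :=
  sup [set l2norm (A *m v) | v in [set v : 'cV[R[i]]_n | l2norm v <= 1]].

Section OperatorNorm.
Variables (R : realType) (n : nat).
Implicit Types (A B : 'M[R[i]]_n) (v : 'cV[R[i]]_n).

Definition mxsum A : R := \sum_i \sum_j normc (A i j).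

Lemma mxsum_ge0 A : 0 <= mxsum A.
Proof. by do 2 apply: sumr_ge0 => ? _; exact: normc_ge0. Qed.

Lemma normc_sum (I : finType) (F : I -> R[i]) :
  normc (\sum_i F i) <= \sum_i normc (F i).
Proof.
elim/big_ind2 : _ => [|x a y b xa yb|i _]//; first by rewrite normc0.
by apply: le_trans (le_normcD _ _) _; exact: lerD.
Qed.

Lemma l2norm_mulmx_mxsum A v : l2norm (A *m v) <= mxsum A * l2norm v.
Proof.
apply: le_trans (l2norm_le_sum _) _; rewrite /mxsum mulr_suml ler_sum// => i _.
rewrite mxE mulr_suml; apply: le_trans (normc_sum _) _.
apply: ler_sum => j _; rewrite normcM ler_wpM2l ?normc_ge0//.
exact: normc_le_l2norm.
Qed.

Lemma opnorm_has_sup A :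
  has_sup [set l2norm (A *m v) | v in [set v | l2norm v <= 1]].
Proof.
split; first by exists (l2norm (A *m 0)), 0 => //=; rewrite l2norm0.
exists (mxsum A) => _ [v /= v1 <-].
apply: le_trans (l2norm_mulmx_mxsum _ _) _.
by rewrite ler_piMr// mxsum_ge0.
Qed.

Lemma l2norm_mulmx A v : l2norm (A *m v) <= opnorm A * l2norm v.
Proof.
have [v0|v0] := eqVneq (l2norm v) 0.
  by rewrite (l2norm_eq0 v0) mulmx0 l2norm0 mulr0.
have vgt0 : 0 < l2norm v by rewrite lt_def v0 l2norm_ge0.
have nV : normc ((l2norm v)^-1%:C) = (l2norm v)^-1.
  by rewrite /= expr0n addr0 sqrtr_sqr ger0_norm// invr_ge0 ltW.
rewrite -ler_pdivrMr// opnorm.unlock; apply: sup_upper_bound; first exact: opnorm_has_sup.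
exists ((l2norm v)^-1%:C *: v) => /=; first by rewrite l2normZ nV mulVf.
by rewrite -scalemxAr l2normZ nV mulrC.
Qed.

Lemma opnorm_ge0 A : 0 <= opnorm A.
Proof.
apply: le_trans (l2norm_ge0 (A *m 0)) _.
rewrite opnorm.unlock; apply: sup_upper_bound.
  exact: opnorm_has_sup.
by exists 0 => //=; rewrite l2norm0.
Qed.

Lemma opnorm_le A c : 0 <= c -> (forall v, l2norm (A *m v) <= c * l2norm v) ->
  opnorm A <= c.
Proof.
move=> c0 Ac; rewrite opnorm.unlock; apply: ge_sup; first by case: (opnorm_has_sup A).
move=> _ [v /= v1 <-]; apply: le_trans (Ac _) _.
by rewrite ler_piMr.
Qed.

Lemma opnorm_le_mxsum A : opnorm A <= mxsum A.
Proof. by apply: opnorm_le (mxsum_ge0 _) _ => v; exact: l2norm_mulmx_mxsum. Qed.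

Lemma normc_le_opnorm A i j : normc (A i j) <= opnorm A.
Proof.
have := normc_le_l2norm (A *m delta_mx j 0) i; rewrite -colE mxE => /le_trans.
apply; rewrite colE; apply: le_trans (l2norm_mulmx _ _) _.
by rewrite l2norm_delta mulr1.
Qed.

Lemma opnormD A B : opnorm (A + B) <= opnorm A + opnorm B.
Proof.
apply: opnorm_le => [|v]; first by rewrite addr_ge0 ?opnorm_ge0.
rewrite mulmxDl mulrDl; apply: le_trans (l2normD _ _) _.
by apply: lerD; exact: l2norm_mulmx.
Qed.

Lemma opnormM A B : opnorm (A *m B) <= opnorm A * opnorm B.
Proof.
apply: opnorm_le => [|v]; first by rewrite mulr_ge0 ?opnorm_ge0.
rewrite -mulmxA -mulrA; apply: le_trans (l2norm_mulmx _ _) _.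
by rewrite ler_wpM2l ?opnorm_ge0// l2norm_mulmx.
Qed.

Lemma opnorm0 : opnorm (0 : 'M[R[i]]_n) = 0.
Proof.
apply/eqP; rewrite eq_le opnorm_ge0 andbT; apply: opnorm_le => // v.
by rewrite mul0mx l2norm0 mul0r.
Qed.

Lemma opnorm_eq0 A : opnorm A = 0 -> A = 0.
Proof.
move=> A0; apply/matrixP => i j; rewrite mxE; apply: eq0_normc; apply/eqP.
by rewrite eq_le normc_ge0 andbT -A0 normc_le_opnorm.
Qed.

Lemma opnormZ (z : R[i]) A : opnorm (z *: A) = normc z * opnorm A.
Proof.
have le (y : R[i]) B : opnorm (y *: B) <= normc y * opnorm B.
  apply: opnorm_le => [|v]; first by rewrite mulr_ge0 ?opnorm_ge0 ?normc_ge0.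
  by rewrite -scalemxAl l2normZ -mulrA ler_wpM2l ?normc_ge0 ?l2norm_mulmx.
have [->|z0] := eqVneq z 0; first by rewrite scale0r opnorm0 normc0 mul0r.
apply/eqP; rewrite eq_le le/=; have := le z^-1 (z *: A).
rewrite scalerA mulVf// scale1r normcV ler_pdivlMl//.
by rewrite lt_def normc_ge0 andbT; apply: contra_neq z0 => /eq0_normc.
Qed.

Lemma opnormN A : opnorm (- A) = opnorm A.
Proof. by rewrite -scaleN1r opnormZ normcN normc1 mul1r. Qed.

Lemma opnormB A B : opnorm (A - B) = opnorm (B - A).
Proof. by rewrite -opnormN opprB. Qed.

Lemma opnorm_dist A B : `|opnorm A - opnorm B| <= opnorm (A - B).
Proof.
have le (C D : 'M[R[i]]_n) : opnorm C <= opnorm D + opnorm (C - D).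
  by have := opnormD D (C - D); rewrite addrC subrK.
rewrite ler_norml lerBlDl le andbT lerNl opprB lerBlDl opnormB.
exact: le.
Qed.

Lemma opnorm_sqr_le A : opnorm A ^+ 2 <= opnorm (A^t* *m A).
Proof.
have AA0 := opnorm_ge0 (A^t* *m A).
rewrite -[leRHS]sqr_sqrtr// ler_sqr ?nnegrE ?opnorm_ge0 ?sqrtr_ge0//.
apply: opnorm_le => [|v]; first exact: sqrtr_ge0.
rewrite -ler_sqr ?nnegrE ?mulr_ge0 ?sqrtr_ge0 ?l2norm_ge0//.
rewrite exprMn [X in X * _]sqr_sqrtr// [in leRHS]expr2 mulrA.
have e : ((l2norm (A *m v)) ^+ 2)%:C = dotmx (A^t* *m A *m v)^T v^T.
  rewrite l2norm_sqr !dotmxE; congr (fun_of_matrix _ 0 0).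
  rewrite !trmx_mul !map_mxM /= !mulmxA; congr (_ *m _).
  by rewrite map_trmx trmxK.
have := l2norm_CS (A^t* *m A *m v) v; rewrite -e.
rewrite /= expr0n addr0 sqrtr_sqr ger0_norm ?sqr_ge0// => /le_trans; apply.
by rewrite ler_wpM2r ?l2norm_ge0// l2norm_mulmx.
Qed.

Lemma opnorm_adj A : opnorm (A^t*) = opnorm A.
Proof.
have le (B : 'M[R[i]]_n) : opnorm B <= opnorm (B^t*).
  have [->|B0] := eqVneq (opnorm B) 0; first exact: opnorm_ge0.
  rewrite -(@ler_pM2r _ (opnorm B)) ?lt_def ?B0 ?opnorm_ge0// -expr2.
  by apply: le_trans (opnorm_sqr_le _) _; exact: opnormM.
by apply/eqP; rewrite eq_le le -{2}[A]trmxCK le.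
Qed.

Lemma opnorm_cstar A : opnorm (A^t* *m A) = opnorm A ^+ 2.
Proof.
apply/eqP; rewrite eq_le opnorm_sqr_le andbT expr2 -{1}(opnorm_adj A).
exact: opnormM.
Qed.

End OperatorNorm.

Section Continuity.
Variables (R : realType) (n : nat).
Implicit Types (A : 'M[R[i]]_n).

Lemma mx_norm_le_opnorm A : `|A| <= (opnorm A)%:C.
Proof.
rewrite -[`|A|]/(mx_norm A).
have [->|/mx_norm_neq0[ij ->]] := eqVneq (mx_norm A) 0.
  by rewrite ler0c opnorm_ge0.
by rewrite lecR normc_le_opnorm.
Qed.

Lemma normc_le_mx_norm A i j : `|A i j| <= `|A|.
Proof.
rewrite [leRHS]/Num.norm/= mx_normE -[leLHS]nngE num_le.
exact: (le_bigmax _ (fun ij : 'I_n * 'I_n => `|A ij.1 ij.2|%:nng) (i, j)).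
Qed.

Lemma continuous_opnormP (T : topologicalType) (f : T -> 'M[R[i]]_n) :
  continuous f <->
  forall t (e : R), 0 < e -> \forall s \near t, opnorm (f t - f s) < e.
Proof.
split=> [cf t e e0|cf t].
  have n0 : 0 < (n * n)%:R + 1 :> R by rewrite ltr_wpDl.
  have d0 : 0 < (e / ((n * n)%:R + 1))%:C :> R[i] by rewrite ltcR divr_gt0.
  have := cf t => /cvgrPdist_lt/(_ _ d0); apply: filterS => s fs.
  apply: le_lt_trans (opnorm_le_mxsum _) _.
  apply: (@le_lt_trans _ _ ((n * n)%:R * (e / ((n * n)%:R + 1)))).
    rewrite mulr_natl mulrnA /mxsum -[X in _ *+ X]card_ord -sumr_const.
    apply: ler_sum => i _; rewrite -[X in _ *+ X]card_ord -sumr_const.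
    apply: ler_sum => j _; rewrite -lecR.
    exact: le_trans (normc_le_mx_norm _ _ _) (ltW fs).
  by rewrite mulrCA gtr_pMr// ltr_pdivrMr// mul1r ltrDl.
apply/cvgrPdist_lt => -[e e'] /[dup]; rewrite {1}ltcE /= => /andP[/eqP -> e0] _.
apply: filterS (cf t e e0) => s fs.
by apply: le_lt_trans (mx_norm_le_opnorm _) _; rewrite ltcR.
Qed.

End Continuity.

Section compact_set_type.
Lemma compact_set_type (T : topologicalType) (A : set T) :
  compact A -> compact [set: set_type A].
Proof.
move=> cA F PF _.
have PG : ProperFilter (set_val @ F) by exact: fmap_proper_filter.
have FA : (set_val @ F) A.
  apply: (@filterS _ F _ setT); last exact: filterT.
  by move=> x _; exact: set_mem (valP x).
have [p [Ap clp]] := cA _ PG FA.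
exists (exist _ p (mem_set Ap)); split=> // B C FB.
rewrite /= nbhsE => -[U [[V oV VU] Up] UC].
have FB' : (set_val @ F) [set x | exists2 b : set_type A, B b & set_val b = x].
  by apply: (@filterS _ F _ B) FB => b Bb; exists b.
have nV : nbhs p V by apply: open_nbhs_nbhs; split => //; rewrite -VU in Up.
have [_ [[b Bb <-] Vb]] := clp _ _ FB' nV.
by exists b; split => //; apply: UC; rewrite -VU.
Qed.
End compact_set_type.

(* The norm is a separate field with values in R: MathComp has no structure
   joining GRing.Algebra and NormedModule, and Hierarchy Builder does not allow
   declaring one downstream of numDomainType. A C*-algebra here is unital and
   nonzero, the latter being part of algType. *)
HB.mixin Record Algebra_isCStar (R : realType) A & GRing.Algebra R[i] A := {
  star : A -> A;
  cnorm : A -> R;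
  starK : involutive star;
  starD : {morph star : a b / a + b};
  starZ : forall (z : R[i]) (a : A), star (z *: a) = Num.conj z *: star a;
  starM : forall a b : A, star (a * b) = star b * star a;
  cnorm_eq0 : forall a : A, cnorm a = 0 -> a = 0;
  cnormD : forall a b : A, cnorm (a + b) <= cnorm a + cnorm b;
  cnormZ : forall (z : R[i]) (a : A), cnorm (z *: a) = normc z * cnorm a;
  cnormM : forall a b : A, cnorm (a * b) <= cnorm a * cnorm b;
  cnorm_star : forall a : A, cnorm (star a * a) = cnorm a ^+ 2;
  cnorm_complete : forall u : nat -> A,
    (forall e : R, 0 < e -> exists N, forall p q,
       (N <= p)%N -> (N <= q)%N -> cnorm (u p - u q) < e) ->
    exists l, forall e : R, 0 < e -> exists N, forall p,
       (N <= p)%N -> cnorm (u p - l) < e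
}.

#[short(type="cstarAlgType")]
HB.structure Definition CStarAlgebra (R : realType) :=
  {A of GRing.Algebra R[i] A & Algebra_isCStar R A}.

Section MatrixComplete.
Variable R : realType.

Lemma real_complete (x : nat -> R) :
  (forall e : R, 0 < e -> exists N, forall p q,
     (N <= p)%N -> (N <= q)%N -> `|x p - x q| < e) ->
  exists l, forall e : R, 0 < e -> \forall p \near \oo, `|x p - l| < e.
Proof.
move=> cx; have : cvg (x @ \oo).
  apply: cauchy_cvg; apply: cauchy_exP => e e0.
  have [N xN] := cx e e0; exists (x N); exists N => // p /= Np.
  by rewrite /ball/=; exact: xN.
move=> /cvgrPdist_lt xl; exists (lim (x @ \oo)) => e e0.
by apply: filterS (xl e e0) => p; rewrite distrC.
Qed.

Lemma ReB (y z : R[i]) : complex.Re (y - z) = complex.Re y - complex.Re z.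
Proof. by case: y z => [? ?] []. Qed.

Lemma ImB (y z : R[i]) : complex.Im (y - z) = complex.Im y - complex.Im z.
Proof. by case: y z => [? ?] []. Qed.

Lemma normc_le_Re_Im (z : R[i]) : normc z <= `|complex.Re z| + `|complex.Im z|.
Proof.
case: z => a b /=; rewrite -[leRHS]ger0_norm ?addr_ge0// -sqrtr_sqr.
by rewrite ler_wsqrtr// sqrrD !real_normK ?num_real// lerD2r lerDl mulrn_wge0 ?mulr_ge0.
Qed.

Lemma Re_le_normc (z : R[i]) : `|complex.Re z| <= normc z.
Proof. by rewrite -lecR; exact: normc_ge_Re. Qed.

Lemma Im_le_normc (z : R[i]) : `|complex.Im z| <= normc z.
Proof.
by case: z => a b; rewrite /= -[leLHS]sqrtr_sqr ler_wsqrtr// lerDr sqr_ge0.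
Qed.

Lemma mx_complete (n : nat) (u : nat -> 'M[R[i]]_n) :
  (forall e : R, 0 < e -> exists N, forall p q,
     (N <= p)%N -> (N <= q)%N -> opnorm (u p - u q) < e) ->
  exists l, forall e : R, 0 < e -> \forall p \near \oo, opnorm (u p - l) < e.
Proof.
move=> cu.
have cRe i j : exists l, forall e : R, 0 < e ->
    \forall p \near \oo, `|complex.Re (u p i j) - l| < e.
  apply: real_complete => e /cu[N uN]; exists N => p q Np Nq.
  apply: le_lt_trans (uN _ _ Np Nq).
  apply: le_trans (normc_le_opnorm _ i j).
  by rewrite !mxE -ReB; exact: Re_le_normc.
have cIm i j : exists l, forall e : R, 0 < e ->
    \forall p \near \oo, `|complex.Im (u p i j) - l| < e.
  apply: real_complete => e /cu[N uN]; exists N => p q Np Nq.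
  apply: le_lt_trans (uN _ _ Np Nq).
  apply: le_trans (normc_le_opnorm _ i j).
  by rewrite !mxE -ImB; exact: Im_le_normc.
pose l : 'M[R[i]]_n :=
  \matrix_(i, j) (sval (cid (cRe i j)) +i* sval (cid (cIm i j))).
exists l => e e0.
have d0 : 0 < e / ((n * n).*2%:R + 1) :> R by rewrite divr_gt0// ltr_wpDl.
have : \forall p \near \oo, forall ij : 'I_n * 'I_n,
    `|complex.Re ((u p - l) ij.1 ij.2)| < e / ((n * n).*2%:R + 1) /\
    `|complex.Im ((u p - l) ij.1 ij.2)| < e / ((n * n).*2%:R + 1).
  apply: filter_forall => -[i j] /=.
  apply: filterS2 (svalP (cid (cRe i j)) _ d0) (svalP (cid (cIm i j)) _ d0).
  by move=> p; rewrite !mxE ReB ImB.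
apply: filterS => p up; apply: le_lt_trans (opnorm_le_mxsum _) _.
apply: (@le_lt_trans _ _ ((n * n).*2%:R * (e / ((n * n).*2%:R + 1)))).
  move: (e / _) up => d up; rewrite mulr_natl -muln2 mulnC mulnA mulrnA /mxsum.
  rewrite -[X in _ *+ X]card_ord -sumr_const.
  apply: ler_sum => i _; rewrite mulrnA -[X in _ *+ X]card_ord -sumr_const.
  apply: ler_sum => j _; apply: le_trans (normc_le_Re_Im _) _.
  by have [/ltW a /ltW b] := up (i, j); rewrite mulr2n lerD.
by rewrite mulrCA gtr_pMr// ltr_pdivrMr ?mul1r ?ltrDl// ltr_wpDl.
Qed.

End MatrixComplete.

Section ContinuousMatrix.
Variables (R : realType) (n : nat) (T : topologicalType).
Local Notation Mn := 'M[R[i]]_n.+1.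
Implicit Types (f g : T -> Mn).

Lemma continuous_mxN f : continuous f -> continuous (fun t => - f t).
Proof. by move=> cf t; apply: cvgN; exact: cf. Qed.

Lemma continuous_mxD f g :
  continuous f -> continuous g -> continuous (fun t => f t + g t).
Proof. by move=> cf cg t; apply: cvgD; [exact: cf | exact: cg]. Qed.

Lemma continuous_mxZ (z : R[i]) f : continuous f -> continuous (fun t => z *: f t).
Proof.
move=> /continuous_opnormP cf; apply/continuous_opnormP => t e e0.
have z0 : 0 < normc z + 1 by rewrite ltr_wpDl ?normc_ge0.
have d0 : 0 < e / (normc z + 1) by exact: divr_gt0.
apply: filterS (cf t _ d0) => s fs.
rewrite -scalerBr opnormZ; apply: (@le_lt_trans _ _ (normc z * (e / (normc z + 1)))).
  by apply: ler_wpM2l; [exact: normc_ge0 | exact: ltW].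
by rewrite mulrCA gtr_pMr// ltr_pdivrMr// mul1r ltrDl.
Qed.

Lemma continuous_mxM f g :
  continuous f -> continuous g -> continuous (fun t => f t * g t).
Proof.
move=> /continuous_opnormP cf /continuous_opnormP cg.
apply/continuous_opnormP => t e e0.
pose c := opnorm (f t) + opnorm (g t) + 2.
have c0 : 0 < c by rewrite ltr_wpDl// addr_ge0// opnorm_ge0.
have [d [d0 d1 de]] : exists d : R, [/\ 0 < d, d <= 1 & d <= e / c].
  exists (Num.min 1 (e / c)).
  by rewrite lt_min ltr01 divr_gt0// ge_min lexx ge_min lexx orbT.
apply: filterS2 (cf t _ d0) (cg t _ d0) => s fs gs.
have -> : f t * g t - f s * g s = f t * (g t - g s) + (f t - f s) * g s.
  by rewrite mulrBr mulrBl addrA subrK.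
apply: le_lt_trans (opnormD _ _) _.
have gsb : opnorm (g s) <= opnorm (g t) + 1.
  have -> : g s = g t + (g s - g t) by rewrite addrC subrK.
  apply: le_trans (opnormD _ _) _; apply: lerD => //; rewrite opnormB.
  exact: le_trans (ltW gs) d1.
apply: (@le_lt_trans _ _ ((opnorm (f t) + (opnorm (g t) + 1)) * (e / c))).
  rewrite [leRHS]mulrDl; apply: lerD; apply: le_trans (opnormM _ _) _.
    apply: ler_wpM2l; [exact: opnorm_ge0 | exact: le_trans (ltW gs) de].
  rewrite mulrC; apply: ler_pM => //; try exact: opnorm_ge0.
  exact: le_trans (ltW fs) de.
rewrite mulrCA gtr_pMr// ltr_pdivrMr// mul1r /c addrA ltrD2l.
by rewrite ltr1n.
Qed.

Lemma continuous_mx_adj f : continuous f -> continuous (fun t => (f t)^t*).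
Proof.
move=> /continuous_opnormP cf; apply/continuous_opnormP => t e e0.
by apply: filterS (cf t e e0) => s; rewrite -!raddfB/= opnorm_adj.
Qed.

Lemma continuous_opnorm f : continuous f -> continuous (fun t => opnorm (f t)).
Proof.
move=> /continuous_opnormP cf t; apply/cvgrPdist_lt => e e0.
apply: filterS (cf t _ e0) => s; apply: le_lt_trans.
exact: opnorm_dist.
Qed.

End ContinuousMatrix.

Definition unit_itv (R : realType) : Type := set_type (`[0, 1]%classic : set R).

HB.instance Definition _ (R : realType) := Topological.copy (unit_itv R)
  (set_type (`[0, 1]%classic : set R)).

(* C([0,1], M_{n+1}): note the shift, needed for 'M_n.+1 to be an algType. *)
Definition C01M (R : realType) (n : nat) : Type :=
  continuousType (unit_itv R) 'M[R[i]]_n.+1.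

HB.instance Definition _ R n := Choice.copy (C01M R n)
  (continuousType (unit_itv R) 'M[R[i]]_n.+1).

Section C01M.
Variables (R : realType) (n : nat).
Local Notation I01 := (unit_itv R).
Local Notation Mn := 'M[R[i]]_n.+1.
Local Notation C := (C01M R n).
Implicit Types (f g h : C) (t s : I01).

Definition C01M_of (f : I01 -> Mn) (cf : continuous f) : C := mkcts cf.

Lemma C01MP f g : (forall t, f t = g t) -> f = g.
Proof. by move=> fg; apply/continuousEP. Qed.

Lemma C01M_continuous f : continuous (f : I01 -> Mn).
Proof. exact: (@cts_fun _ _ f). Qed.

Arguments C01M_continuous : clear implicits.

Definition C01M_cst A : C := C01M_of (@cst_continuous I01 Mn A).
Definition C01M_opp f : C := C01M_of (continuous_mxN (C01M_continuous f)).
Definition C01M_add f g : C :=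
  C01M_of (continuous_mxD (C01M_continuous f) (C01M_continuous g)).
Definition C01M_mul f g : C :=
  C01M_of (continuous_mxM (C01M_continuous f) (C01M_continuous g)).
Definition C01M_scale z f : C :=
  C01M_of (@continuous_mxZ _ _ _ z _ (C01M_continuous f)).
Definition C01M_star f : C := C01M_of (continuous_mx_adj (C01M_continuous f)).

Let addA : associative C01M_add.
Proof. by move=> f g h; apply: C01MP => t /=; exact: addrA. Qed.
Let addC : commutative C01M_add.
Proof. by move=> f g; apply: C01MP => t; exact: addrC. Qed.
Let add0 : left_id (C01M_cst 0) C01M_add.
Proof. by move=> f; apply: C01MP => t; exact: add0r. Qed.
Let addN : left_inverse (C01M_cst 0) C01M_opp C01M_add.
Proof. by move=> f; apply: C01MP => t; exact: addNr. Qed.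
HB.instance Definition _ := GRing.isZmodule.Build C addA addC add0 addN.

Lemma unit_itv0_subproof : (0 : R) \in (`[0%R, 1%R]%classic : set R).
Proof. by rewrite inE /= in_itv/= lexx ler01. Qed.
Definition unit_itv0 : I01 := exist _ 0 unit_itv0_subproof.

Let mulA : associative C01M_mul.
Proof. by move=> f g h; apply: C01MP => t; exact: mulrA. Qed.
Let mul1 : left_id (C01M_cst 1) C01M_mul.
Proof. by move=> f; apply: C01MP => t; exact: mul1r. Qed.
Let mulr1_ : right_id (C01M_cst 1) C01M_mul.
Proof. by move=> f; apply: C01MP => t; exact: mulr1. Qed.
Let mulDl : left_distributive C01M_mul +%R.
Proof. by move=> f g h; apply: C01MP => t; exact: mulrDl. Qed.
Let mulDr : right_distributive C01M_mul +%R.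
Proof. by move=> f g h; apply: C01MP => t; exact: mulrDr. Qed.
Let one_neq0 : C01M_cst 1 != 0.
Proof.
apply/eqP => /(congr1 (fun f : C => f unit_itv0)).
by move=> /eqP; rewrite (negPf (oner_neq0 Mn)).
Qed.
HB.instance Definition _ := GRing.Zmodule_isNzRing.Build C
  mulA mul1 mulr1_ mulDl mulDr one_neq0.

Let scaleA a b f : C01M_scale a (C01M_scale b f) = C01M_scale (a * b) f.
Proof. by apply: C01MP => t; exact: scalerA. Qed.
Let scale1 : left_id 1 C01M_scale.
Proof. by move=> f; apply: C01MP => t; exact: scale1r. Qed.
Let scaleDr : right_distributive C01M_scale +%R.
Proof. by move=> z f g; apply: C01MP => t; exact: scalerDr. Qed.
Let scaleDl f : {morph C01M_scale^~ f : a b / a + b}.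
Proof. by move=> a b; apply: C01MP => t; exact: scalerDl. Qed.
HB.instance Definition _ := GRing.Zmodule_isLmodule.Build R[i] C
  scaleA scale1 scaleDr scaleDl.

Let scaleAl (a : R[i]) f g : a *: (f * g) = a *: f * g.
Proof. by apply: C01MP => t; exact: scalerAl. Qed.
HB.instance Definition _ := GRing.Lmodule_isLalgebra.Build R[i] C scaleAl.
Let scaleAr (a : R[i]) f g : a *: (f * g) = f * (a *: g).
Proof. by apply: C01MP => t; exact: scalerAr. Qed.
HB.instance Definition _ := GRing.Lalgebra_isAlgebra.Build R[i] C scaleAr.

Definition supnorm f : R := sup [set opnorm (f t) | t in [set: I01]].

Lemma supnorm_has_sup f : has_sup [set opnorm (f t) | t in [set: I01]].
Proof.
split; first by exists (opnorm (f unit_itv0)), unit_itv0.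
have cI : compact [set: I01] by apply: compact_set_type; exact: segment_compact.
have cf := continuous_opnorm (C01M_continuous f).
have /compact_bounded : compact [set opnorm (f t) | t in [set: I01]].
  by apply: continuous_compact => //; exact: continuous_subspaceT.
case=> M [_ /(_ (M + 1))]; rewrite ltrDl ltr01 => /(_ isT) fM.
exists (M + 1) => x fx; exact: le_trans (ler_norm _) (fM _ fx).
Qed.

Lemma opnorm_le_supnorm f t : opnorm (f t) <= supnorm f.
Proof.
by apply: sup_upper_bound; [exact: supnorm_has_sup | exists t].
Qed.

Lemma supnorm_le f c : (forall t, opnorm (f t) <= c) -> supnorm f <= c.
Proof.
move=> fc; apply: ge_sup; first by case: (supnorm_has_sup f).
by move=> _ [t _ <-].
Qed.

Lemma supnorm_ge0 f : 0 <= supnorm f.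
Proof. exact: le_trans (opnorm_ge0 _) (opnorm_le_supnorm f unit_itv0). Qed.

Let starK_ : involutive C01M_star.
Proof. by move=> f; apply: C01MP => t; exact: trmxCK. Qed.

Let starD_ : {morph C01M_star : f g / f + g}.
Proof. by move=> f g; apply: C01MP => t /=; rewrite /mkcts !raddfD. Qed.

Let starZ_ (z : R[i]) f : C01M_star (z *: f) = Num.conj z *: C01M_star f.
Proof. by apply: C01MP => t; rewrite /= /mkcts linearZ/= map_mxZ. Qed.

Let starM_ f g : C01M_star (f * g) = C01M_star g * C01M_star f.
Proof. by apply: C01MP => t; rewrite /= /mkcts trmx_mul map_mxM. Qed.

Let norm_eq0 f : supnorm f = 0 -> f = 0.
Proof.
move=> f0; apply: C01MP => t; apply: opnorm_eq0.
by apply/eqP; rewrite eq_le opnorm_ge0 andbT -f0 opnorm_le_supnorm.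
Qed.

Let normD f g : supnorm (f + g) <= supnorm f + supnorm g.
Proof.
apply: supnorm_le => t; apply: le_trans (opnormD _ _) _.
by rewrite lerD ?opnorm_le_supnorm.
Qed.

Let normZ (z : R[i]) f : supnorm (z *: f) = normc z * supnorm f.
Proof.
have le (y : R[i]) g : supnorm (y *: g) <= normc y * supnorm g.
  apply: supnorm_le => t.
  by rewrite [opnorm _]opnormZ ler_wpM2l ?normc_ge0// opnorm_le_supnorm.
have n0 : supnorm 0 = 0.
  by apply/eqP; rewrite eq_le supnorm_ge0 andbT supnorm_le// => t; rewrite opnorm0.
have [->|z0] := eqVneq z 0; first by rewrite scale0r n0 normc0 mul0r.
apply/eqP; rewrite eq_le le/=; have := le z^-1 (z *: f).
rewrite scalerA mulVf// scale1r normcV ler_pdivlMl//.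
by rewrite lt_def normc_ge0 andbT; apply: contra_neq z0 => /eq0_normc.
Qed.

Let normM_le f g : supnorm (f * g) <= supnorm f * supnorm g.
Proof.
apply: supnorm_le => t; apply: le_trans (opnormM _ _) _.
by rewrite ler_pM ?opnorm_ge0 ?opnorm_le_supnorm.
Qed.

Let norm_star f : supnorm (C01M_star f * f) = supnorm f ^+ 2.
Proof.
apply/eqP; rewrite eq_le; apply/andP; split.
  apply: supnorm_le => t; rewrite [opnorm _]opnorm_cstar.
  by rewrite lerXn2r ?nnegrE ?opnorm_ge0 ?supnorm_ge0// opnorm_le_supnorm.
rewrite -[leRHS]sqr_sqrtr ?supnorm_ge0//.
rewrite lerXn2r ?nnegrE ?sqrtr_ge0 ?supnorm_ge0//.
apply: supnorm_le => t; rewrite -[leLHS]ger0_norm ?opnorm_ge0// -sqrtr_sqr.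
rewrite ler_wsqrtr// -opnorm_cstar; exact: (opnorm_le_supnorm (C01M_star f * f)).
Qed.

Let norm_complete (u : nat -> C) :
  (forall e : R, 0 < e -> exists N, forall p q,
     (N <= p)%N -> (N <= q)%N -> supnorm (u p - u q) < e) ->
  exists l, forall e : R, 0 < e -> exists N, forall p,
     (N <= p)%N -> supnorm (u p - l) < e.
Proof.
move=> cu.
have /choice[l ul] t : exists l, forall e : R, 0 < e ->
    \forall p \near \oo, opnorm (u p t - l) < e.
  apply: mx_complete => e /cu[N uN]; exists N => p q Np Nq.
  exact: le_lt_trans (opnorm_le_supnorm (u p - u q) t) (uN _ _ Np Nq).
have uul (e : R) : 0 < e -> exists N, forall p, (N <= p)%N ->
    forall t, opnorm (u p t - l t) <= e.
  move=> e0; have e20 : 0 < e / 2 by rewrite divr_gt0.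
  have [N uN] := cu _ e20; exists N => p Np t.
  have [M _ uM] := ul t _ e20.
  have := uM (maxn N M) (leq_maxr _ _) => /= uM'.
  rewrite -[u p t](subrK (u (maxn N M) t)) -addrA.
  apply: le_trans (opnormD _ _) _; rewrite [e]splitr lerD ?ltW//.
  apply: le_lt_trans (opnorm_le_supnorm (u p - u (maxn N M)) t) _.
  by apply: uN => //; exact: leq_maxl.
have cl : continuous l.
  apply/continuous_opnormP => t e e0.
  have e40 : 0 < e / 4 by rewrite divr_gt0.
  have [N uN] := uul _ e40.
  have /continuous_opnormP/(_ t _ e40) := C01M_continuous (u N).
  apply: filterS => s us.
  have -> : l t - l s = (l t - u N t) + (u N t - u N s) + (u N s - l s).
    by rewrite !subrKA.
  apply: le_lt_trans (opnormD _ _) _; have := uN N (leqnn N) s => us'.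
  have := uN N (leqnn N) t; rewrite opnormB => ut'.
  have := opnormD (l t - u N t) (u N t - u N s); lra.
exists (C01M_of cl) => e e0; have e20 : 0 < e / 2 by rewrite divr_gt0.
have [N uN] := uul _ e20; exists N => p Np.
apply: (@le_lt_trans _ _ (e / 2)); last by rewrite ltr_pdivrMr// ltr_pMr// ltr1n.
by apply: supnorm_le => t; exact: uN.
Qed.

HB.instance Definition _ := Algebra_isCStar.Build R C
  starK_ starD_ starZ_ starM_ norm_eq0 normD normZ normM_le norm_star
  norm_complete.

End C01M.

Section Tracial.
Variable R : realType.

Definition is_trace (A : cstarAlgType R) (tau : {scalar A}) : Prop :=
  [/\ tau 1 = 1,
      forall a, 0 <= tau (star a * a)
    & forall a b, tau (a * b) = tau (b * a)].

Definition faithful (A : cstarAlgType R) (tau : {scalar A}) : Prop :=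
  forall a, tau (star a * a) = 0 -> a = 0.

Record tracialAlg := TracialAlg {
  tracial_alg :> cstarAlgType R;
  trace : {scalar tracial_alg};
  traceP : is_trace trace
}.

(* Unitality, linearity and multiplicativity are part of {lrmorphism _ -> _}. *)
Definition embedding (A B : tracialAlg) (phi : {lrmorphism A -> B}) : Prop :=
  [/\ injective phi,
      forall a, phi (star a) = star (phi a)
    & forall a, trace B (phi a) = trace A a].

Definition automorphism (M : tracialAlg) (alpha : {lrmorphism M -> M}) : Prop :=
  embedding alpha /\ forall b, exists a, alpha a = b.

Definition separable (A : cstarAlgType R) : Prop :=
  exists D : set A, countable D /\
    forall a (e : R), 0 < e -> exists2 d, D d & cnorm (a - d) < e.

Record is_fraisse_limit (K : tracialAlg -> Prop) (M : tracialAlg) : Prop := {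
  fraisse_separable : separable M;
  fraisse_structure : forall (F : set M) (e : R), finite_set F -> 0 < e ->
    exists (A : tracialAlg) (phi : {lrmorphism A -> M}),
      [/\ K A, embedding phi
        & forall x, F x -> exists a, cnorm (x - phi a) < e];
  fraisse_universal : forall A : tracialAlg, K A ->
    exists phi : {lrmorphism A -> M}, embedding phi;
  fraisse_homogeneous : forall A : tracialAlg, K A ->
    forall (n : nat) (a : 'I_n -> A) (phi psi : {lrmorphism A -> M}) (e : R),
      embedding phi -> embedding psi -> 0 < e ->
      exists2 alpha : {lrmorphism M -> M}, automorphism alpha
        & forall i, cnorm (alpha (phi (a i)) - psi (a i)) < e
}.

End Tracial.

Section Supernatural.
Variable R : realType.

(* None stands for the exponent oo; exponents at non-primes are ignored. *)
Definition exponent_ereal (k : option nat) : \bar R :=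
  if k is Some m then m%:R%:E else +oo%E.

Record supernatural := Supernatural {
  expo :> nat -> option nat;
  expo_sum : (\sum_(0 <= p <oo | prime p) exponent_ereal (expo p))%E = +oo%E
}.

(* Positivity is explicit because logn p 0 = 0. *)
Definition formally_divides (n : nat) (nu : supernatural) : Prop :=
  (0 < n)%N /\ forall p, prime p ->
    if nu p is Some m then (logn p n <= m)%N else true.

Definition matrix_embedding (A : cstarAlgType R) (n : nat)
    (phi : {lrmorphism 'M[R[i]]_n.+1 -> A}) : Prop :=
  injective phi /\ forall X, phi (X^t*) = star (phi X).

Definition is_uhf (A : cstarAlgType R) : Prop :=
  exists (k : nat -> nat) (phi : forall j, {lrmorphism 'M[R[i]]_((k j).+1) -> A}),
    [/\ forall j, matrix_embedding (phi j),
        forall j X, exists Y, phi j.+1 Y = phi j X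
      & forall a (e : R), 0 < e -> exists j X, cnorm (a - phi j X) < e].

Definition is_uhf_of (nu : supernatural) (A : cstarAlgType R) : Prop :=
  is_uhf A /\ forall n, formally_divides n.+1 nu <->
    exists phi : {lrmorphism 'M[R[i]]_n.+1 -> A}, matrix_embedding phi.

Inductive interval_class (nu : supernatural) : tracialAlg R -> Prop :=
  IntervalClass (n : nat) (tau : {scalar C01M R n}) (tauP : is_trace tau) :
    formally_divides n.+1 nu -> faithful tau ->
    interval_class nu (TracialAlg tauP).

End Supernatural.

(* Main.v *)
(* Every unital *-homomorphism pi of C([0,1], M_n) into the UHF algebra M is, on finite sets, close to
   a block-diagonal sum of point evaluations at s_1 <= ... <= s_r in a matrix stage M_N, N = n r: perturb
   the images of the matrix units to exact ones in M_N, and diagonalize the compression of the image of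
   the coordinate function. For a faithful trace tau, ramp functions separate points uniformly, so two
   homomorphisms whose traces are close to tau have pointwise close sorted samples, hence are
   unitarily conjugate up to a small error. This gives approximate homogeneity. It also gives universality:
   discretizing tau and rounding the masses to multiples of 1/r (r is unbounded because nu is infinite)
   yields homomorphisms with trace close to tau, and conjugating them successively produces a Cauchy
   sequence, whose limit induces tau exactly and so is injective. Finally M is generated by its matrix
   stages M_N; any trace-preserving embedding of C([0,1], M_N) with a faithful trace can be conjugated so
   that its constants nearly coincide with a given M_N in M. *)
From HB Require Import structures.
Require Import Defs.
From mathcomp Require Import all_boot all_order all_algebra.
From mathcomp Require Import all_classical all_reals all_analysis.
From mathcomp Require Import complex.
From mathcomp Require Import ring lra.

Set Implicit Arguments.
Unset Strict Implicit.
Unset Printing Implicit Defensive.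

Import Order.TTheory GRing.Theory Num.Theory.
Import numFieldNormedType.Exports.
Import ComplexField.Normc.

Local Open Scope classical_set_scope.
Local Open Scope ring_scope.
Local Open Scope complex_scope.
Local Open Scope sesquilinear_scope.

(** * Norms and limits in C*-algebras *)

(** The estimates in abstract C*-algebras avoid spectra: square roots near 1 come from a
    contraction, and multiplicative constants are removed by passing to high powers of selfadjoint
    elements. Two obstacles shape the rest. To be conjugated, two homomorphisms must be modelled in
    one and the same stage, so approximations are stated for all large [j]; there the number of
    blocks is forced by N = n r, and two models differ only by a change of frame and by their
    samples. Moreover, closeness of traces controls averages, while each single sample has to be
    controlled: faithfulness makes consecutive ramps differ in trace by a positive amount, so that a
    large gap between two samples of equal rank would show in the averages. The comparison uses only
    finitely many approximate values of the trace, so one statement serves both exact embeddings and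
    the successive approximate models. Approximating M by members of the class compares no traces at
    all: a constant function has the same value at every sample, and matching the frames is
    enough. *)

Section CStarBasics.
Variables (R : realType) (A : cstarAlgType R).
Implicit Types (a b c : A) (z : R[i]).

Lemma cnorm0 : cnorm (0 : A) = 0.
Proof. by rewrite -(scale0r 0) cnormZ normc0 mul0r. Qed.

Lemma cnormN a : cnorm (- a) = cnorm a.
Proof. by rewrite -scaleN1r cnormZ normcN normc1 mul1r. Qed.

Lemma cnormB a b : cnorm (a - b) = cnorm (b - a).
Proof. by rewrite -cnormN opprB. Qed.

Lemma cnorm_ge0 a : 0 <= cnorm a.
Proof. by have := cnormD a (- a); rewrite subrr cnorm0 cnormN -mulr2n pmulrn_lge0. Qed.

Lemma cnorm_triangle c a b : cnorm (a - b) <= cnorm (a - c) + cnorm (c - b).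
Proof. by rewrite -{1}(subrK c a) -addrA; exact: cnormD. Qed.

Lemma cnorm_sum (I : finType) (F : I -> A) : cnorm (\sum_i F i) <= \sum_i cnorm (F i).
Proof.
elim/big_ind2 : _ => [|x a y b xa yb|i _]//; first by rewrite cnorm0.
by apply: le_trans (cnormD _ _) _; exact: lerD.
Qed.

Lemma normc_real (r : R) : normc r%:C = `|r|.
Proof. by rewrite /= expr0n addr0 sqrtr_sqr. Qed.

Lemma cnormZr (r : R) a : cnorm (r%:C *: a) = `|r| * cnorm a.
Proof. by rewrite cnormZ normc_real. Qed.

Lemma star0 : star 0 = 0 :> A.
Proof. by apply: (addrI (star 0)); rewrite -starD !addr0. Qed.

Lemma starN a : star (- a) = - star a.
Proof. by apply: (addrI (star a)); rewrite -starD !subrr star0. Qed.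

Lemma starB a b : star (a - b) = star a - star b.
Proof. by rewrite starD starN. Qed.

Lemma star1 : star 1 = 1 :> A.
Proof. by rewrite -[LHS]mulr1 -{2}(starK 1) -starM mulr1 starK. Qed.

Lemma star_sum (I : finType) (F : I -> A) : star (\sum_i F i) = \sum_i star (F i).
Proof. exact: (big_morph (@star R A) starD star0). Qed.

Lemma starZr (r : R) a : star (r%:C *: a) = r%:C *: star a.
Proof. by rewrite starZ; congr (_ *: _); exact: conjc_real. Qed.

Lemma starX a n : star (a ^+ n) = star a ^+ n.
Proof. by elim: n => [|n IH]; rewrite ?star1// exprS exprSr starM IH. Qed.

Lemma cnorm_of_star a : cnorm (star a) = cnorm a.
Proof.
have le b : cnorm b <= cnorm (star b).
  have [->|b0] := eqVneq (cnorm b) 0; first exact: cnorm_ge0.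
  rewrite -(@ler_pM2r _ (cnorm b)) ?lt_def ?b0 ?cnorm_ge0// -expr2 -cnorm_star.
  exact: cnormM.
by apply/eqP; rewrite eq_le le -{2}[a]starK le.
Qed.

Lemma cnorm1 : cnorm (1 : A) = 1.
Proof.
have := cnorm_star (1 : A); rewrite star1 mul1r => /esym/eqP.
rewrite expr2 -subr_eq0 -{3}[cnorm 1]mul1r -mulrBl mulf_eq0 subr_eq0 => /orP[/eqP//|].
by move=> /eqP/cnorm_eq0/eqP; rewrite oner_eq0.
Qed.

Lemma cnorm_unitary a : star a * a = 1 -> cnorm a = 1.
Proof.
move=> aa; have /eqP := cnorm_star a; rewrite aa cnorm1 eq_sym sqrf_eq1.
by case/orP => /eqP// a1; have := cnorm_ge0 a; rewrite a1 oppr_ge0 ler10.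
Qed.

(** The C*-identity squares the norm at each step. This is the part of the spectral radius formula
    that replaces functional calculus below. *)
Lemma cnorm_selfadj a : star a = a -> forall k, cnorm (a ^+ (2 ^ k)) = cnorm a ^+ (2 ^ k).
Proof.
move=> sa; elim=> [|k IH]; first by rewrite !expr1.
by rewrite expnS mulnC !exprM expr2 -{1}sa -starX cnorm_star IH.
Qed.

Lemma cnormM_le a b (x y : R) : cnorm a <= x -> cnorm b <= y -> cnorm (a * b) <= x * y.
Proof.
move=> ax by_; apply: le_trans (cnormM _ _) _.
by apply: ler_pM => //; exact: cnorm_ge0.
Qed.

Lemma cnormD_le a b (x y : R) : cnorm a <= x -> cnorm b <= y -> cnorm (a + b) <= x + y.
Proof. by move=> ax by_; apply: le_trans (cnormD _ _) _; exact: lerD. Qed.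

End CStarBasics.

Section Convergence.
Variables (R : realType) (A : cstarAlgType R).
Implicit Types (u v : nat -> A) (a b l m : A).

Definition cvgc u l := forall e : R, 0 < e -> \forall p \near \oo, cnorm (u p - l) < e.

Lemma cvgc_cst l : cvgc (fun=> l) l.
Proof. by move=> e e0; near=> p; rewrite subrr cnorm0. Unshelve. all: by end_near. Qed.

Lemma cvgc_near u v l : (\forall p \near \oo, u p = v p) -> cvgc u l -> cvgc v l.
Proof.
move=> uv ul e e0; near=> p; rewrite -(near uv p)//.
by near: p; exact: ul.
Unshelve. all: by end_near. Qed.

Lemma cvgc_unique u l m : cvgc u l -> cvgc u m -> l = m.
Proof.
move=> ul um; apply/eqP; rewrite -subr_eq0; apply/eqP/cnorm_eq0/eqP.
rewrite eq_le cnorm_ge0 andbT leNgt; apply/negP => d0.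
have e0 : 0 < cnorm (l - m) / 2 by rewrite divr_gt0.
have [p [up vp]] := @filter_ex _ \oo _ _ (filterI (ul _ e0) (um _ e0)).
have := cnorm_triangle (u p) l m; rewrite (cnormB l (u p)).
by rewrite leNgt => /negP; apply; rewrite [ltRHS]splitr ltrD.
Qed.

Lemma cvgcD u v l m : cvgc u l -> cvgc v m -> cvgc (fun p => u p + v p) (l + m).
Proof.
move=> ul vm e e0; have e20 : 0 < e / 2 by rewrite divr_gt0.
near=> p; rewrite opprD addrACA; apply: le_lt_trans (cnormD _ _) _.
by rewrite [e]splitr ltrD//; near: p; [exact: ul | exact: vm].
Unshelve. all: by end_near. Qed.

Lemma cvgcZ z u l : cvgc u l -> cvgc (fun p => z *: u p) (z *: l).
Proof.
move=> ul e e0; have z0 : 0 < normc z + 1 by rewrite ltr_wpDl ?normc_ge0.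
near=> p; rewrite -scalerBr cnormZ.
apply: (@le_lt_trans _ _ (normc z * (e / (normc z + 1)))).
  rewrite ler_wpM2l ?normc_ge0//; apply/ltW; near: p; apply: ul.
  by rewrite divr_gt0.
by rewrite mulrCA gtr_pMr// ltr_pdivrMr// mul1r ltrDl.
Unshelve. all: by end_near. Qed.

Lemma cvgcN u l : cvgc u l -> cvgc (fun p => - u p) (- l).
Proof.
move=> ul; have := cvgcZ (-1) ul; rewrite scaleN1r.
by apply: cvgc_near; near=> p; rewrite scaleN1r.
Unshelve. all: by end_near. Qed.

Lemma cvgcB u v l m : cvgc u l -> cvgc v m -> cvgc (fun p => u p - v p) (l - m).
Proof. by move=> ul /cvgcN; exact: cvgcD. Qed.

Lemma cvgc_bounded u l : cvgc u l -> \forall p \near \oo, cnorm (u p) <= cnorm l + 1.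
Proof.
move=> ul; near=> p; rewrite -[u p](subrK l) addrC.
apply: cnormD_le => //; apply/ltW; near: p; exact: ul.
Unshelve. all: by end_near. Qed.

Lemma cvgcM u v l m : cvgc u l -> cvgc v m -> cvgc (fun p => u p * v p) (l * m).
Proof.
move=> ul vm e e0; pose c := cnorm l + 1 + cnorm m + 1.
have c0 : 0 < c by have := cnorm_ge0 l; have := cnorm_ge0 m; rewrite /c; lra.
have d0 : 0 < e / c by rewrite divr_gt0.
near=> p.
have -> : u p * v p - l * m = u p * (v p - m) + (u p - l) * m.
  by rewrite mulrBr mulrBl addrA subrK.
apply: (@le_lt_trans _ _ ((cnorm l + 1) * (e / c) + (e / c) * cnorm m)).
  apply: cnormD_le; apply: cnormM_le => //.
  - by near: p; exact: cvgc_bounded.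
  - by apply/ltW; near: p; exact: vm.
  - by apply/ltW; near: p; exact: ul.
rewrite [X in _ + X]mulrC -mulrDl mulrCA gtr_pMr// ltr_pdivrMr// mul1r /c.
by rewrite ltrDl.
Unshelve. all: by end_near. Qed.

Lemma cvgc_star u l : cvgc u l -> cvgc (fun p => star (u p)) (star l).
Proof.
by move=> ul e e0; near=> p; rewrite -starB cnorm_of_star; near: p; exact: ul.
Unshelve. all: by end_near. Qed.

Lemma cvgc_sum (I : finType) (u : I -> nat -> A) (l : I -> A) :
  (forall i, cvgc (u i) (l i)) -> cvgc (fun p => \sum_i u i p) (\sum_i l i).
Proof.
move=> ul; suff : forall s : seq I,
    cvgc (fun p => \sum_(i <- s) u i p) (\sum_(i <- s) l i) by exact.
elim=> [|i s IH].
  rewrite big_nil; apply: cvgc_near (cvgc_cst 0).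
  by near=> p; rewrite big_nil.
rewrite big_cons; apply: cvgc_near (cvgcD (ul i) IH).
by near=> p; rewrite big_cons.
Unshelve. all: by end_near. Qed.

Lemma cvgc_le u l (x : R) : cvgc u l -> (\forall p \near \oo, cnorm (u p) <= x) ->
  cnorm l <= x.
Proof.
move=> ul ux; apply/ler_addgt0Pr => e e0.
have [p [up vp]] := @filter_ex _ \oo _ _ (filterI (ul _ e0) ux).
have -> : l = u p - (u p - l) by rewrite subKr.
by apply: cnormD_le => //; rewrite cnormN ltW.
Qed.

Lemma cvgc_cnorm_le u v : cvgc v 0 -> (forall p, cnorm (u p) <= cnorm (v p)) -> cvgc u 0.
Proof.
move=> v0 uv e e0; near=> p; rewrite subr0; apply: le_lt_trans (uv p) _.
by rewrite -[v p]subr0; near: p; exact: v0.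
Unshelve. all: by end_near. Qed.

Lemma cvgc_shift u l : cvgc u l -> cvgc (fun p => u p.+1) l.
Proof.
move=> ul e /ul[N _ uN]; exists N => // p /= Np; apply: uN => /=.
exact: leq_trans Np _.
Qed.

Lemma cvgc_geometric u :
  (forall k, cnorm (u k.+1 - u k) <= (2^-1) ^+ k) -> exists l, cvgc u l.
Proof.
move=> ud.
(* The right side is the exact value of the geometric sum, which makes the induction on [d]
   linear. *)
have tail k d : cnorm (u (k + d)%N - u k) <= 2 * (2^-1) ^+ k - 2 * (2^-1) ^+ (k + d).
  elim: d => [|d IH]; first by rewrite addn0 !subrr cnorm0.
  apply: le_trans (cnorm_triangle (u (k + d)%N) _ _) _; rewrite addnS.
  have E : (2^-1 : R) ^+ (k + d) = 2 * 2^-1 ^+ (k + d).+1.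
    by rewrite exprS mulrA divff// mul1r.
  have := ud (k + d)%N; lra.
have pos k : 0 < (2^-1 : R) ^+ k by rewrite exprn_gt0.
have [l ul] : exists l, forall e : R, 0 < e -> exists N, forall p,
    (N <= p)%N -> cnorm (u p - l) < e.
  apply: cnorm_complete => e e0.
  have [N eN] : exists N, (2^-1 : R) ^+ N < e / 4.
    have [N _ /(_ N (leqnn N))] : \forall n \near \oo, (2^-1 : R) ^+ n < e / 4.
      have /cvgrPdist_lt/(_ (e / 4)) : (GRing.exp (2^-1 : R)) @ \oo --> 0.
        by apply: cvg_expr; rewrite ger0_norm ?invr_ge0// invf_lt1// ltr1n.
      have e40 : 0 < e / 4 by rewrite divr_gt0.
      move=> /(_ e40); apply: filterS => n.
      by rewrite sub0r normrN ger0_norm// ltW.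
    by move=> eN; exists N.
  exists N => p q Np Nq; apply: le_lt_trans (cnorm_triangle (u N) _ _) _.
  have := tail N (p - N)%N; have := tail N (q - N)%N; rewrite !subnKC// (cnormB (u q)).
  have := pos p; have := pos q; lra.
by exists l => e /ul[N uN]; exists N.
Qed.

End Convergence.

(** * Functional calculus near the identity and contractivity *)

(** If [y < x], the powers of [y / x] tend to 0 and cannot stay above [C^-1]. *)
Lemma pow2_le (R : realType) (C x y : R) : 0 <= x -> 0 <= y ->
  (forall k, x ^+ (2 ^ k) <= C * y ^+ (2 ^ k)) -> x <= y.
Proof.
move=> x0 y0 xy; rewrite leNgt; apply/negP => ltyx.
have xgt0 : 0 < x by exact: le_lt_trans ltyx.
pose q := y / x; have q0 : 0 <= q by rewrite divr_ge0.
have q1 : q < 1 by rewrite ltr_pdivrMr// mul1r.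
have qC k : 1 <= C * q ^+ (2 ^ k).
  by rewrite expr_div_n mulrA ler_pdivlMr ?exprn_gt0// mul1r.
have C0 : 0 < C.
  by rewrite ltNge; apply/negP => C0; have := qC 0%N; rewrite leNgt => /negP; apply;
    apply: le_lt_trans ltr01; rewrite mulr_le0_ge0// exprn_ge0.
have Ci : 0 < C^-1 by rewrite invr_gt0.
have /cvgrPdist_lt/(_ _ Ci)[N _ /(_ N (leqnn N))] : (GRing.exp q) @ \oo --> 0.
  by apply: cvg_expr; rewrite ger0_norm.
rewrite sub0r normrN ger0_norm ?exprn_ge0// => qN.
have := qC N; rewrite leNgt => /negP; apply.
rewrite -(mulfV (lt0r_neq0 C0)) ltr_pM2l//; apply: le_lt_trans qN.
by apply: ler_wiXn2l; rewrite ?(ltW q1)// ltnW// ltn_expl.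
Qed.

(* The spectral radius trick: for selfadjoint elements the constant [C] disappears in the limit. *)
Lemma cnorm_le_of_pow (R : realType) (A B : cstarAlgType R) (a : A) (b : B) (C : R) :
  star a = a -> star b = b ->
  (forall k, cnorm (a ^+ k) <= C * cnorm (b ^+ k)) -> cnorm a <= cnorm b.
Proof.
move=> sa sb ab; apply: (pow2_le (C := C)); rewrite ?cnorm_ge0// => k.
by rewrite -!cnorm_selfadj.
Qed.

Section InverseSquareRoot.
Variables (R : realType) (A : cstarAlgType R) (h : A).
Hypotheses (sh : star h = h) (h8 : cnorm h <= 8^-1).

(* [w] is a fixed point of [isq_step] iff [(1 + w)^2 (1 - h) = 1]. *)
Definition isq_step (w : A) : A :=
  (2^-1 : R)%:C *: (h * ((1 + w) * (1 + w)) - w * w).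

(** Invariant of the iteration. Commuting with whatever commutes with [h] stands for lying in the
    closed algebra generated by [h]; on the ball of radius 1/4 the step contracts by 1/2. *)
Definition isq_ok (w : A) :=
  [/\ star w = w, forall x, x * h = h * x -> x * w = w * x & cnorm w <= 4^-1].

Lemma isq_ok0 : isq_ok 0.
Proof.
by split=> [|x _|]; rewrite ?star0 ?mulr0 ?mul0r ?cnorm0.
Qed.

Lemma cnorm_add1 (w : A) : cnorm w <= 4^-1 -> cnorm (1 + w) <= 5 / 4.
Proof. by move=> w4; apply: le_trans (cnormD _ _) _; rewrite cnorm1; lra. Qed.

Lemma isq_step_ok w : isq_ok w -> isq_ok (isq_step w).
Proof.
move=> [sw cw w4]; have hw := cw h erefl.
have c1 x : x * h = h * x -> x * (1 + w) = (1 + w) * x.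
  by move=> /cw xw; rewrite mulrDl mulrDr mul1r mulr1 xw.
split.
- rewrite /isq_step starZr starB !starM starD star1 sw sh.
  by rewrite -mulrA (mulrA h) (c1 h)// -!mulrA (c1 h).
- move=> x xh; rewrite /isq_step -scalerAl -scalerAr mulrBr mulrBl.
  congr (_ *: (_ - _)); last by rewrite (mulrA x) (cw x)// -mulrA (cw x)// mulrA.
  by rewrite (mulrA x) xh -!mulrA; congr (h * _); rewrite (mulrA x) (c1 x)// -mulrA (c1 x).
rewrite /isq_step cnormZr ger0_norm ?invr_ge0//.
have := cnormD (h * ((1 + w) * (1 + w))) (- (w * w)); rewrite cnormN.
have := cnormM_le h8 (cnormM_le (cnorm_add1 w4) (cnorm_add1 w4)).
have := cnormM_le w4 w4; lra.
Qed.

Lemma mulr_subsq (a b : A) : a * b = b * a -> a * a - b * b = (a + b) * (a - b).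
Proof. by move=> ab; rewrite mulrDl !mulrBr ab addrA subrK. Qed.

Lemma isq_step_lip w v : isq_ok w -> isq_ok v ->
  cnorm (isq_step w - isq_step v) <= 2^-1 * cnorm (w - v).
Proof.
move=> [sw cw w4] [sv cv v4].
have wv : w * v = v * w by apply: cv; rewrite -(cw h).
rewrite /isq_step -scalerBr cnormZr ger0_norm ?invr_ge0//.
rewrite ler_wpM2l ?invr_ge0//.
have -> (a b c d : A) : h * a - b - (h * c - d) = h * (a - c) - (b - d).
  by rewrite mulrBr !opprD !opprK addrACA.
rewrite !mulr_subsq//; last by rewrite !mulrDl !mulrDr !mul1r !mulr1 wv addrACA.
have -> : 1 + w - (1 + v) = w - v by rewrite opprD addrACA subrr add0r.
have d := lexx (cnorm (w - v)).
have := cnormM_le h8 (cnormM_le (cnormD_le (cnorm_add1 w4) (cnorm_add1 v4)) d).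
have := cnormM_le (cnormD_le w4 v4) d.
have := cnormD (h * ((1 + w + (1 + v)) * (w - v))) (- ((w + v) * (w - v))).
rewrite cnormN; have := cnorm_ge0 (w - v); lra.
Qed.

(** Here [1 + w] is the inverse square root of [1 - h]. The bound on [w] is what later turns small
    defects into small corrections. *)
Lemma ex_isq : exists w : A, [/\ star w = w,
  forall x, x * h = h * x -> x * w = w * x,
  (1 + w) * (1 + w) * (1 - h) = 1 & cnorm w <= cnorm h].
Proof.
pose u k := iter k isq_step 0.
have uok k : isq_ok (u k) by elim: k => [|k IH]; [exact: isq_ok0|exact: isq_step_ok].
have [w uw] : exists w, cvgc u w.
  apply: cvgc_geometric; elim=> [|k IH].
    rewrite expr0 /= subr0; apply: le_trans (_ : 4^-1 <= 1); last by lra.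
    by have [] := uok 1%N.
  apply: le_trans (isq_step_lip (uok k.+1) (uok k)) _.
  by rewrite exprS ler_wpM2l ?invr_ge0.
have w4 : cnorm w <= 4^-1.
  by apply: cvgc_le uw _; near=> p; have [] := uok p.
have sw : star w = w.
  apply: cvgc_unique (cvgc_star uw) _; apply: cvgc_near uw.
  by near=> p; have [->] := uok p.
have cw x : x * h = h * x -> x * w = w * x.
  move=> xh; apply: cvgc_unique (cvgcM (cvgc_cst x) uw) _.
  apply: cvgc_near (cvgcM uw (cvgc_cst x)).
  by near=> p; have [_ ->] := uok p.
have fw : w = isq_step w.
  apply: cvgc_unique (cvgc_shift uw) _; apply: cvgcZ; apply: cvgcB; last exact: cvgcM.
  have u1 := cvgcD (cvgc_cst 1) uw.
  by apply: cvgcM (cvgc_cst h) (cvgcM u1 u1).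
have hw := cw h erefl.
exists w; split=> //.
  have c1 : (1 + w) * h = h * (1 + w) by rewrite mulrDl mulrDr mul1r mulr1 hw.
  have -> : (1 + w) * (1 + w) * (1 - h) = (1 + w) * (1 + w) - h * ((1 + w) * (1 + w)).
    by rewrite mulrBr mulr1 -[_ * _ * h]mulrA c1 mulrA c1 -mulrA.
  have : w + w = h * ((1 + w) * (1 + w)) - w * w.
    rewrite {1 2}fw /isq_step -scalerDl -rmorphD/=.
    by have -> : (2^-1 + 2^-1 : R) = 1; [lra|rewrite scale1r].
  move=> /eqP; rewrite eq_sym subr_eq => /eqP ->.
  by rewrite mulrDl mul1r mulrDr mulr1 -(addrA 1) (addrA w) addrK.
(* The fixed-point equation gives 2 |w| <= 25/16 |h| + |w| / 4, hence |w| <= 25/28 |h|. *)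
have := cnormD (h * ((1 + w) * (1 + w))) (- (w * w)); rewrite cnormN.
have := cnormM_le (lexx (cnorm h)) (cnormM_le (cnorm_add1 w4) (cnorm_add1 w4)).
have := cnormM_le (lexx (cnorm w)) w4.
have : cnorm w = 2^-1 * cnorm (h * ((1 + w) * (1 + w)) - w * w).
  by rewrite {1}fw /isq_step cnormZr ger0_norm ?invr_ge0.
have := cnorm_ge0 h; have := cnorm_ge0 w; lra.
Unshelve. all: by end_near. Qed.

End InverseSquareRoot.

Section SquareRoot.
Variables (R : realType) (A : cstarAlgType R).
Implicit Types (a h : A).

Lemma ex_sqrt_1B h : star h = h -> cnorm h <= 8^-1 ->
  exists z : A, [/\ star z = z, forall x, x * h = h * x -> x * z = z * x & z * z = 1 - h].
Proof.
move=> sh h8; have [w [sw cw w1 _]] := ex_isq sh h8.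
have c1 x : x * h = h * x -> x * (1 + w) = (1 + w) * x.
  by move=> /cw xw; rewrite mulrDl mulrDr mul1r mulr1 xw.
have c2 : (1 + w) * (1 - h) = (1 - h) * (1 + w).
  by rewrite mulrBr mulrBl mulr1 mul1r (c1 h).
exists ((1 + w) * (1 - h)); split.
- by rewrite starM starB starD star1 sw sh c2.
- by move=> x xh; rewrite mulrA c1// -!mulrA mulrBr mulrBl mulr1 mul1r xh.
- by rewrite {1}c2 mulrA -(mulrA (1 - h)) -[_ * _ * (1 - h)]mulrA w1 mulr1.
Qed.

(** The unitary is h + i sqrt(1 - h^2), with real part [h]. *)
Lemma ex_unitary_part h : star h = h -> cnorm h <= 8^-1 ->
  exists2 u : A, star u * u = 1 & h = (2^-1 : R)%:C *: (u + star u).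
Proof.
move=> sh h8.
have [|| z [sz cz zz]] := @ex_sqrt_1B (h * h).
- by rewrite starM sh.
- by apply: le_trans (cnormM_le h8 h8) _; lra.
have hz : h * z = z * h by apply: cz; rewrite mulrA.
have su : star (h + 'i *: z) = h - 'i *: z.
  by rewrite starD starZ sh sz conjCi scaleNr.
exists (h + 'i *: z).
  rewrite su mulrDr !mulrBl -!scalerAl -!scalerAr hz addrA subrK.
  have -> : 'i *: ('i *: (z * z)) = - (z * z) by rewrite scalerA -expr2 sqrCi scaleN1r.
  by rewrite opprK zz addrC subrK.

rewrite su addrACA subrr addr0 scalerDr -scalerDl -rmorphD/=.
by have -> : (2^-1 + 2^-1 : R) = 1; [lra|rewrite scale1r].
Qed.

End SquareRoot.

Definition starhom (R : realType) (A B : cstarAlgType R) (phi : A -> B) :=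
  forall a, phi (star a) = star (phi a).

Section Contractive.
Variables (R : realType) (A B : cstarAlgType R) (phi : {lrmorphism A -> B}).
Hypothesis sphi : starhom phi.

(* Small selfadjoint elements are averages of two unitaries, and unitaries go to unitaries. *)
Lemma starhom_bounded a : cnorm (phi a) <= 3 * cnorm a.
Proof.
have small h : star h = h -> cnorm h <= 8^-1 -> cnorm (phi h) <= 1.
  move=> sh h8; have [u u1 ->] := ex_unitary_part sh h8.
  have pu : cnorm (phi u) = 1.
    by apply: cnorm_unitary; rewrite -sphi -rmorphM u1 rmorph1.
  rewrite linearZ/= cnormZr ger0_norm ?invr_ge0// raddfD/= sphi.
  have := cnormD (phi u) (star (phi u)); rewrite cnorm_of_star pu; lra.
have sa h : star h = h -> cnorm (phi h) <= 8 * cnorm h.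
  have [->|h0 sh] := eqVneq h 0; first by rewrite raddf0 !cnorm0 mulr0.
  have nh : 0 < cnorm h.
    by rewrite lt_def cnorm_ge0 andbT; apply: contra_neq h0; exact: cnorm_eq0.
  pose c := (8 * cnorm h)^-1; have c0 : 0 < c by rewrite invr_gt0 mulr_gt0.
  have ch : c * cnorm h = 8^-1 by rewrite /c invfM -mulrA mulVf ?mulr1 ?lt0r_neq0.
  have := small (c%:C *: h); rewrite starZr sh linearZ/= !cnormZr gtr0_norm// ch.
  by move=> /(_ erefl (lexx _)); rewrite -ler_pdivlMl// invrK mulr1.
(* The C*-identity reduces [a] to the selfadjoint [star a * a], and 8 <= 3 ^ 2. *)
rewrite -ler_sqr ?nnegrE ?mulr_ge0 ?cnorm_ge0// exprMn -!cnorm_star -sphi -rmorphM.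
apply: le_trans (sa _ _) _; first by rewrite starM starK.
by rewrite ler_wpM2r ?cnorm_ge0//; lra.
Qed.

(** The factor 3 is the same for all powers of [star a * a], so [cnorm_le_of_pow] removes it. *)
Lemma starhom_contractive a : cnorm (phi a) <= cnorm a.
Proof.
rewrite -ler_sqr ?nnegrE ?cnorm_ge0// -!cnorm_star -sphi -rmorphM.
apply: (cnorm_le_of_pow (C := 3)) => [||k].
- by rewrite -sphi starM starK.
- by rewrite starM starK.
- by rewrite -rmorphXn; exact: starhom_bounded.
Qed.

End Contractive.

(* The constants 8 and 16 below are not optimal, but only boundedness matters. *)
Section TraceBounded.
Variables (R : realType) (A : cstarAlgType R) (tau : {scalar A}).
Hypotheses (tau1 : tau 1 = 1) (tau_pos : forall a, 0 <= tau (star a * a)).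

(** When [h] has norm at most 1/8, both [1 - h] and [1 + h] are squares of selfadjoint elements, so
    positivity confines [tau h] to [-1, 1]; the factor 8 comes from rescaling. *)
Lemma positive_bounded_selfadj h : star h = h -> normc (tau h) <= 8 * cnorm h.
Proof.
have half g : star g = g -> cnorm g <= 8^-1 -> tau g <= 1.
  move=> sg g8; have [z [sz _ zz]] := ex_sqrt_1B sg g8.
  have := tau_pos z; rewrite sz zz raddfB/=.
  by rewrite -[tau _ in X in X -> _]/(tau 1) tau1 subr_ge0.
have small g : star g = g -> cnorm g <= 8^-1 -> normc (tau g) <= 1.
  move=> sg g8; have g1 := half _ sg g8.
  have := half (- g); rewrite starN sg cnormN raddfN/= => /(_ erefl g8) g2.
  rewrite -lecR -[(normc _)%:C]/(`|tau g|) real_ler_norml ?g1 ?andbT 1?lerNl//.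
  by rewrite -(subKr 1 (tau g)) rpredB ?rpred1// ger0_real// subr_ge0.
have [->|h0 sh] := eqVneq h 0; first by rewrite raddf0 normc0 cnorm0 mulr0.
have nh : 0 < cnorm h.
  by rewrite lt_def cnorm_ge0 andbT; apply: contra_neq h0; exact: cnorm_eq0.
pose c := (8 * cnorm h)^-1; have c0 : 0 < c by rewrite invr_gt0 mulr_gt0.
have ch : c * cnorm h = 8^-1 by rewrite /c invfM -mulrA mulVf ?mulr1 ?lt0r_neq0.
have := small (c%:C *: h); rewrite starZr sh linearZ/= cnormZr normcM normc_real gtr0_norm// ch.
by move=> /(_ erefl (lexx _)); rewrite -ler_pdivlMl// invrK mulr1.
Qed.

Lemma selfadj_decomp (x : A) : exists a b : A,
  [/\ star a = a, star b = b, x = a + 'i *: b, cnorm a <= cnorm x & cnorm b <= cnorm x].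
Proof.
pose a := (2^-1 : R)%:C *: (x + star x); pose b := (2^-1 : R)%:C *: ('i *: (star x - x)).
exists a, b; split.
- by rewrite starZr starD starK addrC.
- by rewrite starZr starZ conjCi starB starK scaleNr -scalerN opprB.
- rewrite /b !scalerA mulrAC -expr2 sqrCi mulN1r scaleNr.
  rewrite -scalerN opprB -scalerDr addrACA subrr addr0 scalerDr -scalerDl.
  by rewrite -rmorphD/= (_ : 2^-1 + 2^-1 = 1 :> R) ?scale1r//; lra.
- rewrite cnormZr ger0_norm ?invr_ge0//.
  by have := cnormD x (star x); rewrite cnorm_of_star; lra.
rewrite cnormZr ger0_norm ?invr_ge0// cnormZ.
have -> : normc ('i : R[i]) = 1.
  by have := normCi R[i]; rewrite -[`|_|]/((normc _)%:C) => -[].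
by have := cnormD (star x) (- x); rewrite cnormN cnorm_of_star; lra.
Qed.

Lemma positive_bounded x : normc (tau x) <= 16 * cnorm x.
Proof.
have [a [b [sa sb xE ax bx]]] := selfadj_decomp x.
rewrite {1}xE raddfD/= linearZ/=; apply: le_trans (le_normcD _ _) _; rewrite normcM.
have -> : normc ('i : R[i]) = 1.
  by have := normCi R[i]; rewrite -[`|_|]/((normc _)%:C) => -[].
have := positive_bounded_selfadj sa; have := positive_bounded_selfadj sb.
lra.
Qed.

End TraceBounded.

(** * Matrix algebras as C*-algebras: embeddings are isometric, traces are unique *)

Section MatrixCStar.
Variables (R : realType) (n : nat).
Local Notation Mn := 'M[R[i]]_n.+1.

Lemma mxadjK : involutive (fun X : Mn => X^t*).
Proof. by move=> X; exact: trmxCK. Qed.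

Lemma mxadjD : {morph (fun X : Mn => X^t*) : X Y / X + Y}.
Proof. by move=> X Y /=; rewrite !raddfD. Qed.

Lemma mxadjZ (z : R[i]) (X : Mn) : (z *: X)^t* = Num.conj z *: X^t*.
Proof. by rewrite linearZ/= map_mxZ. Qed.

Lemma mxadjM (X Y : Mn) : (X * Y)^t* = Y^t* * X^t*.
Proof. by rewrite [X * Y]/(X *m Y) trmx_mul map_mxM. Qed.

Lemma opnorm_mulr (X Y : Mn) : opnorm (X * Y) <= opnorm X * opnorm Y.
Proof. exact: opnormM. Qed.

Lemma opnorm_cstar_mulr (X : Mn) : opnorm (X^t* * X) = opnorm X ^+ 2.
Proof. exact: opnorm_cstar. Qed.

Lemma opnorm_complete (u : nat -> Mn) :
  (forall e : R, 0 < e -> exists N, forall p q,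
     (N <= p)%N -> (N <= q)%N -> opnorm (u p - u q) < e) ->
  exists l, forall e : R, 0 < e -> exists N, forall p,
     (N <= p)%N -> opnorm (u p - l) < e.
Proof.
move=> /Defs.mx_complete[l ul]; exists l => e /ul[N _ uN].
by exists N => p; exact: uN.
Qed.

HB.instance Definition _ := Algebra_isCStar.Build R Mn
  mxadjK mxadjD mxadjZ mxadjM (@opnorm_eq0 R n.+1) (@opnormD R n.+1)
  (@opnormZ R n.+1) opnorm_mulr opnorm_cstar_mulr opnorm_complete.

End MatrixCStar.

Section MatrixEmbedding.
Variables (R : realType) (n : nat) (B : cstarAlgType R).
Local Notation Mn := 'M[R[i]]_n.+1.
Variable phi : {lrmorphism Mn -> B}.
Hypothesis ephi : matrix_embedding phi.

Lemma matrix_embedding_starhom : starhom phi.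
Proof. by case: ephi => _ + X => /(_ X). Qed.

Lemma delta_mx_mulr (i j k l : 'I_n.+1) :
  delta_mx i j * delta_mx k l = (j == k)%:R *: delta_mx i l :> Mn.
Proof.
rewrite -[LHS]/(delta_mx i j *m delta_mx k l).
have [->|jk] := eqVneq j k; first by rewrite mul_delta_mx scale1r.
by rewrite mul_delta_mx_0// scale0r.
Qed.

Lemma delta_mx_sandwich (X : Mn) i j :
  delta_mx i i * X * delta_mx j j = X i j *: delta_mx i j :> Mn.
Proof.
apply/matrixP => k l; rewrite !mxE (bigD1 j)//= big1 => [|m mj]; last first.
  by rewrite [delta_mx j j m l]mxE (negPf mj) mulr0.
rewrite !mxE (bigD1 i)//= big1 => [|m mi]; last by rewrite mxE (negPf mi) andbF mul0r.
rewrite !mxE !eqxx !addr0 !andbT.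
by case: (k == i); case: (l == j); rewrite !(mul1r, mul0r, mulr1, mulr0).
Qed.

Lemma star_delta_mx (i j : 'I_n.+1) : star (delta_mx i j : Mn) = delta_mx j i.
Proof. by rewrite -[LHS]/((delta_mx i j)^t*) trmx_delta map_delta_mx. Qed.

Lemma cnorm_projection (p : B) : star p = p -> p * p = p -> p <> 0 -> cnorm p = 1.
Proof.
move=> sp pp p0; have := cnorm_star p; rewrite sp pp => /esym/eqP.
rewrite expr2 -subr_eq0 -{3}[cnorm p]mul1r -mulrBl mulf_eq0 subr_eq0.
by case/orP => [/eqP//|/eqP/cnorm_eq0].
Qed.

Lemma cnorm_embedding_delta (i j : 'I_n.+1) : cnorm (phi (delta_mx i j)) = 1.
Proof.
have sphi := matrix_embedding_starhom.
have /eqP : cnorm (phi (delta_mx i j)) ^+ 2 = 1.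
  rewrite -cnorm_star -sphi -rmorphM star_delta_mx delta_mx_mulr eqxx scale1r.
  apply: cnorm_projection.
  - by rewrite -sphi star_delta_mx.
  - by rewrite -rmorphM delta_mx_mulr eqxx scale1r.
  case: ephi => inj _; rewrite -(raddf0 phi) => /inj/matrixP/(_ j j)/eqP.
  by rewrite !mxE !eqxx oner_eq0.
rewrite sqrf_eq1 => /orP[/eqP//|/eqP a1].
by have := cnorm_ge0 (phi (delta_mx i j)); rewrite a1 oppr_ge0 ler10.
Qed.

Lemma entry_le_cnorm (X : Mn) i j : normc (X i j) <= cnorm (phi X).
Proof.
have -> : normc (X i j) = cnorm (phi (delta_mx i i * X * delta_mx j j)).
  have -> : delta_mx i i * X * delta_mx j j = X i j *: delta_mx i j.
    exact: delta_mx_sandwich.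
  by rewrite linearZ/= cnormZ cnorm_embedding_delta mulr1.
rewrite !rmorphM/=; apply: le_trans (cnormM _ _) _.
rewrite cnorm_embedding_delta mulr1; apply: le_trans (cnormM _ _) _.
by rewrite cnorm_embedding_delta mul1r.
Qed.

(** Entries are recovered by compressing with matrix units, whose images have norm 1. This bounds
    [opnorm] by the norm of the image up to a factor depending only on the size, and the power trick
    removes that factor. *)
Lemma matrix_embedding_isometric (X : Mn) : cnorm (phi X) = opnorm X.
Proof.
have sphi := matrix_embedding_starhom.
apply/eqP; rewrite eq_le (starhom_contractive sphi)/=.
have sX (Y : Mn) : star (star Y * Y) = star Y * Y by rewrite starM starK.
rewrite -[opnorm X]/(cnorm X) -ler_sqr ?nnegrE ?cnorm_ge0//.
rewrite -!cnorm_star -sphi -rmorphM.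
apply: (cnorm_le_of_pow (C := (n.+1 * n.+1)%:R)) => [||k]; rewrite -?sphi ?sX//.
rewrite -rmorphXn; set Y := (_ ^+ k).
apply: le_trans (opnorm_le_mxsum _) _; rewrite mulr_natl mulrnA /mxsum.
rewrite -[X in _ *+ X]card_ord -sumr_const.
apply: ler_sum => i _; rewrite -[X in _ *+ X]card_ord -sumr_const.
by apply: ler_sum => j _; exact: entry_le_cnorm.
Qed.

End MatrixEmbedding.

Section MatrixTrace.
Variables (R : realType) (n : nat) (A : cstarAlgType R).
Local Notation Mn := 'M[R[i]]_n.+1.
Variables (phi : {lrmorphism Mn -> A}) (tau : {scalar A}).
Hypothesis tauC : forall a b, tau (a * b) = tau (b * a).

(** As [f] commutes with the range of [phi], the map sending [X] to [tau (f * phi X)] is a tracial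
    functional on matrices, hence a multiple of the matrix trace. The case [f = 1] is uniqueness of
    the trace; Bernstein weights are the other use. *)
Lemma trace_commuting_mul (f : A) (X : Mn) : (forall Y, f * phi Y = phi Y * f) ->
  tau (f * phi X) = tau f * (\tr X / n.+1%:R).
Proof.
move=> fphi; pose g X := tau (f * phi X).
have gC (Y Z : Mn) : g (Y * Z) = g (Z * Y).
  rewrite /g !rmorphM/= (mulrA f) tauC (mulrA (phi Z)).
  by rewrite -fphi mulrA.
have gd (i j : 'I_n.+1) : g (delta_mx i j) = (i == j)%:R * g (delta_mx 0 0).
  have -> : delta_mx i j = delta_mx i 0 * delta_mx 0 j :> Mn.
    by rewrite delta_mx_mulr eqxx scale1r.
  rewrite gC delta_mx_mulr /g linearZ/= -scalerAr linearZ/= eq_sym.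
  by case: (i == j).
have gE (Y : Mn) : g Y = \tr Y * g (delta_mx 0 0).
  rewrite {1}(matrix_sum_delta Y) /g raddf_sum mulr_sumr raddf_sum /mxtrace mulr_suml.
  apply: eq_bigr => i _; rewrite raddf_sum mulr_sumr raddf_sum (bigD1 i)//= big1 ?addr0.
    by rewrite linearZ/= -scalerAr linearZ/= -/(g (delta_mx i i)) (gd i i) eqxx mul1r.
  move=> j ji; rewrite linearZ/= -scalerAr linearZ/= -/(g (delta_mx i j)) (gd i j).
  by rewrite eq_sym (negPf ji) mul0r mulr0.
have := gE 1; rewrite {1}/g rmorph1 mulr1 mxtrace1 => ->.
rewrite -/(g X) gE; have := pnatr_eq0 R[i] n.+1; move: (n.+1%:R : R[i]) => N /negbT N0.
by rewrite [N * _]mulrC -[RHS]mulrA (mulrCA N) mulfV// mulr1 mulrC.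
Qed.

Lemma trace_matrix (X : Mn) : tau 1 = 1 -> tau (phi X) = \tr X / n.+1%:R.
Proof.
move=> tau1; rewrite -[phi X]mul1r trace_commuting_mul ?tau1 ?mul1r// => Y.
by rewrite mul1r mulr1.
Qed.

End MatrixTrace.

(** * Perturbation of matrix units *)

Section MatrixUnits.
Variables (R : realType) (M : cstarAlgType R) (B : nat -> cstarAlgType R).
Variable phi : forall j, {lrmorphism B j -> M}.
Hypothesis sphi : forall j, starhom (phi j).
Hypothesis iso : forall j x, cnorm (phi j x) = cnorm x.

(** The terms live in the varying stages [B j], the limit in [M]. An exact relation between limits
    thus becomes an approximate one inside [B j]. *)
Definition tends (x : forall j, B j) (l : M) := cvgc (fun j => phi j (x j)) l.

Lemma tendsD x y l m : tends x l -> tends y m -> tends (fun j => x j + y j) (l + m).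
Proof.
move=> xl ym; apply: cvgc_near (cvgcD xl ym).
by near=> j; rewrite raddfD.
Unshelve. all: by end_near. Qed.

Lemma tendsB x y l m : tends x l -> tends y m -> tends (fun j => x j - y j) (l - m).
Proof.
move=> xl ym; apply: cvgc_near (cvgcB xl ym).
by near=> j; rewrite raddfB.
Unshelve. all: by end_near. Qed.

Lemma tendsM x y l m : tends x l -> tends y m -> tends (fun j => x j * y j) (l * m).
Proof.
move=> xl ym; apply: cvgc_near (cvgcM xl ym).
by near=> j; rewrite rmorphM.
Unshelve. all: by end_near. Qed.

Lemma tendsZ z x l : tends x l -> tends (fun j => z *: x j) (z *: l).
Proof.
move=> xl; apply: cvgc_near (cvgcZ z xl).
by near=> j; rewrite linearZ.
Unshelve. all: by end_near. Qed.

Lemma tends_star x l : tends x l -> tends (fun j => star (x j)) (star l).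
Proof.
move=> xl; apply: cvgc_near (cvgc_star xl).
by near=> j; rewrite sphi.
Unshelve. all: by end_near. Qed.

Lemma tends1 : tends (fun=> 1) 1.
Proof.
apply: cvgc_near (cvgc_cst 1).
by near=> j; rewrite rmorph1.
Unshelve. all: by end_near. Qed.

Lemma tends_sum (I : finType) (x : I -> forall j, B j) (l : I -> M) :
  (forall i, tends (x i) (l i)) -> tends (fun j => \sum_i x i j) (\sum_i l i).
Proof.
move=> xl; apply: cvgc_near (cvgc_sum xl).
by near=> j; rewrite raddf_sum.
Unshelve. all: by end_near. Qed.

Lemma tends_small x (e : R) : tends x 0 -> 0 < e -> \forall j \near \oo, cnorm (x j) < e.
Proof.
by move=> x0 e0; near=> j; rewrite -iso -[phi _ _]subr0; near: j; exact: x0.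
Unshelve. all: by end_near. Qed.

Lemma tends_le0 x y : tends y 0 -> (forall j, cnorm (x j) <= cnorm (y j)) -> tends x 0.
Proof. by move=> y0 xy; apply: cvgc_cnorm_le y0 _ => j; rewrite !iso. Qed.

End MatrixUnits.

Section Isqf.
Variables (R : realType) (A : cstarAlgType R).
Implicit Types (h g : A).

(* The value [0] outside the domain keeps [cnorm (isqf h) <= cnorm h] unconditional. *)
Definition isqf h : A :=
  if pselect (star h = h /\ cnorm h <= 8^-1) is left H
  then sval (cid (ex_isq H.1 H.2)) else 0.

Lemma isqf_le h : cnorm (isqf h) <= cnorm h.
Proof.
rewrite /isqf; case: pselect => [H|_]; last by rewrite cnorm0 cnorm_ge0.
by case: (cid _) => /= w [].
Qed.

Lemma isqfP h : star h = h -> cnorm h <= 8^-1 ->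
  [/\ star (isqf h) = isqf h, forall x, x * h = h * x -> x * isqf h = isqf h * x &
      (1 + isqf h) * (1 + isqf h) * (1 - h) = 1].
Proof.
move=> sh h8; rewrite /isqf; case: pselect => [H|[]//].
by case: (cid _) => /= w [].
Qed.

(* For [g] near a projection, [symm g = 2 g - 1] is near a symmetry, and dividing it by its
   absolute value gives an exact symmetry, hence an exact projection. *)
Definition symm g : A := g + g - 1.
Definition proj_of g : A :=
  (2^-1 : R)%:C *: (1 + symm g * (1 + isqf (1 - symm g * symm g))).

Lemma halfD (a : A) : (2^-1 : R)%:C *: (a + a) = a.
Proof.
rewrite scalerDr -scalerDl -rmorphD/=.
by have -> : (2^-1 + 2^-1 : R) = 1; [lra|rewrite scale1r].
Qed.

Lemma sign_ofP (c : A) : star c = c -> cnorm (1 - c * c) <= 8^-1 ->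
  let s := c * (1 + isqf (1 - c * c)) in star s = s /\ s * s = 1.
Proof.
move=> sc h8; set h := 1 - c * c in h8 *.
have sh : star h = h by rewrite /h starB starM star1 sc.
have [sw cw w1] := isqfP sh h8; move: (isqf h) sw cw w1 => w sw cw w1.
have cc : c * w = w * c by apply: cw; rewrite /h mulrBr mulrBl mulr1 mul1r mulrA.
have c1 : c * (1 + w) = (1 + w) * c by rewrite mulrDl mulrDr mulr1 mul1r cc.
split; first by rewrite starM starD star1 sw sc c1.
have c2 : c * c = 1 - h by rewrite /h subKr.
move: (1 + w) c1 w1 => u c1 w1.
have du : c * c * u = u * (c * c) by rewrite -mulrA c1 mulrA c1 mulrA.
by rewrite mulrA -(mulrA c u c) -c1 (mulrA c) du -mulrA du mulrA c2.
Qed.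

Lemma proj_ofP g : star g = g -> cnorm (1 - symm g * symm g) <= 8^-1 ->
  star (proj_of g) = proj_of g /\ proj_of g * proj_of g = proj_of g.
Proof.
move=> sg h8; have sc : star (symm g) = symm g by rewrite /symm starB starD star1 sg.
have /= [ss s1] := sign_ofP sc h8; rewrite /proj_of.
move: (symm g * _) ss s1 => s ss s1; split; first by rewrite starZr starD star1 ss.
rewrite -scalerAl -scalerAr mulrDl mul1r mulrDr mulr1 s1 [s + 1]addrC.
by rewrite halfD.
Qed.

End Isqf.

Section Perturbation.
Variables (R : realType) (M : cstarAlgType R) (B : nat -> cstarAlgType R).
Variable phi : forall j, {lrmorphism B j -> M}.
Hypothesis sphi : forall j, starhom (phi j).
Hypothesis iso : forall j x, cnorm (phi j x) = cnorm x.
Variables (n : nat) (E : 'I_n.+1 -> M) (p : M) (X : 'I_n.+1 -> forall j, B j).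
Hypothesis EE : forall i k, star (E i) * E k = (i == k)%:R *: p.
Hypothesis Ep : forall i, E i * p = E i.
Hypothesis pp : p * p = p.
Hypothesis Esum : \sum_i E i * star (E i) = 1.
Hypothesis XE : forall i, tends phi (X i) (E i).

(** The [E i] behave as the matrix units of the first column and [p] as the corner projection. The
    approximation [g] of [p] is rounded to a projection [P], the columns are cut down by [P], and
    the factor [1 + w], an inverse square root of [S], makes the sum of [z i * star (z i)] exactly
    1. *)
Let g j := star (X ord0 j) * X ord0 j.
Let P j := proj_of (g j).
Let y i j := X i j * P j.
Let S j := \sum_i y i j * star (y i j).
Let w j := isqf (1 - S j).
Let z i j := (1 + w j) * y i j.

Let gp : tends phi g p.
Proof.
have <- : star (E ord0) * E ord0 = p by rewrite EE eqxx scale1r.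
exact: tendsM (tends_star sphi (XE _)) (XE _).
Qed.

Let symm_g : tends phi (fun j => symm (g j)) (p + p - 1).
Proof. exact: tendsB (tendsD gp gp) (tends1 _). Qed.

Let h0 : tends phi (fun j => 1 - symm (g j) * symm (g j)) 0.
Proof.
have -> : 0 = 1 - (p + p - 1) * (p + p - 1).
  have e : (p + p - 1) * p = p by rewrite mulrBl mul1r mulrDl pp addrK.
  by rewrite [_ * _]mulrBr mulr1 mulrDr e subKr subrr.
exact: tendsB (tends1 _) (tendsM symm_g symm_g).
Qed.

Lemma perturbed_proj : tends phi P p.
Proof.
rewrite -[p]halfD.
have -> : p + p = 1 + (p + p - 1) * (1 + 0) by rewrite addr0 mulr1 [RHS]addrC subrK.
apply: tendsZ; apply: tendsD (tends1 _) _; apply: tendsM symm_g _.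
apply: tendsD (tends1 _) _; apply: (tends_le0 iso h0) => j; exact: isqf_le.
Qed.

Let yE i : tends phi (y i) (E i).
Proof. by rewrite -(Ep i); exact: tendsM (XE i) perturbed_proj. Qed.

Let S1 : tends phi (fun j => 1 - S j) 0.
Proof.
rewrite -(subrr 1) -{2}Esum; apply: tendsB (tends1 _) _.
by apply: tends_sum => i; exact: tendsM (yE i) (tends_star sphi (yE i)).
Qed.

Lemma perturbed_units i : tends phi (z i) (E i).
Proof.
have -> : E i = (1 + 0) * E i by rewrite addr0 mul1r.
apply: tendsM (yE i); apply: tendsD (tends1 _) _.
by apply: (tends_le0 iso S1) => j; exact: isqf_le.
Qed.

(* [q] is an idempotent matrix over [B j]; being small, it vanishes, which turns the
   approximate relations into exact ones. *)
Let q j i k := (i == k)%:R *: P j - star (z i j) * z k j.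

Let q0 i k : tends phi (fun j => q j i k) 0.
Proof.
rewrite -(subrr ((i == k)%:R *: p)) -{2}EE.
apply: tendsB (tendsZ _ perturbed_proj) _.
exact: tendsM (tends_star sphi (perturbed_units i)) (perturbed_units k).
Qed.

Lemma perturbed_exact : \forall j \near \oo,
  [/\ star (P j) = P j, P j * P j = P j,
      forall i k, star (z i j) * z k j = (i == k)%:R *: P j,
      forall i, z i j * P j = z i j & \sum_i z i j * star (z i j) = 1].
Proof.
pose c : R := ((n.+1 * n.+1)%:R + 1)^-1.
have c0 : 0 < c by rewrite invr_gt0 ltr_wpDl.
have i8 : 0 < 8^-1 :> R by [].
have q1 : \forall j \near \oo, forall ik : 'I_n.+1 * 'I_n.+1, cnorm (q j ik.1 ik.2) < c.
  by apply: filter_forall => -[i k] /=; have := tends_small iso (q0 i k) c0.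
near=> j.
have [sP PP] : star (P j) = P j /\ P j * P j = P j.
  apply: proj_ofP; first by rewrite /g starM starK.
  by apply/ltW; near: j; exact: (tends_small iso h0 i8).
have sS : star (1 - S j) = 1 - S j.
  rewrite starB star1 star_sum; congr (_ - _); apply: eq_bigr => i _.
  by rewrite starM starK.
have S8 : cnorm (1 - S j) <= 8^-1.
  by apply/ltW; near: j; exact: (tends_small iso S1 i8).
have [sw cw w1] := isqfP sS S8; rewrite -/(w j) subKr in sw cw w1.
have wS : S j * (1 + w j) = (1 + w j) * S j.
  rewrite mulrDl mulrDr mulr1 mul1r; congr (_ + _); apply: cw.
  by rewrite mulrBr mulrBl mulr1 mul1r.
have zP i : z i j * P j = z i j by rewrite /z /y -!mulrA PP.
have zz : \sum_i z i j * star (z i j) = 1.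
  rewrite -w1 -mulrA -wS mulrA /S mulr_sumr mulr_suml; apply: eq_bigr => i _.
  by rewrite /z starM starD star1 sw !mulrA.
split=> // i k; apply/eqP; rewrite eq_sym -subr_eq0 -/(q j i k).
pose Q := \sum_i \sum_k cnorm (q j i k).
(* With Z the row of the [z i], the relation Z Z^* = 1 makes Z^* Z a projection below the diagonal
   matrix of [P], and [q] is the difference of the two. *)
have qq a b : q j a b = \sum_l q j a l * q j l b.
  have -> : \sum_l q j a l * q j l b =
      \sum_l ((a == l)%:R *: (P j * q j l b) - star (z a j) * z l j * q j l b).
    by apply: eq_bigr => l _; rewrite {1}/q mulrBl -scalerAl.
  rewrite sumrB (bigD1 a)//= eqxx scale1r big1 ?addr0; last first.
    by move=> l la; rewrite eq_sym (negPf la) scale0r.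
  have Pz l : P j * star (z l j) = star (z l j) by rewrite -{1}sP -starM zP.
  have -> : P j * q j a b = q j a b.
    by rewrite /q mulrBr -scalerAr PP mulrA Pz.
  have -> : \sum_l star (z a j) * z l j * q j l b = 0; last by rewrite subr0.
    under eq_bigr do rewrite -mulrA /q.
    rewrite -mulr_sumr.
    have -> : \sum_l z l j * ((l == b)%:R *: P j - star (z l j) * z b j) = 0.
      under eq_bigr do rewrite mulrBr -scalerAr zP mulrA.
      rewrite sumrB -mulr_suml zz mul1r (bigD1 b)//= eqxx scale1r big1 ?addr0 ?subrr//.
      by move=> l /negPf->; rewrite scale0r.
    by rewrite mulr0.
have le_sum (F : 'I_n.+1 -> R) a : (forall b, 0 <= F b) -> F a <= \sum_b F b.
  by move=> F0; rewrite (bigD1 a)//= lerDl sumr_ge0.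
have Q0 : 0 <= Q by do 2 apply: sumr_ge0 => ? _; exact: cnorm_ge0.
(* The sum of the norms of all entries is submultiplicative, so idempotence gives Q <= Q^2; together
   with Q < 1 this forces Q = 0. *)
have QQ : Q <= Q * Q.
  rewrite {2}/Q mulr_suml; apply: ler_sum => a _.
  apply: (@le_trans _ _ (\sum_b \sum_l cnorm (q j a l) * cnorm (q j l b))).
    apply: ler_sum => b _; rewrite {1}qq; apply: le_trans (cnorm_sum _) _.
    by apply: ler_sum => l _; exact: cnormM.
  rewrite exchange_big mulr_suml; apply: ler_sum => l _.
  rewrite -mulr_sumr ler_wpM2l ?cnorm_ge0//.
  apply: (le_sum (fun a => \sum_b cnorm (q j a b))) => d.
  by apply: sumr_ge0 => b _; exact: cnorm_ge0.
have Q1 : Q < 1.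
  apply: (@le_lt_trans _ _ ((n.+1 * n.+1)%:R * c)).
    rewrite mulr_natl mulrnA /Q -[X in _ *+ X]card_ord -sumr_const.
    apply: ler_sum => a _; rewrite -[X in _ *+ X]card_ord -sumr_const.
    apply: ler_sum => b _; apply/ltW; move: (a, b) => /= ab.
    suff /(_ (a, b)) : forall ik : 'I_n.+1 * 'I_n.+1, cnorm (q j ik.1 ik.2) < c by [].
    by near: j.
  by rewrite ltr_pdivrMr ?ltr_wpDl// mul1r ltrDl.
have Qz : Q = 0.
  apply/eqP; rewrite eq_le Q0 andbT leNgt; apply/negP => Qp.
  by have := QQ; rewrite leNgt gtr_pMr// Q1.
apply/eqP/cnorm_eq0/eqP; rewrite eq_le cnorm_ge0 andbT -[leRHS]Qz.
apply: le_trans (le_sum (fun b => cnorm (q j i b)) k _) _ => [b|]; first exact: cnorm_ge0.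
apply: (le_sum (fun a => \sum_b cnorm (q j a b))) => a.
by apply: sumr_ge0 => b _; exact: cnorm_ge0.
Unshelve. all: by end_near. Qed.

Lemma ex_perturbed_units : exists (P : forall j, B j) (z : 'I_n.+1 -> forall j, B j),
  [/\ tends phi P p, forall i, tends phi (z i) (E i) & \forall j \near \oo,
  [/\ star (P j) = P j, P j * P j = P j,
      forall i k, star (z i j) * z k j = (i == k)%:R *: P j,
      forall i, z i j * P j = z i j & \sum_i z i j * star (z i j) = 1]].
Proof.
by exists P, z; split; [exact: perturbed_proj|exact: perturbed_units|exact: perturbed_exact].
Qed.

End Perturbation.

(** * Spectral decomposition and block-diagonal matrices *)

Section Spectral.
Variables (R : realType) (N : nat).
Local Notation cV := 'cV[R[i]]_N.+1.
Local Notation MN := 'M[R[i]]_N.+1.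

Lemma adjM m n p (X : 'M[R[i]]_(m, n)) (Y : 'M[R[i]]_(n, p)) :
  (X *m Y)^t* = Y^t* *m X^t*.
Proof. by rewrite trmx_mul map_mxM. Qed.

Lemma adj_sum (I : finType) m n (F : I -> 'M[R[i]]_(m, n)) :
  (\sum_i F i)^t* = \sum_i (F i)^t*.
Proof.
apply/matrixP => a b; rewrite !mxE !summxE rmorph_sum.
by apply: eq_bigr => i _; rewrite !mxE.
Qed.

Lemma hermitian_eigenbasis (B : MN) : B^t* = B ->
  exists (v : 'I_N.+1 -> cV) (d : 'I_N.+1 -> R),
  [/\ forall i k, (v i)^t* *m v k = (i == k)%:R%:M,
      \sum_i v i *m (v i)^t* = 1%:M & forall i, B *m v i = (d i)%:C *: v i].
Proof.
move=> sB; have hB : B \is hermsymmx.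
  by apply/is_hermitianmxP; rewrite expr0 scale1r sB.
have /orthomx_spectralP BE := hermitian_normalmx hB.
have /mxOverP dreal := hermitian_spectral_diag_real hB.
have uU := spectral_unitarymx B; rewrite (invmx_unitary uU) in BE.
move: (spectralmx B) (spectral_diag B) uU BE dreal => U D uU BE dreal.
have UV : U *m U^t* = 1%:M by apply/unitarymxP.
have VU : U^t* *m U = 1%:M by exact: mulmx1C.
have vE i : (col i (U^t*))^t* = row i U by apply/matrixP => a b; rewrite !mxE conjCK.
exists (fun i => col i (U^t*)), (fun i => complex.Re (D 0 i)); split.
- move=> i k; rewrite vE; apply/matrixP => a b; rewrite !ord1.
  have /matrixP/(_ i k) := UV; rewrite !mxE eqxx mulr1n => <-.
  by apply: eq_bigr => j _; rewrite !mxE.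
- rewrite -VU; apply/matrixP => a b; rewrite summxE [RHS]mxE.
  by apply: eq_bigr => i _; rewrite vE mxE big_ord1 !mxE.
move=> i; have -> : (complex.Re (D 0 i))%:C = D 0 i by apply/eqP; rewrite RRe_real.
rewrite colE {1}BE -!mulmxA (mulmxA U) UV mul1mx scalemxAr; congr (_ *m _).
apply/matrixP => a b; rewrite mul_diag_mx !mxE.
by have [->|] := eqVneq a i; rewrite //= ?mulr0// ord1 mulr0.
Qed.

Lemma l2norm_adj m (v : 'cV[R[i]]_m) : ((l2norm v) ^+ 2)%:C = (v^t* *m v) 0 0.
Proof.
rewrite sqr_sqrtr; last by apply: sumr_ge0 => i _; exact: sqr_ge0.
rewrite mxE rmorph_sum; apply: eq_bigr => i _.
by rewrite !mxE mulrC -normCK rmorphXn.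
Qed.

Lemma l2norm_eigen (v : cV) : v^t* *m v = 1%:M -> l2norm v = 1.
Proof.
move=> v1; have : ((l2norm v) ^+ 2)%:C = 1 by rewrite l2norm_adj v1 mxE eqxx.
move=> [/eqP]; rewrite sqrf_eq1 => /orP[/eqP//|/eqP v1'].
by have := l2norm_ge0 v; rewrite v1' oppr_ge0 ler10.
Qed.

(* Eigenvectors of [b - (1 - P)]: the eigenvalue [-1] is attained exactly on the
   kernel of [P], because [b] is nearly positive on the range of [P]. *)
Lemma corner_eigenbasis (P b : MN) (c : R) : P^t* = P -> P *m P = P -> b^t* = b ->
  P *m b = b -> b *m P = b -> opnorm (b - (2^-1 : R)%:C *: P) <= c -> c < 3 / 2 ->
  exists r (v : 'I_r -> cV) (s : 'I_r -> R),
  [/\ forall i k, (v i)^t* *m v k = (i == k)%:R%:M,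
      \sum_i v i *m (v i)^t* = P,
      \sum_i (s i)%:C *: (v i *m (v i)^t*) = b,
      forall i k : 'I_r, (i <= k)%N -> s i <= s k &
      forall i, `|s i - 2^-1| <= c].
Proof.
move=> sP PP sb Pb bP bc c32; pose B := b - (1%:M - P).
have sB : B^t* = B.
  by rewrite /B !raddfB/= trmx1 map_mx1 sP sb.
have [v [d [vv v1 Bv]]] := hermitian_eigenbasis sB.
have BP : B *m P = b by rewrite /B mulmxBl bP mulmxBl mul1mx PP subrr subr0.
have PB : P *m B = b by rewrite /B mulmxBr Pb mulmxBr mulmx1 PP subrr subr0.
have normr_v i : l2norm (v i) = 1 by apply: l2norm_eigen; rewrite vv eqxx.
have bv i : b *m v i = (d i)%:C *: (P *m v i).
  by rewrite -PB -mulmxA Bv scalemxAr.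
have bound i : l2norm (b *m v i - (2^-1 : R)%:C *: (P *m v i)) <= c * l2norm (P *m v i).
  have -> : b *m v i - (2^-1 : R)%:C *: (P *m v i) = (b - (2^-1 : R)%:C *: P) *m (P *m v i).
    by rewrite mulmxBl -scalemxAl !mulmxA bP PP.
  by apply: le_trans (l2norm_mulmx _ _) _; rewrite ler_wpM2r ?l2norm_ge0.
(* A nonzero [P *m v i] would be an eigenvector of [b] for -1, at distance 3/2 from the value 1/2 of
   the reference matrix; this exceeds [c]. *)
have dP i : d i = -1 -> P *m v i = 0.
  move=> di; apply: l2norm_eq0; have := bound i.
  rewrite bv di -scalerBl -rmorphB l2normZ normc_real.
  have -> : `|-1 - 2^-1 : R| = 3 / 2 by rewrite ler0_norm; lra.
  move=> H; apply/eqP; rewrite eq_le l2norm_ge0 andbT leNgt; apply/negP => p0.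
  by move: H; rewrite ler_pM2r// leNgt c32.
have dP1 i : d i != -1 -> P *m v i = v i.
  move=> di; apply/eqP; rewrite eq_sym -subr_eq0.
  have : (d i + 1)%:C *: (v i - P *m v i) == 0.
    rewrite rmorphD/= scalerDl scale1r scalerBr -Bv -bv /B mulmxBl mulmxBl mul1mx.
    by rewrite addrAC subrK subrr.
  by rewrite scaler_eq0 => /orP[|//]; rewrite fmorph_eq0 (addr_eq0 (d i)) (negPf di).
pose S := [seq i <- enum 'I_N.+1 | d i != -1].
(* The order of the eigenvalues matters later: samples of two homomorphisms are compared index by
   index. *)
pose l := sort (fun i k => d i <= d k) S.
have ul : uniq l by rewrite sort_uniq filter_uniq// enum_uniq.
have mem_l i : i \in l -> d i != -1.
  by rewrite mem_sort mem_filter => /andP[].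
have sum_l (V : nmodType) (F : 'I_N.+1 -> V) :
    \sum_(i < size l) F (tnth (in_tuple l) i) = \sum_(i | d i != -1) F i.
  rewrite -(big_tnth _ _ l xpredT F) (perm_big S)/=; last first.
    by apply/permPl; exact: perm_sort.
  by rewrite big_filter big_enum_cond.
exists (size l), (fun i => v (tnth (in_tuple l) i)), (fun i => d (tnth (in_tuple l) i)).
split.
- move=> i k; rewrite vv; congr (_%:R%:M).
  by rewrite !(tnth_nth ord0) nth_uniq.
- rewrite (sum_l _ (fun i => v i *m (v i)^t*)).
  rewrite -[RHS]mulmx1 -v1 mulmx_sumr [RHS](bigID (fun i => d i != -1))/=.
  rewrite [X in _ = _ + X]big1 ?addr0 => [|i]; last first.
    by rewrite negbK => /eqP/dP; rewrite mulmxA => ->; rewrite mul0mx.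
  by apply: eq_bigr => i /dP1; rewrite mulmxA => ->.
- rewrite (sum_l _ (fun i => (d i)%:C *: (v i *m (v i)^t*))).
  rewrite -[RHS]mulmx1 -v1 mulmx_sumr [RHS](bigID (fun i => d i != -1))/=.
  rewrite [X in _ = _ + X]big1 ?addr0 => [|i]; last first.
    by rewrite negbK mulmxA bv => /eqP/dP ->; rewrite scaler0 mul0mx.
  by apply: eq_bigr => i /dP1 Pv; rewrite mulmxA bv Pv scalemxAl.
- move=> i k ik; rewrite !(tnth_nth ord0)/=.
  have tot : total (fun i k : 'I_N.+1 => d i <= d k) by move=> ? ?; exact: le_total.
  have tr : transitive (fun i k : 'I_N.+1 => d i <= d k) by move=> ? ? ?; exact: le_trans.
  have re : reflexive (fun i k : 'I_N.+1 => d i <= d k) by move=> ?; exact: lexx.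
  exact: (sorted_leq_nth tr re ord0 (sort_sorted tot S) _ _ (ltn_ord i) (ltn_ord k) ik).
move=> i; set k := tnth _ i; have /mem_l/dP1 Pv : k \in l by exact: mem_tnth.
have := bound k; rewrite bv Pv -scalerBl -rmorphB l2normZ normc_real normr_v.
by rewrite !mulr1.
Qed.

End Spectral.

Section Frames.
Variables (R : realType) (N n r : nat).
Local Notation MN := 'M[R[i]]_N.+1.
Local Notation Mn := 'M[R[i]]_n.+1.
Local Notation family := ('I_r -> 'M[R[i]]_(N.+1, n.+1)).
Implicit Types (T U V : family) (X Y : 'I_r -> Mn).

(** The [T i] are isometries whose orthogonal ranges fill the space: a splitting of C^N into [r]
    copies of C^n, up to the index shifts. *)
Definition frame T : Prop :=
  (forall i k, (T i)^t* *m T k = (i == k)%:R%:M) /\ \sum_i T i *m (T i)^t* = 1%:M.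

(** For [T = U] this is a block-diagonal matrix; for identity blocks it is the unitary carrying the
    frame [U] to [T]. One definition serves both, with a single product rule. *)
Definition blockmx2 T U X : MN := \sum_i T i *m X i *m (U i)^t*.

Lemma blockmx2_adj T U X : (blockmx2 T U X)^t* = blockmx2 U T (fun i => (X i)^t*).
Proof.
rewrite /blockmx2 adj_sum; apply: eq_bigr => i _.
by rewrite !adjM trmxCK mulmxA.
Qed.

Lemma blockmx2M T U V X Y : frame U ->
  blockmx2 T U X * blockmx2 U V Y = blockmx2 T V (fun i => X i *m Y i).
Proof.
move=> [UU _]; rewrite /blockmx2 mulr_suml; apply: eq_bigr => i _.
rewrite mulr_sumr (bigD1 i)//= big1 ?addr0 => [|k ki].
  rewrite -[_ * _]/(_ *m _) -!mulmxA; congr (_ *m (_ *m _)).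
  by rewrite mulmxA UU eqxx mul1mx.
rewrite -[_ * _]/(_ *m _) -!mulmxA (mulmxA _ (U k)) UU eq_sym (negPf ki).
by rewrite mul_scalar_mx scale0r !mulmx0.
Qed.

Lemma blockmx2_1 T : frame T -> blockmx2 T T (fun=> 1%:M) = 1.
Proof. by move=> [_ T1]; apply: etrans T1; apply: eq_bigr => i _; rewrite mulmx1. Qed.

Lemma blockmx2D T U X Y :
  blockmx2 T U (fun i => X i + Y i) = blockmx2 T U X + blockmx2 T U Y.
Proof.
by rewrite -big_split; apply: eq_bigr => i _; rewrite mulmxDr mulmxDl.
Qed.

Lemma blockmx2Z z T U X : blockmx2 T U (fun i => z *: X i) = z *: blockmx2 T U X.
Proof.
by rewrite scaler_sumr; apply: eq_bigr => i _; rewrite -scalemxAr -scalemxAl.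
Qed.

Lemma blockmx2B T U X Y :
  blockmx2 T U (fun i => X i - Y i) = blockmx2 T U X - blockmx2 T U Y.
Proof.
rewrite -[- blockmx2 _ _ _]scaleN1r -blockmx2Z -blockmx2D; apply: eq_bigr => i _.
by rewrite scaleN1r.
Qed.

Lemma mxtrace_blockmx2 T X : frame T -> \tr (blockmx2 T T X) = \sum_i \tr (X i).
Proof.
move=> [TT _]; rewrite raddf_sum; apply: eq_bigr => i _.
by rewrite /= mxtrace_mulC mulmxA TT eqxx mul1mx.
Qed.

(** Comparing traces of the identity. Consequently two frames in the same stage have the same number
    of blocks. *)
Lemma frame_size T : frame T -> (n.+1 * r)%N = N.+1.
Proof.
move=> fT; have := mxtrace_blockmx2 (fun=> 1%:M) fT.
rewrite (blockmx2_1 fT) sumr_const card_ord !mxtrace1 -mulrnA.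
by move/eqP; rewrite eqr_nat => /eqP.
Qed.

Lemma l2norm_frame T (v : 'cV[R[i]]_N.+1) (c : 'I_r -> R) :
  (v^t* *m blockmx2 T T (fun i => (c i)%:C%:M) *m v) 0 0 =
  (\sum_i c i * (l2norm ((T i)^t* *m v)) ^+ 2)%:C.
Proof.
rewrite mulmx_sumr mulmx_suml summxE rmorph_sum; apply: eq_bigr => i _.
rewrite rmorphM/= l2norm_adj adjM trmxCK mul_mx_scalar -scalemxAl -scalemxAr -scalemxAl.
by rewrite mxE !mulmxA.
Qed.

(** Pythagoras in the frame [U]: the component of [v] in block [i] is multiplied by [d i] and moved
    isometrically to block [i] of [T]. *)
Lemma opnorm_blockmx2_scalar T U (d : 'I_r -> R) (c : R) : frame T -> frame U ->
  0 <= c -> (forall i, `|d i| <= c) ->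
  opnorm (blockmx2 T U (fun i => (d i)%:C%:M)) <= c.
Proof.
move=> fT fU c0 dc; apply: opnorm_le => // v; set Z := blockmx2 _ _ _.
rewrite -ler_sqr ?nnegrE ?mulr_ge0 ?l2norm_ge0// exprMn -lecR.
have -> : ((l2norm (Z *m v)) ^+ 2)%:C =
    (\sum_i (d i ^+ 2) * (l2norm ((U i)^t* *m v)) ^+ 2)%:C.
  rewrite l2norm_adj adjM -mulmxA (mulmxA _ Z) -[X in (_ *m (X *m _)) 0 0]/(Z^t* * Z).
  have -> : Z^t* * Z = blockmx2 U U (fun i => (d i ^+ 2)%:C%:M).
    rewrite blockmx2_adj (blockmx2M _ _ _ _ fT); apply: eq_bigr => i _.
    have -> : ((d i)%:C%:M)^t* = (d i)%:C%:M :> Mn.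
      by rewrite tr_scalar_mx map_scalar_mx/=; congr (_%:M); exact: conjc_real.
    by rewrite -scalar_mxM -rmorphM expr2.
  by rewrite mulmxA -l2norm_frame.
have -> : (l2norm v) ^+ 2 = \sum_i 1 * (l2norm ((U i)^t* *m v)) ^+ 2.
  apply: (@complexI R); rewrite -l2norm_frame.
  by rewrite (blockmx2_1 fU) mulmx1 l2norm_adj.
rewrite lecR mulr_sumr ler_sum// => i _; rewrite mul1r ler_wpM2r ?sqr_ge0//.
by rewrite -(real_normK (num_real (d i))) ler_sqr ?nnegrE.
Qed.

End Frames.

(** * The algebra C([0,1], M_n) and its point evaluations *)

Section LinearMaps.
Variables (R : realType) (A B : algType R[i]) (f : A -> B).
Hypotheses (fD : {morph f : x y / x + y}) (fZ : forall z, {morph f : x / z *: x})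
  (f1 : f 1 = 1) (fM : {morph f : x y / x * y}).

Lemma ex_lrmorphism : exists phi : {lrmorphism A -> B}, forall a, phi a = f a.
Proof.
have lf : linear f by move=> z x y; rewrite fD fZ.
have mf : monoid_morphism f by split.
pose l := GRing.isLinear.Build R[i] A B *:%R f lf.
pose m := GRing.isMonoidMorphism.Build A B f mf.
pose phi : {lrmorphism A -> B} := HB.pack f l m.
by exists phi.
Qed.

End LinearMaps.

Definition itv_val (R : realType) (t : unit_itv R) : R := val t.
Arguments itv_val : simpl never.

Section FunctionAlgebra.
Variables (R : realType) (n : nat).
Local Notation I01 := (unit_itv R).
Local Notation C := (C01M R n).
Local Notation Mn := 'M[R[i]]_n.+1.

Lemma opnorm_real_scalar m (x : R) : opnorm (x%:C%:M : 'M[R[i]]_m.+1) = `|x|.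
Proof. by rewrite -scalemx1 opnormZ normc_real -[opnorm 1%:M]/(cnorm 1) cnorm1 mulr1. Qed.

Lemma continuous_real_scalar (f : I01 -> R) : continuous f ->
  continuous (fun t => (f t)%:C%:M : Mn).
Proof.
move=> cf; apply/continuous_opnormP => t e e0.
have /cvgrPdist_lt/(_ _ e0) := cf t; apply: filterS => s.
by rewrite -raddfB/= -rmorphB opnorm_real_scalar.
Qed.

Definition C01M_real (f : I01 -> R) (cf : continuous f) : C :=
  C01M_of (continuous_real_scalar cf).

Lemma continuous_unit_itv_val : continuous (@itv_val R).
Proof. exact: initial_continuous. Qed.

Definition coord : C := C01M_real continuous_unit_itv_val.

Lemma unit_itvP (t : I01) : 0 <= itv_val t <= 1.
Proof. by have := valP t; rewrite inE /= in_itv/=. Qed.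

Definition clamp (x : R) : R := Num.max 0 (Num.min 1 x).

Lemma clamp_subproof (x : R) : clamp x \in (`[0%R, 1%R]%classic : set R).
Proof.
by rewrite inE /= in_itv/= /clamp le_max lexx/= ge_max ler01/= ge_min lexx.
Qed.
Definition unit_itv_clamp (x : R) : I01 := exist _ (clamp x) (clamp_subproof x).

Lemma unit_itv_clampE (x : R) : itv_val (unit_itv_clamp x) = clamp x.
Proof. by []. Qed.

Lemma clamp_homo (x y : R) : x <= y -> clamp x <= clamp y.
Proof.
move=> xy; rewrite /clamp /Num.max /Num.min.
case: (ltP 1 x) => ?; case: (ltP 1 y) => ?; case: ltP => ?; case: ltP => ?; lra.
Qed.

Lemma clamp_dist (x c : R) : 0 <= c -> `|x - 2^-1| <= 2^-1 + c -> `|x - clamp x| <= c.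
Proof.
move=> c0; rewrite !ler_norml /clamp /Num.max /Num.min => /andP[a b].
by case: (ltP 1 x) => ?; case: ltP => ?; apply/andP; split; lra.
Qed.

Lemma cnorm_cst (X : Mn) : cnorm (C01M_cst X) <= opnorm X.
Proof. by apply: supnorm_le => t. Qed.

Lemma C01M_cstM (X Y : Mn) : C01M_cst (X * Y) = C01M_cst X * C01M_cst Y.
Proof. exact: C01MP. Qed.

Lemma C01M_cstD (X Y : Mn) : C01M_cst (X + Y) = C01M_cst X + C01M_cst Y.
Proof. exact: C01MP. Qed.

Lemma C01M_cstZ z (X : Mn) : C01M_cst (z *: X) = z *: C01M_cst X.
Proof. exact: C01MP. Qed.

Lemma C01M_cst1 : C01M_cst (1 : Mn) = 1.
Proof. exact: C01MP. Qed.

Lemma C01M_cst_star (X : Mn) : C01M_cst (X^t*) = star (C01M_cst X).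
Proof. exact: C01MP. Qed.

Lemma C01M_real_star (f : I01 -> R) (cf : continuous f) :
  star (C01M_real cf) = C01M_real cf.
Proof.
apply: C01MP => t; rewrite /= /mkcts tr_scalar_mx map_scalar_mx/=; congr (_%:M).
exact: conjc_real.
Qed.

Lemma C01M_real_comm (f : I01 -> R) (cf : continuous f) (a : C) :
  C01M_real cf * a = a * C01M_real cf.
Proof. by apply: C01MP => t; apply: esym; exact: scalar_mxC. Qed.

Lemma C01M_cst_delta_sum :
  \sum_i C01M_cst (delta_mx i i : Mn) = 1.
Proof.
apply/esym; rewrite -C01M_cst1.
have -> : 1 = \sum_i delta_mx i i :> Mn.
  rewrite -[LHS]/(1%:M) [LHS]matrix_sum_delta; apply: eq_bigr => i _.
  rewrite (bigD1 i)//= big1 ?addr0 ?mxE ?eqxx ?scale1r// => k ki.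
  by rewrite mxE eq_sym (negPf ki) scale0r.
by apply: (big_morph _ C01M_cstD); exact: C01MP.
Qed.

End FunctionAlgebra.

Section PointEvaluations.
Variables (R : realType) (n N r : nat) (T : 'I_r -> 'M[R[i]]_(N.+1, n.+1)).
Variable s : 'I_r -> unit_itv R.
Hypothesis fT : frame T.

Definition pointeval (a : C01M R n) : 'M[R[i]]_N.+1 := blockmx2 T T (fun i => a (s i)).

Lemma ex_pointeval : exists2 phi : {lrmorphism C01M R n -> 'M[R[i]]_N.+1},
  starhom phi & forall a, phi a = pointeval a.
Proof.
have [|||| phi phiE] := @ex_lrmorphism R (C01M R n) 'M[R[i]]_N.+1 pointeval.
- by move=> a b; exact: blockmx2D.
- by move=> z a; exact: blockmx2Z.
- exact: blockmx2_1.
- by move=> a b; rewrite /pointeval blockmx2M.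
by exists phi => // a; rewrite !phiE; apply: esym; exact: blockmx2_adj.
Qed.

End PointEvaluations.

(** The vectors [v i] form a basis of the corner [P], and [z a] carries this corner to the [a]-th
    one; [T i] sends the basis vector [a] to [z a *m v i]. *)
Lemma frame_of_units (R : realType) (N n r : nat) (z : 'I_n.+1 -> 'M[R[i]]_N.+1)
    (P : 'M[R[i]]_N.+1) (v : 'I_r -> 'cV[R[i]]_N.+1) :
  (forall a b, star (z a) * z b = (a == b)%:R *: P) ->
  (forall a, z a * P = z a) -> \sum_a z a * star (z a) = 1 ->
  (forall i k, (v i)^t* *m v k = (i == k)%:R%:M) -> \sum_i v i *m (v i)^t* = P ->
  exists2 T : 'I_r -> 'M[R[i]]_(N.+1, n.+1), frame T &
    forall a b (c : 'I_r -> R[i]), blockmx2 T T (fun i => c i *: delta_mx a b) =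
      z a * (\sum_i c i *: (v i *m (v i)^t*)) * star (z b).
Proof.
move=> zz zP z1 vv vP; pose T i := \sum_a z a *m v i *m delta_mx 0 a.
have d1 : delta_mx 0 0 = 1%:M :> 'M[R[i]]_1.
  by apply/matrixP => i j; rewrite !mxE !ord1.
have Td i a : T i *m delta_mx a 0 = z a *m v i.
  rewrite /T mulmx_suml (bigD1 a)//= big1 ?addr0 => [|b ba]; rewrite -mulmxA.
    by rewrite mul_delta_mx d1 mulmx1.
  by rewrite mul_delta_mx_0// mulmx0.
have Pv i : P *m v i = v i.
  rewrite -vP mulmx_suml (bigD1 i)//= big1 ?addr0 => [|k ki].
    by rewrite -mulmxA vv eqxx mulmx1.
  by rewrite -mulmxA vv (negPf ki) mul_mx_scalar scale0r.
have TdT i k a b : T i *m delta_mx a b *m (T k)^t* = z a *m (v i *m (v k)^t*) *m (z b)^t*.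
  have -> : delta_mx a b = delta_mx a 0 *m (delta_mx b (0 : 'I_1))^t* :> 'M[R[i]]_n.+1.
    by rewrite trmx_delta map_delta_mx mul_delta_mx.
  by rewrite (mulmxA (T i)) Td -(mulmxA _ _ ((T k)^t*)) -adjM Td adjM !mulmxA.
have bl a b (c : 'I_r -> R[i]) : blockmx2 T T (fun i => c i *: delta_mx a b) =
      z a * (\sum_i c i *: (v i *m (v i)^t*)) * star (z b).
  rewrite mulr_sumr mulr_suml; apply: eq_bigr => i _.
  by rewrite -scalemxAr -scalemxAl TdT -scalerAr -scalerAl.
exists T => //; split.
  move=> i k; apply/matrixP => a b.
  have -> : ((T i)^t* *m T k) a b = 
      ((T i *m (delta_mx a 0 : 'cV_n.+1))^t* *m (T k *m (delta_mx b 0 : 'cV_n.+1))) 0 0.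
    rewrite adjM -mulmxA (mulmxA _ (T k)) trmx_delta map_delta_mx.
    by rewrite -rowE -colE !mxE; apply: eq_bigr.
  rewrite !Td adjM -mulmxA (mulmxA _ (z b)).
  rewrite -[X in _ *m (X *m _)]/(star (z a) * z b) zz -scalemxAl Pv -scalemxAr vv !mxE eqxx.
  by case: (a == b); case: (i == k); rewrite ?mul1r ?mul0r ?mulr0.
have -> : \sum_i T i *m (T i)^t* = \sum_a blockmx2 T T (fun i => 1 *: delta_mx a a).
  rewrite exchange_big; apply: eq_bigr => i _ /=.
  rewrite -mulmx_suml -mulmx_sumr; congr (_ *m _); rewrite -[LHS]mulmx1; congr (_ *m _).
  rewrite [LHS]matrix_sum_delta; apply: eq_bigr => a _.
  rewrite (bigD1 a)//= big1 ?addr0 ?mxE ?eqxx// => b ba.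
  by rewrite mxE eq_sym (negPf ba) scale0r.
rewrite -[RHS]z1; apply: eq_bigr => a _; rewrite bl.
by under eq_bigr do rewrite scale1r; rewrite vP zP.
Qed.

(** * Finite-dimensional approximation of homomorphisms into a UHF algebra *)

Section Approximation.
Variables (R : realType) (M : cstarAlgType R) (k : nat -> nat).
Variable phi : forall j, {lrmorphism 'M[R[i]]_((k j).+1) -> M}.
Hypothesis ephi : forall j, matrix_embedding (phi j).
Hypothesis nest : forall j X, exists Y, phi j.+1 Y = phi j X.
Hypothesis dense : forall a (e : R), 0 < e -> exists j X, cnorm (a - phi j X) < e.
Local Notation B j := ('M[R[i]]_((k j).+1) : cstarAlgType R).

Lemma nested_le j j' X : (j <= j')%N -> exists Y, phi j' Y = phi j X.
Proof.
move=> /subnKC <-; elim: (j' - j)%N => [|d [Y IH]]; first by rewrite addn0; exists X.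
by have [Z ZY] := nest Y; rewrite addnS; exists Z; rewrite ZY.
Qed.

(** Each stage supplies a near-minimizer of the distance to [x], with slack [j.+1%:R^-1] since the
    infimum need not be attained. Nestedness makes these distances tend to 0. *)
Lemma ex_approximants (x : M) : exists X : forall j, B j, cvgc (fun j => phi j (X j)) x.
Proof.
pose D j := [set cnorm (x - phi j Y) | Y in [set: B j]].
have D_inf j : has_inf (D j).
  split; first by exists (cnorm (x - phi j 0)), 0.
  by exists 0 => _ [Y _ <-]; exact: cnorm_ge0.
have XD j : exists Y : B j, cnorm (x - phi j Y) < inf (D j) + j.+1%:R^-1.
  have j0 : 0 < j.+1%:R^-1 :> R by rewrite invr_gt0.
  by have [_ [Y _ <-] YD] := inf_adherent j0 (D_inf j); exists Y.
exists (fun j => sval (cid (XD j))) => e e0.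
have e20 : 0 < e / 2 by rewrite divr_gt0.
have [J [Y YJ]] := dense x e20.
near=> j; rewrite cnormB; apply: lt_le_trans (svalP (cid (XD j))) _.
rewrite [leRHS]splitr lerD//.
  apply: le_trans (ltW YJ); have Jj : (J <= j)%N by near: j; exists J.
  have [Z <-] := nested_le Y Jj.
  by apply: ge_inf; [case: (D_inf j)|exists Z].
apply/ltW; near: j.
by have /cvgrPdist_lt/(_ _ e20) := @cvg_harmonic R; apply: filterS => j;
  rewrite sub0r normrN ger0_norm// harmonic_ge0.
Unshelve. all: by end_near. Qed.

Variables (n : nat) (pi : {lrmorphism C01M R n -> M}).
Hypothesis spi : starhom pi.
Local Notation unit a b := (C01M_cst (delta_mx a b : 'M[R[i]]_n.+1)).

Lemma unitM (a b c d : 'I_n.+1) : unit a b * unit c d = (b == c)%:R *: unit a d.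
Proof. by rewrite -C01M_cstM delta_mx_mulr C01M_cstZ. Qed.

Lemma unit_star (a b : 'I_n.+1) : star (unit a b) = unit b a.
Proof. by rewrite -C01M_cst_star trmx_delta map_delta_mx. Qed.

(** On [0,1] the coordinate stays within 1/2 of 1/2. Centering there keeps the compressed spectrum
    well away from the eigenvalue -1 that [corner_eigenbasis] reserves for the kernel of the
    projection. *)
Lemma cnorm_unit_corner : cnorm (unit 0 0 * (coord R n - (2^-1 : R)%:C *: 1) * unit 0 0) <= 2^-1.
Proof.
have u1 : cnorm (unit 0 0) <= 1.
  apply: le_trans (cnorm_cst _) _; rewrite -[opnorm _]/(cnorm _).
  have := cnorm_star (delta_mx 0 0 : 'M[R[i]]_n.+1).
  rewrite star_delta_mx delta_mx_mulr eqxx scale1r => /eqP.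
  rewrite expr2 -subr_eq0 -{1}[cnorm _]mul1r -mulrBl mulf_eq0 subr_eq0.
  by case/orP => /eqP => [<-|->].
have c2 : cnorm (coord R n - (2^-1 : R)%:C *: 1) <= 2^-1.
  apply: supnorm_le => t; rewrite -[X in opnorm X]/((itv_val t)%:C%:M - (2^-1 : R)%:C *: 1%:M).
  rewrite scalemx1 -raddfB/= -rmorphB opnorm_real_scalar ler_norml.
  have /andP[] := unit_itvP t; move=> a b; apply/andP; split; lra.
have := cnormM_le (cnormM_le u1 c2) u1; rewrite mul1r mulr1; exact.
Qed.

(** Matrix units are made exact first; the coordinate commutes with them, so only its compression to
    one corner has to be diagonalized. Validity for all large [j] allows two homomorphisms to share
    a stage. *)
Lemma approx_generators (e : R) : 0 < e -> \forall j \near \oo,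
  exists r (T : 'I_r -> 'M[R[i]]_((k j).+1, n.+1)) (s : 'I_r -> unit_itv R),
  [/\ frame T, forall i i' : 'I_r, (i <= i')%N -> itv_val (s i) <= itv_val (s i'),
      forall a b, cnorm (pi (unit a b) - phi j (blockmx2 T T (fun=> delta_mx a b))) < e &
      cnorm (pi (coord R n) - phi j (blockmx2 T T (fun i => (itv_val (s i))%:C%:M))) < e].
Proof.
move=> e0; have sphi j : starhom (phi j) by exact: matrix_embedding_starhom.
have iso j (x : B j) : cnorm (phi j x) = cnorm x by exact: matrix_embedding_isometric.
pose E a := pi (unit a 0); pose p := pi (unit 0 0); pose H := pi (coord R n).
have /choice[X XE] : forall a, exists X : forall j, B j, cvgc (fun j => phi j (X j)) (E a).
  by move=> a; exact: ex_approximants.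
have [h0 h0H] := ex_approximants H.
pose h j : B j := (2^-1 : R)%:C *: (h0 j + star (h0 j)).
have sH : star H = H by rewrite -spi C01M_real_star.
have hH : tends (B := fun j => B j) phi h H.
  rewrite -[H]halfD; apply: tendsZ; apply: tendsD => //.
  by rewrite -sH; apply: tends_star.
have EE a b : star (E a) * E b = (a == b)%:R *: p.
  by rewrite -spi unit_star -rmorphM unitM [LHS]linearZ.
have Ep a : E a * p = E a by rewrite -rmorphM unitM eqxx scale1r.
have pp : p * p = p by rewrite -rmorphM unitM eqxx scale1r.
have sp : star p = p by rewrite -spi unit_star.
have Esum : \sum_a E a * star (E a) = 1.
  rewrite -(rmorph1 pi) -C01M_cst_delta_sum raddf_sum; apply: eq_bigr => a _.
  by rewrite -spi unit_star -rmorphM unitM eqxx scale1r.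
have [P [z [Pp zE exact_j]]] :=
  ex_perturbed_units (B := fun j => B j) sphi iso EE Ep pp Esum XE.
pose b j := P j * h j * P j.
have bH : tends (B := fun j => B j) phi b (p * H * p).
  exact: tendsM (tendsM Pp hH) Pp.
(* The bound [e / 2] pays for clamping the eigenvalues; the bound [2^-1] keeps [2^-1 + eta] below
   the 3/2 of [corner_eigenbasis]. *)
pose eta := Num.min (e / 2) 2^-1.
have eta0 : 0 < eta by rewrite lt_min divr_gt0//= invr_gt0.
have bhalf : \forall j \near \oo, cnorm (b j - (2^-1 : R)%:C *: P j : B j) <= 2^-1 + eta.
  have : tends (B := fun j => B j) phi (fun j => b j - (2^-1 : R)%:C *: P j)
      (p * H * p - (2^-1 : R)%:C *: p).
    by apply: tendsB => //; exact: tendsZ.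
  move=> /(_ _ eta0); apply: filterS => j bj.
  have l2 : cnorm (p * H * p - (2^-1 : R)%:C *: p) <= 2^-1.
    have -> : p * H * p - (2^-1 : R)%:C *: p =
        pi (unit 0 0 * (coord R n - (2^-1 : R)%:C *: 1) * unit 0 0).
      have pi1 : pi ((2^-1 : R)%:C *: 1) = (2^-1 : R)%:C *: 1.
        by rewrite -[in RHS](rmorph1 pi); exact: linearZ.
      rewrite !rmorphM/= raddfB/= pi1 mulrBr mulrBl; congr (_ - _).
      by rewrite -scalerAr mulr1 -scalerAl pp.
    exact: le_trans (starhom_contractive spi _) cnorm_unit_corner.
  rewrite -iso -[phi j _](subrK (p * H * p - (2^-1 : R)%:C *: p)) addrC.
  by apply: cnormD_le => //; exact: ltW.
(* Since [H] commutes with the images of the matrix units, it is the sum of the copies of its corner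
   [p * H * p]. *)
have zbz : tends (B := fun j => B j) phi (fun j => \sum_a z a j * b j * star (z a j)) H.
  have -> : H = \sum_a E a * (p * H * p) * star (E a).
    rewrite -[LHS]mul1r -Esum mulr_suml; apply: eq_bigr => a _.
    have pE : p * star (E a) = star (E a) by rewrite -{1}sp -starM Ep.
    rewrite !mulrA Ep -!mulrA pE; congr (_ * _).
    by rewrite -spi -!rmorphM C01M_real_comm.
  apply: tends_sum => a; apply: tendsM; last exact: tends_star.
  exact: tendsM.
have zz a c : tends (B := fun j => B j) phi (fun j => z a j * star (z c j)) (pi (unit a c)).
  have -> : pi (unit a c) = E a * star (E c).
    by rewrite -spi unit_star -rmorphM unitM eqxx scale1r.
  by apply: tendsM => //; exact: tends_star.
have zze : \forall j \near \oo, forall ac : 'I_n.+1 * 'I_n.+1,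
    cnorm (phi j (z ac.1 j * star (z ac.2 j)) - pi (unit ac.1 ac.2)) < e.
  by apply: filter_forall => -[a c] /=; exact: (zz a c e e0).
have e20 : 0 < e / 2 by rewrite divr_gt0.
near=> j.
have [sP PP zzP zP z1] : [/\ star (P j) = P j, P j * P j = P j,
      forall i l, star (z i j) * z l j = (i == l)%:R *: P j,
      forall i, z i j * P j = z i j & \sum_i z i j * star (z i j) = 1].
  by near: j; exact: exact_j.
have sh : star (h j) = h j by rewrite /h starZr starD starK addrC.
have sb : star (b j) = b j by rewrite /b !starM sP sh mulrA.
have Pb : P j * b j = b j by rewrite /b !mulrA PP.
have bP : b j * P j = b j by rewrite /b -!mulrA PP.
have [||r [v [s [vv vP vs s_homo s_bound]]]] :=
    corner_eigenbasis (c := 2^-1 + eta) sP PP sb Pb bP.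
- by near: j; exact: bhalf.
- have : eta <= 2^-1 by rewrite /eta ge_min lexx orbT.
  lra.
have [T fT Tz] := frame_of_units zzP zP z1 vv vP.
(* The eigenvalues lie in [0,1] only up to [eta]; clamping moves each of them by at most [eta] and
   keeps their order. *)
exists r, T, (fun i => unit_itv_clamp (s i)); split=> //.
- by move=> i i' /s_homo; exact: clamp_homo.
- move=> a c.
  have -> : blockmx2 T T (fun=> delta_mx a c) = z a j * star (z c j).
    transitivity (blockmx2 T T (fun=> 1 *: delta_mx a c)).
      by apply: eq_bigr => i _; rewrite scale1r.
    by rewrite Tz; under eq_bigr do rewrite scale1r; rewrite vP zP.
  rewrite cnormB.
  suff /(_ (a, c)) : forall ac : 'I_n.+1 * 'I_n.+1,
    cnorm (phi j (z ac.1 j * star (z ac.2 j)) - pi (unit ac.1 ac.2)) < e by [].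
  by near: j; exact: zze.
have -> : blockmx2 T T (fun i => (clamp (s i))%:C%:M) =
    \sum_a z a j * b j * star (z a j) -
    blockmx2 T T (fun i => (s i - clamp (s i))%:C%:M).
  rewrite -vs; under [X in _ = X - _]eq_bigr do rewrite -Tz.
  rewrite exchange_big/=.
  have -> : \sum_i \sum_a T i *m ((s i)%:C *: delta_mx a a) *m (T i)^t* =
      blockmx2 T T (fun i => (s i)%:C%:M).
    apply: eq_bigr => i _; rewrite -mulmx_suml -mulmx_sumr; congr (_ *m _ *m _).
    rewrite -scaler_sumr -scalemx1; congr (_ *: _).
    rewrite [RHS]matrix_sum_delta; apply: eq_bigr => a _.
    rewrite (bigD1 a)//= big1 ?addr0 ?mxE ?eqxx ?scale1r// => c ca.
    by rewrite mxE eq_sym (negPf ca) scale0r.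
  rewrite -blockmx2B; apply: eq_bigr => i _; congr (_ *m _ *m _).
  by rewrite rmorphB raddfB/= subKr.
have ble : opnorm (blockmx2 T T (fun i => (s i - clamp (s i))%:C%:M)) <= e / 2.
  apply: opnorm_blockmx2_scalar => //; first exact: ltW.
  move=> i; apply: clamp_dist; first exact: ltW.
  by apply: le_trans (s_bound i) _; rewrite lerD2l /eta ge_min lexx.
rewrite raddfB/= opprB addrC -addrA; apply: le_lt_trans (cnormD _ _) _.
rewrite [e]splitr; apply: ler_ltD; first by rewrite matrix_embedding_isometric.
by rewrite addrC cnormB; near: j; exact: zbz.
Unshelve. all: by end_near. Qed.

End Approximation.

(** * Bernstein approximation and generators *)

Section UniformContinuity.
Variables (R : realType) (n : nat).
Local Notation I01 := (unit_itv R).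

Lemma nbhs_unit_itv (x : I01) (U : set I01) : nbhs x U ->
  exists2 d : R, 0 < d & forall y, `|itv_val x - itv_val y| < d -> U y.
Proof.
rewrite nbhsE => -[V [[W oW WV] Vx] VU].
have : nbhs (itv_val x) W by apply: open_nbhs_nbhs; split => //; rewrite -WV in Vx.
move=> /nbhs_ballP[d /= d0 dW]; exists d => // y xy.
by apply: VU; rewrite -WV; apply: dW.
Qed.

Lemma C01M_unif_continuous (a : C01M R n) (e : R) : 0 < e ->
  exists2 d : R, 0 < d &
    forall x y : I01, `|itv_val x - itv_val y| < d -> opnorm (a x - a y) < e.
Proof.
move=> e0; have e20 : 0 < e / 2 by rewrite divr_gt0.
have cI : compact [set: I01] by apply: compact_set_type; exact: segment_compact.
pose P (d : R) (x : I01) :=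
  forall y, `|itv_val x - itv_val y| < d -> opnorm (a x - a y) < e.
have cover x : [set: I01] x -> \forall x' \near x & d \near 0^'+, P d x'.
  move=> _; have /continuous_opnormP/(_ x _ e20)/nbhs_unit_itv[d d0 dx] :=
    @C01M_continuous R n a.
  have d20 : 0 < d / 2 by rewrite divr_gt0.
  exists ([set x' | `|itv_val x - itv_val x'| < d / 2], [set r : R | r < d / 2]).
    split=> /=; last exact: nbhs_right_lt.
    by have /cvgrPdist_lt/(_ _ d20) := @continuous_unit_itv_val R x.
  move=> [x' r] /= [xx' rd] y x'y.
  have : opnorm (a x' - a y) <= opnorm (a x' - a x) + opnorm (a x - a y).
    exact: (@cnorm_triangle R 'M[R[i]]_n.+1).
  rewrite [X in _ <= X + _]opnormB.
  move=> /le_lt_trans; apply; rewrite [e]splitr ltrD//; apply: dx.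
    by apply: lt_trans xx' _; rewrite [ltRHS]splitr ltrDl.
  apply: le_lt_trans (ler_distD (itv_val x') _ _) _.
  by rewrite [d]splitr ltrD//; exact: lt_trans rd.
have H : \forall d \near 0^'+, [set: I01] `<=` P d.
  exact: (proj1 (compact_near_coveringP _) cI R (0^'+) P _ cover).
have [d [dP d0]] := @filter_ex _ 0^'+ _ _ (filterI H (nbhs_right_gt (0 : R))).
by exists d => // x y; exact: dP.
Qed.

(** A bound quadratic in [y] is what Bernstein operators evaluate exactly. Beyond the distance [d]
    of uniform continuity, the trivial bound 2 |a| is absorbed by 2 |a| (x - y)^2 / d^2. *)
Lemma C01M_quadratic_modulus (a : C01M R n) (e : R) : 0 < e ->
  exists2 C : R, 0 <= C &
    forall x y : I01, opnorm (a x - a y) <= e + C * (itv_val x - itv_val y) ^+ 2.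
Proof.
move=> /(C01M_unif_continuous a)[d d0 ad].
have C0 : 0 <= (cnorm a + cnorm a) / d ^+ 2.
  by rewrite divr_ge0 ?exprn_ge0 ?addr_ge0 ?cnorm_ge0// ltW.
exists ((cnorm a + cnorm a) / d ^+ 2) => // x y.
have [/ad/ltW xy|xy] := ltP `|itv_val x - itv_val y| d.
  by apply: le_trans xy _; rewrite lerDl mulr_ge0// sqr_ge0.
have e0 : 0 < e by have := ad x x; rewrite !subrr normr0 opnorm0 => ->.
apply: (@le_trans _ _ (cnorm a + cnorm a)).
  apply: le_trans (opnormD _ _) _; rewrite opnormN.
  by apply: lerD; exact: opnorm_le_supnorm.
apply: le_trans (_ : (cnorm a + cnorm a) / d ^+ 2 * (itv_val x - itv_val y) ^+ 2 <= _).
  rewrite mulrAC ler_pdivlMr ?exprn_gt0// ler_wpM2l ?addr_ge0 ?cnorm_ge0//.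
  by rewrite -[leRHS]real_normK ?num_real// lerXn2r ?nnegrE// ltW.
by rewrite lerDr ltW.
Qed.

End UniformContinuity.

Section Bernstein.
Variable R : realType.

(* Bernstein operators by the binomial-tree recursion: the value at [x] of the
   [m]-th Bernstein polynomial of a function with values [f k] at [k / m]. *)
Fixpoint bernR (m : nat) (x : R) (f : nat -> R) : R :=
  if m is m'.+1 then x * bernR m' x (f \o S) + (1 - x) * bernR m' x f else f 0%N.

Lemma bernR_le m x f g : 0 <= x <= 1 -> (forall k, (k <= m)%N -> f k <= g k) ->
  bernR m x f <= bernR m x g.
Proof.
move=> /andP[x0 x1]; elim: m f g => [|m IH] f g fg /=; first exact: fg.
apply: lerD; apply: ler_wpM2l; rewrite ?subr_ge0//; apply: IH => k km.
  exact: fg.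
by apply: fg; exact: leqW.
Qed.

(** These are the first two moments of the binomial distribution with parameters [m] and [x]. *)
Lemma bernR_quadratic m x (a b c : R) :
  bernR m x (fun k => a + b * k%:R + c * k%:R ^+ 2) =
  a + b * (m%:R * x) + c * (m%:R * (x * (1 - x)) + m%:R ^+ 2 * x ^+ 2).
Proof.
elim: m a b c => [|m IH] a b c; first by rewrite /= !mul0r expr0n/= !mul0r addr0.
rewrite [LHS]/=; have -> : (fun k => a + b * k%:R + c * k%:R ^+ 2) \o S =
    (fun k => (a + b + c) + (b + 2 * c) * k%:R + c * k%:R ^+ 2).
  by apply/funext => k /=; rewrite -natr1; ring.
by rewrite !IH -natr1; ring.
Qed.

Lemma bernR_ge0 m x f : 0 <= x <= 1 -> (forall k, 0 <= f k) -> 0 <= bernR m x f.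
Proof.
move=> x01 f0; have := bernR_quadratic m x 0 0 0; rewrite !mul0r !addr0 => <-.
by apply: bernR_le => // k _; rewrite !mul0r !addr0.
Qed.

Variable n : nat.
Local Notation C := (C01M R n).

(** The same recursion with coefficients in the algebra; it exhibits the result as a polynomial
    expression in the coordinate and the coefficients. *)
Fixpoint bern (m : nat) (f : nat -> C) : C :=
  if m is m'.+1 then coord R n * bern m' (f \o S) + (1 - coord R n) * bern m' f
  else f 0%N.

Lemma bern_eval_real m (f : nat -> C) (g : nat -> R) t :
  (forall k, f k t = (g k)%:C%:M) -> bern m f t = (bernR m (itv_val t) g)%:C%:M.
Proof.
elim: m f g => [|m IH] f g fg /=; first exact: fg.
rewrite -[LHS]/((itv_val t)%:C%:M *m bern m (f \o S) t +
  (1%:M - (itv_val t)%:C%:M) *m bern m f t).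
rewrite (IH _ (g \o S)) ?(IH _ g)// => [|k]; last exact: fg.
rewrite -raddfB/= -!scalar_mxM -raddfD/=; congr (_%:M).
by rewrite rmorphD !rmorphM rmorphB rmorph1.
Qed.

Lemma bern_dist m (f : nat -> C) (X : 'M[R[i]]_n.+1) t :
  opnorm (X - bern m f t) <= bernR m (itv_val t) (fun k => opnorm (X - f k t)).
Proof.
elim: m f => [|m IH] f//=.
rewrite -[X in opnorm (_ - X)]/((itv_val t)%:C%:M *m bern m (f \o S) t +
  (1%:M - (itv_val t)%:C%:M) *m bern m f t).
have /andP[t0 t1] := unit_itvP t.
have -> : 1%:M - (itv_val t)%:C%:M = (1 - itv_val t)%:C%:M :> 'M[R[i]]_n.+1.
  by rewrite rmorphB raddfB/= rmorph1.
rewrite !mul_scalar_mx.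
have -> : X - ((itv_val t)%:C *: bern m (f \o S) t + (1 - itv_val t)%:C *: bern m f t) =
    (itv_val t)%:C *: (X - bern m (f \o S) t) + (1 - itv_val t)%:C *: (X - bern m f t).
  rewrite !scalerBr addrACA -scalerDl -rmorphD/= (addrC (itv_val t)) subrK.
  by rewrite scale1r opprD.
apply: le_trans (opnormD _ _) _; rewrite !opnormZ !normc_real !ger0_norm ?subr_ge0//.
by apply: lerD; rewrite ler_wpM2l ?subr_ge0//; exact: IH.
Qed.

Definition grid m k : unit_itv R := unit_itv_clamp (k%:R / m%:R).
Definition bernstein m (a : C) : C := bern m (fun k => C01M_cst (a (grid m k))).

Lemma clamp_id (x : R) : 0 <= x <= 1 -> clamp x = x.
Proof. by move=> /andP[x0 x1]; rewrite /clamp min_r// max_r. Qed.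

Lemma bernstein_cvg (a : C) (e : R) : 0 < e ->
  \forall m \near \oo, cnorm (a - bernstein m a) <= e.
Proof.
move=> e0; have e20 : 0 < e / 2 by rewrite divr_gt0.
have [K K0 aK] := C01M_quadratic_modulus a e20.
have K10 : 0 < K + 1 by rewrite ltr_wpDl.
near=> m; have m0 : (0 < m)%N by near: m; exists 1%N.
have mR : 0 < m%:R :> R by rewrite ltr0n.
apply: supnorm_le => t; apply: le_trans (bern_dist _ _ _ _) _ => /=.
have /andP[t0 t1] := unit_itvP t; set x := itv_val t in t0 t1 *.
(* Coefficients in [k] of e/2 + K (x - k/m)^2. Averaging leaves the variance term K x (1 - x) / m,
   which vanishes as [m] grows. *)
pose b := - (2 * K * x / m%:R); pose c := K / m%:R ^+ 2.
apply: (@le_trans _ _ (bernR m x (fun k => (e / 2 + K * x ^+ 2) + b * k%:R + c * k%:R ^+ 2))).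
  apply: bernR_le; first by rewrite t0.
  move=> k km; apply: le_trans (aK _ _) _; rewrite unit_itv_clampE clamp_id; last first.
    by rewrite divr_ge0//= ler_pdivrMr// mul1r ler_nat.
  rewrite le_eqVlt; apply/orP; left; apply/eqP.
  by rewrite /b /c -/x; field; rewrite lt0r_neq0.
rewrite bernR_quadratic /b /c.
have -> : e / 2 + K * x ^+ 2 + - (2 * K * x / m%:R) * (m%:R * x) +
    K / m%:R ^+ 2 * (m%:R * (x * (1 - x)) + m%:R ^+ 2 * x ^+ 2) =
    e / 2 + K * (x * (1 - x)) / m%:R by field; rewrite lt0r_neq0.
rewrite [leRHS]splitr lerD2l ler_pdivrMr//.
apply: (@le_trans _ _ (K + 1)).
  apply: (@le_trans _ _ (K * 1)); last by rewrite mulr1 lerDl.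
  by rewrite ler_wpM2l//; nra.
rewrite -ler_pdivrMl//; near: m.
exact: nbhs_infty_ger.
Unshelve. all: by end_near. Qed.

Lemma bernD m f g : bern m (fun k => f k + g k) = bern m f + bern m g.
Proof.
elim: m f g => [|m IH] f g//=; rewrite (IH (f \o S) (g \o S)) IH !mulrDr.
by rewrite addrACA.
Qed.

Lemma bern_sum m (I : finType) (F : I -> nat -> C) :
  bern m (fun k => \sum_i F i k) = \sum_i bern m (F i).
Proof.
have b0 : bern m (fun=> 0) = 0.
  by elim: m => [|m IH]//=; rewrite IH !mulr0 addr0.
have : forall s : seq I, bern m (fun k => \sum_(i <- s) F i k) = \sum_(i <- s) bern m (F i).
  elim=> [|i s IH]; first by rewrite big_nil -[RHS]b0; congr bern; apply/funext => k; rewrite big_nil.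
  rewrite big_cons -IH -bernD; congr bern; apply/funext => k.
  by rewrite big_cons.
by move=> /(_ (index_enum I)).
Qed.

Lemma bernMr m f (a : C) : bern m (fun k => f k * a) = bern m f * a.
Proof.
elim: m f => [|m IH] f//=; rewrite (IH f).
have -> : bern m ((fun k => f k * a) \o S) = bern m (f \o S) * a by exact: IH.
by rewrite [RHS]mulrDl !mulrA.
Qed.

Lemma bern_ext m f g : (forall k, (k <= m)%N -> f k = g k) -> bern m f = bern m g.
Proof.
elim: m f g => [|m IH] f g fg /=; first exact: fg.
have -> : bern m (f \o S) = bern m (g \o S) by apply: IH => k km; exact: fg.
by rewrite (IH f g)// => k km; apply: fg; exact: leqW.
Qed.

(** Kronecker data give the Bernstein basis polynomial binom(m,k) x^k (1-x)^(m-k): a nonnegative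
    scalar function, and a partition of unity over k <= m. *)
Definition bernw m (k : nat) : C := bern m (fun l => (l == k)%:R).

Lemma bernstein_weights m (a : C) :
  bernstein m a = \sum_(k < m.+1) bernw m k * C01M_cst (a (grid m k)).
Proof.
rewrite /bernstein /bernw.
under eq_bigr do rewrite -bernMr.
rewrite -bern_sum; apply: bern_ext => k km.
rewrite (bigD1 (Ordinal (km : (k < m.+1)%N)))//= eqxx mul1r big1 ?addr0// => i ik.
by rewrite eq_sym (_ : (i == k :> nat) = false) ?mul0r//; apply/negbTE.
Qed.

Lemma bernw_sum m : \sum_(k < m.+1) bernw m k = 1.
Proof.
have := bernstein_weights m 1; rewrite /bernstein => H.
transitivity (bern m (fun=> 1)).
  have -> : (fun=> 1) = (fun k => C01M_cst ((1 : C) (grid m k))).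
    by apply/funext => k; exact: C01MP.
  by rewrite H; apply: eq_bigr => k _; rewrite [C01M_cst _]C01M_cst1 mulr1.
by elim: m {H} => [|m IH]//=; rewrite IH !mulr1 addrC subrK.
Qed.

Lemma bernw_eval m k t :
  bernw m k t = (bernR m (itv_val t) (fun l => (l == k)%:R))%:C%:M.
Proof.
apply: bern_eval_real => l; case: (l == k).
  by rewrite rmorph1.
by rewrite rmorph0 raddf0.
Qed.

End Bernstein.

Section GeneratorControl.
Variables (R : realType) (M : cstarAlgType R) (n : nat).
Local Notation C := (C01M R n).
Local Notation unit a b := (C01M_cst (delta_mx a b : 'M[R[i]]_n.+1)).

Definition gen_close (d : R) (pi pi' : {lrmorphism C -> M}) : Prop :=
  (forall a b, cnorm (pi (unit a b) - pi' (unit a b)) < d) /\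
  cnorm (pi (coord R n) - pi' (coord R n)) < d.

(** The tolerance [d] depends on [a] and [e] but not on the homomorphisms. This uniformity reduces
    every comparison to the matrix units and the coordinate. *)
Definition gen_controlled (a : C) : Prop := forall e : R, 0 < e ->
  exists2 d : R, 0 < d & forall pi pi' : {lrmorphism C -> M},
    starhom pi -> starhom pi' -> gen_close d pi pi' -> cnorm (pi a - pi' a) < e.

Lemma gen_close_le d d' pi pi' : d <= d' -> gen_close d pi pi' -> gen_close d' pi pi'.
Proof.
move=> dd' [pu pc]; split; last exact: lt_le_trans dd'.
by move=> a b; exact: lt_le_trans dd'.
Qed.

Lemma gen_controlledD a b : gen_controlled a -> gen_controlled b -> gen_controlled (a + b).
Proof.
move=> ca cb e e0; have e20 : 0 < e / 2 by rewrite divr_gt0.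
have [d d0 da] := ca _ e20; have [d' d'0 db] := cb _ e20.
exists (Num.min d d'); first by rewrite lt_min d0.
move=> pi pi' sp sp' pp'; rewrite (raddfD pi) (raddfD pi') opprD addrACA.
apply: le_lt_trans (cnormD _ _) _; rewrite [e]splitr; apply: ltrD.
  by apply: da => //; apply: gen_close_le pp'; rewrite ge_min lexx.
by apply: db => //; apply: gen_close_le pp'; rewrite ge_min lexx orbT.
Qed.

Lemma gen_controlledZ z a : gen_controlled a -> gen_controlled (z *: a).
Proof.
move=> ca e e0; have z0 : 0 < normc z + 1 by rewrite ltr_wpDl ?normc_ge0.
have [d d0 da] := ca _ (divr_gt0 e0 z0); exists d => // pi pi' sp sp' pp'.
have -> : pi (z *: a) - pi' (z *: a) = z *: (pi a - pi' a).
  by rewrite scalerBr; congr (_ - _); exact: linearZ.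
rewrite cnormZ.
apply: (@le_lt_trans _ _ (normc z * (e / (normc z + 1)))).
  by rewrite ler_wpM2l ?normc_ge0//; apply/ltW/da.
by rewrite mulrCA gtr_pMr// ltr_pdivrMr// mul1r ltrDl.
Qed.

Lemma gen_controlledM a b : gen_controlled a -> gen_controlled b -> gen_controlled (a * b).
Proof.
move=> ca cb e e0; pose c := cnorm a + cnorm b + 1.
have c0 : 0 < c by rewrite ltr_wpDl// addr_ge0// cnorm_ge0.
have [d d0 da] := ca _ (divr_gt0 e0 c0); have [d' d'0 db] := cb _ (divr_gt0 e0 c0).
exists (Num.min d d'); first by rewrite lt_min d0.
move=> pi pi' sp sp' pp'; rewrite (rmorphM pi) (rmorphM pi').
have -> : pi a * pi b - pi' a * pi' b = pi a * (pi b - pi' b) + (pi a - pi' a) * pi' b.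
  by rewrite mulrBr mulrBl addrA subrK.
apply: (@le_lt_trans _ _ (cnorm a * (e / c) + (e / c) * cnorm b)).
  apply: cnormD_le; apply: cnormM_le; rewrite ?starhom_contractive//; apply/ltW.
    by apply: db => //; apply: gen_close_le pp'; rewrite ge_min lexx orbT.
  by apply: da => //; apply: gen_close_le pp'; rewrite ge_min lexx.
rewrite [X in _ + X]mulrC -mulrDl mulrCA gtr_pMr// ltr_pdivrMr// mul1r.
by rewrite /c ltrDl.
Qed.

Lemma gen_controlled_closure a :
  (forall e : R, 0 < e -> exists2 b, gen_controlled b & cnorm (a - b) <= e) ->
  gen_controlled a.
Proof.
move=> ab e e0; have e30 : 0 < e / 3 by rewrite divr_gt0.
have [b cb abe] := ab _ e30; have [d d0 db] := cb _ e30.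
exists d => // pi pi' sp sp' pp'.
apply: le_lt_trans (cnorm_triangle (pi b) _ _) _.
have := cnorm_triangle (pi' b) (pi b) (pi' a); have := db _ _ sp sp' pp'.
rewrite -!raddfB/=; have := starhom_contractive sp (a - b).
have := starhom_contractive sp' (b - a); rewrite (cnormB b); lra.
Qed.

Lemma gen_controlled_unit i j : gen_controlled (unit i j).
Proof. by move=> e e0; exists e => // pi pi' _ _ []. Qed.

Lemma gen_controlled_coord : gen_controlled (coord R n).
Proof. by move=> e e0; exists e => // pi pi' _ _ []. Qed.

Lemma gen_controlled0 : gen_controlled 0.
Proof.
by move=> e e0; exists 1 => // pi pi' _ _ _; rewrite (raddf0 pi) (raddf0 pi') subrr cnorm0.
Qed.

Lemma gen_controlled1 : gen_controlled 1.
Proof.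
by move=> e e0; exists 1 => // pi pi' _ _ _; rewrite (rmorph1 pi) (rmorph1 pi') subrr cnorm0.
Qed.

Lemma gen_controlled_sum (I : finType) (F : I -> C) :
  (forall i, gen_controlled (F i)) -> gen_controlled (\sum_i F i).
Proof.
move=> cF; apply: (big_ind gen_controlled) => //; first exact: gen_controlled0.
exact: gen_controlledD.
Qed.

Lemma C01M_cst_sum (X : 'M[R[i]]_n.+1) :
  C01M_cst X = \sum_i \sum_j X i j *: unit i j :> C.
Proof.
have cst0 : C01M_cst (0 : 'M[R[i]]_n.+1) = 0 :> C by exact: C01MP.
rewrite {1}(matrix_sum_delta X) (big_morph _ (@C01M_cstD R n) cst0).
apply: eq_bigr => i _; rewrite (big_morph _ (@C01M_cstD R n) cst0).
by apply: eq_bigr => j _; rewrite C01M_cstZ.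
Qed.

Lemma gen_controlled_cst X : gen_controlled (C01M_cst X).
Proof.
rewrite C01M_cst_sum; do 2 apply: gen_controlled_sum => ?.
by apply: gen_controlledZ; exact: gen_controlled_unit.
Qed.

Lemma gen_controlled_bern m f : (forall k, gen_controlled (f k)) ->
  gen_controlled (bern m f).
Proof.
elim: m f => [|m IH] f cf //=; apply: gen_controlledD; apply: gen_controlledM.
- exact: gen_controlled_coord.
- by apply: IH => k; exact: cf.
- apply: gen_controlledD; first exact: gen_controlled1.
  by rewrite -scaleN1r; apply: gen_controlledZ; exact: gen_controlled_coord.
- exact: IH.
Qed.

(** Bernstein approximants are polynomials in the generators, and contractivity of homomorphisms
    carries the control to norm limits. *)
Lemma gen_controlledT a : gen_controlled a.
Proof.
apply: gen_controlled_closure => e e0.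
have [m am] := @filter_ex _ \oo _ _ (bernstein_cvg a e0).
by exists (bernstein m a) => //; apply: gen_controlled_bern => k; exact: gen_controlled_cst.
Qed.

Lemma gen_controlled_fin (I : finType) (F : I -> C) (e : R) : 0 < e ->
  exists2 d : R, 0 < d & forall pi pi' : {lrmorphism C -> M},
    starhom pi -> starhom pi' -> gen_close d pi pi' ->
    forall i, cnorm (pi (F i) - pi' (F i)) < e.
Proof.
move=> e0; have /choice[d dF] : forall i, exists d : R, 0 < d /\
    forall pi pi' : {lrmorphism C -> M},
    starhom pi -> starhom pi' -> gen_close d pi pi' -> cnorm (pi (F i) - pi' (F i)) < e.
  by move=> i; have [d d0 dP] := gen_controlledT (F i) e0; exists d.
exists (\big[Num.min/1]_i d i).
  by apply: (big_ind (fun x => 0 < x)) => // [x y x0 y0|i _]; [rewrite lt_min x0|have [] := dF i].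
move=> pi pi' sp sp' pp' i; have [_] := dF i; apply => //.
apply: gen_close_le pp'; exact: bigmin_le_cond.
Qed.

End GeneratorControl.

Section Averages.
Variables (R : realType) (n : nat).
Local Notation C := (C01M R n).
Variable tau : {scalar C}.
Hypotheses (tau1 : tau 1 = 1) (tau_pos : forall a, 0 <= tau (star a * a))
  (tauC : forall a b, tau (a * b) = tau (b * a)).

Lemma C01M_positive_sqrt (f : unit_itv R -> R) (cf : continuous f) :
  (forall t, 0 <= f t) -> exists q : C, C01M_real n cf = star q * q.
Proof.
move=> f0; have cg : continuous (fun t => Num.sqrt (f t)).
  by move=> t; apply: continuous_comp; [exact: cf|exact: sqrt_continuous].
exists (C01M_real n cg); rewrite C01M_real_star; apply: C01MP => t.
rewrite -[RHS]/((Num.sqrt (f t))%:C%:M *m (Num.sqrt (f t))%:C%:M) -scalar_mxM.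
by rewrite -rmorphM -expr2 sqr_sqrtr.
Qed.

Lemma tau_real_ge0 (f : unit_itv R -> R) (cf : continuous f) :
  (forall t, 0 <= f t) -> 0 <= tau (C01M_real n cf).
Proof. by move=> /(@C01M_positive_sqrt _ cf)[q ->]. Qed.

Lemma ex_cst_lrmorphism : exists2 phi : {lrmorphism 'M[R[i]]_n.+1 -> C},
  starhom phi & forall X, phi X = C01M_cst X.
Proof.
have [||||phi phiE] := @ex_lrmorphism R 'M[R[i]]_n.+1 C (@C01M_cst R n).
- exact: C01M_cstD.
- exact: C01M_cstZ.
- exact: C01M_cst1.
- exact: C01M_cstM.
by exists phi => // X; rewrite !phiE -C01M_cst_star.
Qed.

Lemma tau_real_cst (a : C) (X : 'M[R[i]]_n.+1) : (forall b, a * b = b * a) ->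
  tau (a * C01M_cst X) = tau a * (\tr X / n.+1%:R).
Proof.
move=> aC; have [phi _ phiE] := ex_cst_lrmorphism.
by rewrite -phiE trace_commuting_mul.
Qed.

End Averages.

(** * Unitary equivalence of homomorphisms with close traces *)

Section Ramps.
Variables (R : realType) (n : nat).

(** Equal to 1 up to k/K, to 0 from (k+1)/K on, and linear in between: a continuous substitute for
    the indicator of an initial segment. *)
Definition rampR (K k : nat) (x : R) : R := clamp (k.+1%:R - K%:R * x).

Lemma clamp_lip (x y : R) : `|clamp x - clamp y| <= `|x - y|.
Proof.
wlog xy : x y / x <= y => [H|].
  by have [/H//|/ltW/H] := leP x y; rewrite distrC [leRHS]distrC.
rewrite !ler0_norm ?subr_le0 ?clamp_homo//.
rewrite /clamp /Num.max /Num.min.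
by case: (ltP 1 x) => ?; case: (ltP 1 y) => ?; case: ltP => ?; case: ltP => ?; lra.
Qed.

Lemma continuous_rampR (K k : nat) : continuous (fun t : unit_itv R => rampR K k (itv_val t)).
Proof.
move=> t; apply: (@continuous_comp _ _ _ (@itv_val R) (rampR K k)).
  exact: continuous_unit_itv_val.
move: (itv_val t) => {}t; apply/cvgrPdist_lt => e e0.
have K0 : 0 < K%:R + 1 :> R by rewrite ltr_wpDl.
have d0 : 0 < e / (K%:R + 1) by rewrite divr_gt0.
have : \forall s \near t, `|t - s| < e / (K%:R + 1) by exists (e / (K%:R + 1)).
apply: filterS => s ts; apply: le_lt_trans (clamp_lip _ _) _.
have -> : k.+1%:R - K%:R * t - (k.+1%:R - K%:R * s) = - (K%:R * (t - s)) by ring.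
rewrite normrN normrM ger0_norm//.
apply: (@le_lt_trans _ _ (K%:R * (e / (K%:R + 1)))); first by rewrite ler_wpM2l// ltW.
by rewrite mulrCA gtr_pMr// ltr_pdivrMr// mul1r ltrDl.
Qed.

Definition ramp (K k : nat) : C01M R n := C01M_real n (@continuous_rampR K k).

(* If [y i > x i + 3 / K], some ramp [k] satisfies [rampR k.+1 (y l) <= rampR k (x l)] for every [l],
   whereas the averages of these two ramps must differ by about [w k.+1 - w k >= c]. *)
Lemma rampR_compare (K r : nat) (x y : 'I_r -> R) (w : nat -> R) (c : R) :
  (0 < K)%N -> 0 < c -> (forall k, (k < K)%N -> c <= w k.+1 - w k) ->
  (forall i, 0 <= x i) -> (forall i, y i <= 1) ->
  (forall i l : 'I_r, (i <= l)%N -> x i <= x l) ->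
  (forall i l : 'I_r, (i <= l)%N -> y i <= y l) ->
  (forall k, (k <= K)%N -> `|(\sum_i rampR K k (x i)) / r%:R - w k| < c / 2) ->
  (forall k, (k <= K)%N -> `|(\sum_i rampR K k (y i)) / r%:R - w k| < c / 2) ->
  forall i, y i <= x i + 3 / K%:R.
Proof.
move=> K0 c0 wc x0 y1 xs ys xw yw i; rewrite leNgt; apply/negP => xy.
have KR : 0 < K%:R :> R by rewrite ltr0n.
(* With this choice x i < k/K, so ramp [k] is 1 at [x l] for l <= i; and y i > (k+2)/K, so ramp
   [k.+1] is 0 at [y l] for l >= i. *)
pose k := (Num.truncn (K%:R * x i)).+1.
have kx : K%:R * x i < k%:R.
  by have /truncn_itv/andP[] : 0 <= K%:R * x i by rewrite mulr_ge0.
have kx1 : k%:R <= K%:R * x i + 1.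
  have /truncn_itv/andP[+ _] : 0 <= K%:R * x i by rewrite mulr_ge0.
  by rewrite /k -natr1 lerD2r.
have Ky : K%:R * x i + 3 < K%:R * y i.
  by move: xy; rewrite -(ltr_pM2l KR) mulrDr mulrCA divff ?mulr1 ?lt0r_neq0.
have Ky1 : K%:R * y i <= K%:R by rewrite ler_piMr.
have kK : (k < K)%N by rewrite -(ltr_nat R); lra.
have : (\sum_i rampR K k.+1 (y i)) / r%:R <= (\sum_i rampR K k (x i)) / r%:R.
  rewrite ler_wpM2r ?invr_ge0//; apply: ler_sum => l _.
  have cl (z : R) : 0 <= clamp z <= 1.
    by have := clamp_subproof z; rewrite inE /= in_itv.
  have [li|/ltnW il] := leqP l i.
    apply: (@le_trans _ _ 1); first by case/andP: (cl (k.+2%:R - K%:R * y l)).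
    rewrite /rampR /clamp min_l ?max_r//.
    have : K%:R * x l <= K%:R * x i by rewrite ler_pM2l// xs.
    rewrite -natr1; lra.
  apply: (@le_trans _ _ 0); last by case/andP: (cl (k.+1%:R - K%:R * x l)).
  have : K%:R * y i <= K%:R * y l by rewrite ler_pM2l// ys.
  move=> H; have kn : k.+2%:R = k%:R + 2 :> R by rewrite -!natr1; ring.
  rewrite /rampR /clamp max_l// min_r; rewrite kn; lra.
have := xw _ (ltnW kK); have := yw _ kK; have := wc _ kK.
rewrite !ltr_norml => ? /andP[? ?] /andP[? ?]; lra.
Qed.

End Ramps.

Section UnitaryEquivalence.
Variables (R : realType) (M : cstarAlgType R) (k : nat -> nat).
Variable phi : forall j, {lrmorphism 'M[R[i]]_((k j).+1) -> M}.
Hypothesis ephi : forall j, matrix_embedding (phi j).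
Hypothesis nest : forall j X, exists Y, phi j.+1 Y = phi j X.
Hypothesis dense : forall a (e : R), 0 < e -> exists j X, cnorm (a - phi j X) < e.
Variable n : nat.
Local Notation C := (C01M R n).
Local Notation unit a b := (C01M_cst (delta_mx a b : 'M[R[i]]_n.+1)).

Lemma approx_pointeval (pi : {lrmorphism C -> M}) (I : finType) (F : I -> C) (e : R) :
  starhom pi -> 0 < e -> \forall j \near \oo,
  exists r (T : 'I_r -> 'M[R[i]]_((k j).+1, n.+1)) (s : 'I_r -> unit_itv R),
  [/\ frame T, forall i i' : 'I_r, (i <= i')%N -> itv_val (s i) <= itv_val (s i') &
      forall i, cnorm (pi (F i) - phi j (pointeval T s (F i))) < e].
Proof.
move=> spi e0; have [d d0 dF] := @gen_controlled_fin R M n I F e e0.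
have := approx_generators ephi nest dense spi d0; apply: filterS => j.
move=> [r [T [s [fT s_homo Tu Tc]]]]; exists r, T, s; split=> // i.
have [ev sev evE] := ex_pointeval s fT.
pose D : {lrmorphism C -> M} := phi j \o ev.
have sD : starhom D by move=> a; rewrite /D /= sev (matrix_embedding_starhom (ephi j)).
have DF : gen_close d pi D by split=> [a b|]; rewrite /D/= evE; [exact: Tu|exact: Tc].
by have := dF _ _ spi sD DF i; rewrite /D/= evE.
Qed.

(** The unitary moves the frame [T] to [T']; after conjugation the models differ only through the
    sample points. *)
Lemma frame_conj j r (T T' : 'I_r -> 'M[R[i]]_((k j).+1, n.+1)) : frame T -> frame T' ->
  exists u : M, [/\ star u * u = 1, u * star u = 1 &
    forall s s' (a : C), u * phi j (pointeval T s a) * star u - phi j (pointeval T' s' a) =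
      phi j (blockmx2 T' T' (fun i => a (s i) - a (s' i)))].
Proof.
move=> fT fT'; exists (phi j (blockmx2 T' T (fun=> 1%:M))).
have su : star (phi j (blockmx2 T' T (fun=> 1%:M))) = phi j (blockmx2 T T' (fun=> 1%:M)).
  rewrite -(matrix_embedding_starhom (ephi j)); congr (phi j _).
  apply: etrans (blockmx2_adj _ _ _) _; apply: eq_bigr => i _.
  by rewrite trmx1 map_mx1.
have cancel1 (U V : 'I_r -> 'M[R[i]]_((k j).+1, n.+1)) : frame U -> frame V ->
    blockmx2 U V (fun=> 1%:M) * blockmx2 V U (fun=> 1%:M) = 1.
  move=> fU fV; rewrite (blockmx2M _ _ _ _ fV) -(blockmx2_1 fU).
  by apply: eq_bigr => i _; rewrite mulmx1.
rewrite su; split.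
- by rewrite -(rmorphM (phi j)) cancel1// rmorph1.
- by rewrite -(rmorphM (phi j)) cancel1// rmorph1.
move=> s s' a; rewrite -!(rmorphM (phi j)) -(raddfB (phi j)) blockmx2B; congr (phi j (_ - _)).
rewrite /pointeval (blockmx2M _ _ _ _ fT) (blockmx2M _ _ _ _ fT).
by apply: eq_bigr => i _; rewrite mulmx1 mul1mx.
Qed.

Variable tr : {scalar M}.
Hypothesis tr_trace : is_trace tr.

Lemma trace_pointeval j r (T : 'I_r -> 'M[R[i]]_((k j).+1, n.+1)) s a : frame T ->
  tr (phi j (pointeval T s a)) = (\sum_i (\tr (a (s i)) / n.+1%:R)) / r%:R.
Proof.
move=> fT; have [tr1 _ trC] := tr_trace.
rewrite (trace_matrix (phi j) trC _ tr1) mxtrace_blockmx2// -(frame_size fT).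
by rewrite natrM invfM mulrA -mulr_suml.
Qed.

Lemma trace_pointeval_ramp j r (T : 'I_r -> 'M[R[i]]_((k j).+1, n.+1)) s K l : frame T ->
  tr (phi j (pointeval T s (ramp R n K l))) =
  ((\sum_i rampR K l (itv_val (s i))) / r%:R)%:C.
Proof.
move=> fT; rewrite trace_pointeval// rmorphM/= fmorphV/= rmorph_nat rmorph_sum/=.
congr (_ / _); apply: eq_bigr => i _.
by rewrite mxtrace_scalar -(mulr_natr (_%:C)) mulfK// pnatr_eq0.
Qed.

Variable tau : {scalar C}.
Hypotheses (tau_trace : is_trace tau) (tau_faithful : faithful tau).

(** The difference of consecutive ramps is nonnegative and takes the value 1 at (l+1)/K, so
    faithfulness makes its trace positive. Finitely many [l] leave a positive minimum. *)
Lemma ramp_gap K : (0 < K)%N -> exists2 c : R, 0 < c & forall l, (l < K)%N ->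
  c <= complex.Re (tau (ramp R n K l.+1)) - complex.Re (tau (ramp R n K l)).
Proof.
move=> K0; have [_ tau_pos _] := tau_trace.
have KR : 0 < K%:R :> R by rewrite ltr0n.
have gap l : (l < K)%N -> 0 < complex.Re (tau (ramp R n K l.+1)) - complex.Re (tau (ramp R n K l)).
  move=> lK; pose f (t : unit_itv R) := rampR K l.+1 (itv_val t) - rampR K l (itv_val t).
  have cf : continuous f.
    by move=> t; exact: cvgB (@continuous_rampR R K l.+1 t) (@continuous_rampR R K l t).
  have f0 t : 0 <= f t.
    by rewrite subr_ge0; apply: clamp_homo; rewrite lerD2r ler_nat.
  have [q fq] := @C01M_positive_sqrt R n f cf f0.
  have E : tau (ramp R n K l.+1) - tau (ramp R n K l) = tau (star q * q).
    rewrite -fq -raddfB; congr (tau _); apply: C01MP => t.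
    by rewrite /= /mkcts /f rmorphB raddfB.
  have : 0 < tau (ramp R n K l.+1) - tau (ramp R n K l).
    rewrite E lt_def tau_pos andbT; apply/eqP => /tau_faithful q0.
    have := congr1 (fun g : C => g (unit_itv_clamp (l.+1%:R / K%:R))) fq.
    rewrite q0 mulr0 => /matrixP/(_ 0 0); rewrite !mxE eqxx mulr1n.
    rewrite /f unit_itv_clampE clamp_id; last first.
      by rewrite divr_ge0//= ler_pdivrMr// mul1r ler_nat.
    have e1 : l.+2%:R - l.+1%:R = 1 :> R by rewrite -natrB// subSnn.
    rewrite /rampR mulrCA divff ?lt0r_neq0// mulr1 e1 subrr !clamp_id ?lexx ?ler01//.
    by rewrite subr0 => /eqP; rewrite oner_eq0.
  by rewrite ltcE/= => /andP[_]; rewrite ReB.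
pose G (l : 'I_K) := complex.Re (tau (ramp R n K l.+1)) - complex.Re (tau (ramp R n K l)).
exists (\big[Num.min/1]_l G l).
  by apply: (big_ind (fun x => 0 < x)) => // [x y x0 y0|i _]; [rewrite lt_min x0|exact: gap].
move=> l lK; have : \big[Num.min/1]_l G l <= G (Ordinal lK) by exact: bigmin_le_cond.
exact.
Qed.

Definition ad_close (d : R) (u : M) (pi pi' : {lrmorphism C -> M}) : Prop :=
  [/\ star u * u = 1, u * star u = 1,
      forall a b, cnorm (u * pi (unit a b) * star u - pi' (unit a b)) < d &
      cnorm (u * pi (coord R n) * star u - pi' (coord R n)) < d].

Definition ramps_close (K : nat) (d : R) (pi : {lrmorphism C -> M}) : Prop :=
  forall l, (l <= K)%N -> normc (tr (pi (ramp R n K l)) - tau (ramp R n K l)) < d.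

Lemma cnorm_conj_triangle (u x x' y y' : M) (d : R) : star u * u = 1 -> u * star u = 1 ->
  cnorm (x - x') < d -> cnorm (y - y') < d ->
  cnorm (u * x' * star u - y') <= d -> cnorm (u * x * star u - y) < d + d + d.
Proof.
move=> u1 u2 xx yy xy.
have -> : u * x * star u - y = u * (x - x') * star u + (u * x' * star u - y') + (y' - y).
  by rewrite mulrBr mulrBl subrKA subrKA.
apply: le_lt_trans (cnormD _ _) _; apply: ler_ltD; last by rewrite cnormB.
apply: cnormD_le => //; have cu := cnorm_unitary u1.
have csu : cnorm (star u) = 1 by rewrite cnorm_of_star.
apply: le_trans (cnormM _ _) _; rewrite csu mulr1.
by apply: le_trans (cnormM _ _) _; rewrite cu mul1r ltW.
Qed.

(** Sorted samples with nearly equal ramp averages are within 3/K of each other, and [K] is taken so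
    that 3/K <= e/3; the other two thirds of [e] pay for replacing both homomorphisms by point
    evaluations. *)
Lemma unitary_equivalence (e : R) : 0 < e -> exists (K : nat) (d : R), 0 < d /\
  forall pi pi' : {lrmorphism C -> M}, starhom pi -> starhom pi' ->
  ramps_close K d pi -> ramps_close K d pi' -> exists u, ad_close e u pi pi'.
Proof.
move=> e0; have e30 : 0 < e / 3 by rewrite divr_gt0.
pose K := (Num.truncn (3 / (e / 3))).+1.
have K0 : (0 < K)%N by [].
have KR : 0 < K%:R :> R by rewrite ltr0n.
have Ke : 3 / K%:R <= e / 3.
  rewrite ler_pdivrMr// mulrC -ler_pdivrMr// ltW//.
  have /truncn_itv/andP[_] : 0 <= 3 / (e / 3) by rewrite divr_ge0 ?(ltW e30).
  exact.
have [c c0 gap] := ramp_gap K0; have c40 : 0 < c / 4 by rewrite divr_gt0.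
(* The factor 16 of [positive_bounded] turns c/64 into c/4; adding the tolerance c/4 of
   [ramps_close] gives the c/2 required by [rampR_compare]. *)
have d0 : 0 < Num.min (e / 3) (c / 64) by rewrite lt_min e30 divr_gt0.
exists K, (c / 4); split => // pi pi' spi spi' rpi rpi'.
pose F (i : option ('I_n.+1 * 'I_n.+1 + 'I_K.+1)) : C :=
  match i with
  | None => coord R n
  | Some (inl ab) => unit ab.1 ab.2
  | Some (inr l) => ramp R n K l
  end.
have [j [[r [T [s [fT s_homo Ts]]]] [r' [T' [s' [fT' s'_homo T's]]]]]] := @filter_ex _ \oo _ _
  (filterI (approx_pointeval F spi d0) (approx_pointeval F spi' d0)).
have rr : r' = r.
  by have /eqP := frame_size fT'; rewrite -(frame_size fT) eqn_pmul2l// => /eqP.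
subst r'; have [u [u1 u2 uT]] := frame_conj fT fT'; exists u.
have [tr1 tr_pos _] := tr_trace.
have avg (pi0 : {lrmorphism C -> M}) (T0 : 'I_r -> 'M[R[i]]_((k j).+1, n.+1)) s0 :
    frame T0 -> ramps_close K (c / 4) pi0 ->
    (forall i, cnorm (pi0 (F i) - phi j (pointeval T0 s0 (F i))) < Num.min (e / 3) (c / 64)) ->
    forall l, (l <= K)%N -> `|(\sum_i rampR K l (itv_val (s0 i))) / r%:R -
      complex.Re (tau (ramp R n K l))| < c / 2.
  move=> fT0 rpi0 pT0 l lK.
  have := pT0 (Some (inr (Ordinal (lK : (l < K.+1)%N)))); rewrite /F/= lt_min => /andP[_ dl].
  have := rpi0 l lK.
  have := positive_bounded tr1 tr_pos (pi0 (ramp R n K l) - phi j (pointeval T0 s0 (ramp R n K l))).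
  rewrite raddfB/= trace_pointeval_ramp//; set A := _ / r%:R => b1 b2.
  have -> : A = complex.Re (A%:C) by [].
  rewrite -ReB; apply: le_lt_trans (Re_le_normc _) _.
  have -> : A%:C - tau (ramp R n K l) = - (tr (pi0 (ramp R n K l)) - A%:C) +
      (tr (pi0 (ramp R n K l)) - tau (ramp R n K l)) by ring.
  apply: le_lt_trans (le_normcD _ _) _; rewrite normcN; lra.
have ss' i : `|itv_val (s i) - itv_val (s' i)| <= 3 / K%:R.
  have s0 (t : unit_itv R) : 0 <= itv_val t by case/andP: (unit_itvP t).
  have s1 (t : unit_itv R) : itv_val t <= 1 by case/andP: (unit_itvP t).
  have As := avg _ _ _ fT rpi Ts; have As' := avg _ _ _ fT' rpi' T's.
  rewrite ler_norml; apply/andP; split.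
    rewrite lerNl opprB lerBlDl.
    exact: (rampR_compare K0 c0 gap (fun i => s0 (s i)) (fun i => s1 (s' i)) s_homo s'_homo As As').
  rewrite lerBlDl.
  exact: (rampR_compare K0 c0 gap (fun i => s0 (s' i)) (fun i => s1 (s i)) s'_homo s_homo As' As).
have e3 : e = e / 3 + e / 3 + e / 3 by field.
have Tse i : cnorm (pi (F i) - phi j (pointeval T s (F i))) < e / 3.
  by apply: lt_le_trans (Ts i) _; rewrite ge_min lexx.
have T'se i : cnorm (pi' (F i) - phi j (pointeval T' s' (F i))) < e / 3.
  by apply: lt_le_trans (T's i) _; rewrite ge_min lexx.
split=> //.
  move=> a b; rewrite e3; have := Tse (Some (inl (a, b))); have := T'se (Some (inl (a, b))).
  move=> /= h1 h2; apply: (cnorm_conj_triangle u1 u2 h2 h1); rewrite uT.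
  have -> : blockmx2 T' T' (fun i => unit a b (s i) - unit a b (s' i)) = 0.
    apply: big1 => i _.
    by rewrite -[X in _ *m X *m _]/(delta_mx a b - delta_mx a b) subrr mulmx0 mul0mx.
  by rewrite raddf0 cnorm0 ltW.
rewrite e3; apply: (cnorm_conj_triangle u1 u2 (Tse None) (T'se None)); rewrite uT.
rewrite matrix_embedding_isometric//; apply: le_trans Ke.
have -> : blockmx2 T' T' (fun i => F None (s i) - F None (s' i)) =
    blockmx2 T' T' (fun i => (itv_val (s i) - itv_val (s' i))%:C%:M).
  by apply: eq_bigr => i _; congr (_ *m _ *m _); rewrite rmorphB [RHS]raddfB.
by apply: opnorm_blockmx2_scalar => //; rewrite divr_ge0.
Qed.

End UnitaryEquivalence.

(** * Homomorphisms with prescribed approximate trace *)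

Section LargeDivisors.
Variable R : realType.

Definition prime_power_prod (e : nat -> nat) (P : nat) : nat :=
  (\prod_(0 <= p < P) if prime p then p ^ e p else 1)%N.

Lemma prime_power_prod_gt0 e P : (0 < prime_power_prod e P)%N.
Proof.
apply: (big_ind (fun n => (0 < n)%N)) => // [x y x0 y0|p _]; first by rewrite muln_gt0 x0.
by case: ifP => // /prime_gt0 p0; rewrite expn_gt0 p0.
Qed.

Lemma logn_prime_power_prod e P q : prime q -> (logn q (prime_power_prod e P) <= e q)%N.
Proof.
move=> pq; suff -> : logn q (prime_power_prod e P) = if (q < P)%N then e q else 0%N.
  by case: ifP.
rewrite /prime_power_prod.
elim: P => [|P IH]; first by rewrite big_geq// logn1.
rewrite big_nat_recr//= lognM; last 2 first.
- exact: prime_power_prod_gt0.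
- by case: ifP => // /prime_gt0 p0; rewrite expn_gt0 p0.
have step : logn q (if prime P then P ^ e P else 1)%N = if q == P then e q else 0%N.
  have [<-|qP] := eqVneq q P; first by rewrite pq lognX logn_prime// eqxx muln1.
  by case: ifP => [pP|_]; rewrite ?logn1// lognX logn_prime// (negPf qP) muln0.
by rewrite IH step ltnS; case: ltngtP => //; rewrite addn0.
Qed.

(** A product of prime powers is at least 2 to the sum of its exponents, and these sums are
    unbounded. Infinite exponents are truncated to [B], a single one of which already suffices. *)
Lemma large_divisor (nu : supernatural R) (B : nat) :
  exists n, formally_divides n.+1 nu /\ (B <= n.+1)%N.
Proof.
pose e p := if nu p is Some m then m else B.
(* If all partial sums stayed below [B], no exponent could be infinite and the series would be at
   most [B], against [expo_sum]. *)
have [P BP] : exists P, (B <= \sum_(0 <= p < P | prime p) e p)%N.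
  apply: contrapT => /forallNP small.
  have nuS p : prime p -> exists m, nu p = Some m.
    case E : (nu p) => [m|] pp; first by exists m.
    exfalso; apply: (small p.+1); rewrite big_mkcond big_nat_recr//= pp /e E.
    exact: leq_addl.
  have u0 p : (0 <= p)%N -> prime p -> (0%R <= exponent_ereal R (nu p))%E.
    by move=> _ /nuS[m ->]; rewrite lee_fin.
  have : (\sum_(0 <= p <oo | prime p) exponent_ereal R (nu p) <= B%:R%:E)%E.
    apply: lime_le; first exact: is_cvg_nneseries.
    apply: nearW => P.
    have -> : (\sum_(0 <= p < P | prime p) exponent_ereal R (nu p) =
        (\sum_(0 <= p < P | prime p) e p)%:R%:E)%E.
      rewrite natr_sum -sumEFin; apply: eq_bigr => p /nuS[m pm].
      by rewrite /e pm.
    rewrite lee_fin ler_nat; have /negP := small P.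
    by rewrite -ltnNge => /ltnW.
  by rewrite expo_sum leye_eq.
have n0 := prime_power_prod_gt0 e P.
exists (prime_power_prod e P).-1; rewrite prednK//; split.
  split => // p pp; have := logn_prime_power_prod e P pp; rewrite /e.
  by case: (nu p).
apply: leq_trans BP _; apply: leq_trans (ltnW (ltn_expl _ (ltnSn 1))) _.
rewrite expn_sum big_mkcond /prime_power_prod /=.
apply: leq_prod => p _; case: ifP => // pp.
by case: (e p) => // m; rewrite leq_exp2r// prime_gt1.
Qed.

End LargeDivisors.

Section Rounding.
Variables (R : realType) (m r : nat) (w : 'I_m.+1 -> R).
Hypotheses (w0 : forall k, 0 <= w k) (w1 : \sum_k w k = 1).

(** Each [k] is repeated floor(r w_k) times, and the at most m+1 missing places are filled with
    [ord0]. Floors and filling each cost at most (m+1) G, for one [kappa] valid for all [g]. *)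
Lemma ex_rounding : exists kappa : 'I_r -> 'I_m.+1,
  forall (g : 'I_m.+1 -> R[i]) (G : R), (forall k, normc (g k) <= G) ->
  normc (\sum_i g (kappa i) - \sum_k (r%:R * w k)%:C * g k) <= 2 * m.+1%:R * G.
Proof.
pose c k := Num.truncn (r%:R * w k).
have cw k : (c k)%:R <= r%:R * w k /\ r%:R * w k <= (c k)%:R + 1.
  have /truncn_itv/andP[a b] : 0 <= r%:R * w k by rewrite mulr_ge0.
  by split => //; rewrite natr1 ltW.
have cr : (\sum_k c k <= r)%N.
  have rE : r%:R = \sum_k r%:R * w k by rewrite -mulr_sumr w1 mulr1.
  rewrite -(ler_nat R) natr_sum [leRHS]rE.
  by apply: ler_sum => k _; have [] := cw k.
pose d := (r - \sum_k c k)%N.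
have dE : (d%:R : R) = \sum_k (r%:R * w k - (c k)%:R).
  by rewrite natrB// natr_sum sumrB -mulr_sumr w1 mulr1.
have dm : (d%:R : R) <= m.+1%:R.
  have -> : m.+1%:R = \sum_(k < m.+1) (1 : R) by rewrite sumr_const card_ord.
  rewrite dE.
  by apply: ler_sum => k _; have [] := cw k; lra.
pose l := (\big[cat/[::]]_k nseq (c k) k) ++ nseq d ord0.
have sl : size l = r.
  rewrite size_cat size_nseq (big_morph _ (@size_cat _) (erefl (size [::]))).
  by under eq_bigr do rewrite size_nseq; rewrite subnKC.
exists (fun i => nth ord0 l i) => g G gG.
have G0 : 0 <= G by apply: le_trans (gG ord0); exact: normc_ge0.
have -> : \sum_(i < r) g (nth ord0 l i) = \sum_k g k *+ c k + g ord0 *+ d.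
  have nseqE n k : \sum_(x <- nseq n k) g x = g k *+ n by rewrite big_nseq iter_addr_0.
  rewrite -sl -(big_mkord xpredT (fun i => g (nth ord0 l i))) -(big_nth ord0 xpredT g).
  rewrite big_cat/= nseqE; congr (_ + _).
  have h1 : {morph (fun s : seq 'I_m.+1 => \sum_(x <- s) g x) : s1 s2 / s1 ++ s2 >-> s1 + s2}.
    by move=> s1 s2 /=; rewrite big_cat.
  have h0 : (fun s : seq 'I_m.+1 => \sum_(x <- s) g x) [::] = 0 by rewrite big_nil.
  by rewrite (big_morph _ h1 h0); apply: eq_bigr => k _; rewrite nseqE.
rewrite addrAC -sumrB; apply: le_trans (le_normcD _ _) _.
have n1 n (z : R[i]) : normc (z *+ n) = n%:R * normc z.
  rewrite -[z *+ n]mulr_natl normcM; congr (_ * _).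
  by rewrite -(rmorph_nat (real_complex R)) normc_real ger0_norm.
have : normc (g ord0 *+ d) <= m.+1%:R * G.
  by rewrite n1; apply: ler_pM => //; exact: normc_ge0.
have : normc (\sum_k (g k *+ c k - (r%:R * w k)%:C * g k)) <= m.+1%:R * G.
  apply: le_trans (normc_sum _) _.
  have -> : m.+1%:R * G = \sum_(k < m.+1) G by rewrite sumr_const card_ord mulr_natl.
  apply: ler_sum => k _; rewrite -[g k *+ _]mulr_natl -(rmorph_nat (real_complex R)) -mulrBl -rmorphB normcM normc_real.
  rewrite -[leRHS]mul1r; apply: ler_pM => //; first exact: normc_ge0.
  by have [a b] := cw k; rewrite ler_norml; apply/andP; split; lra.
lra.
Qed.

End Rounding.

Section TraceApproximation.
Variables (R : realType) (n : nat).
Local Notation C := (C01M R n).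
Variables (tau : {scalar C}).
Hypothesis tau_trace : is_trace tau.

Lemma continuous_bernR m (f : nat -> R) : continuous (fun x => bernR m x f).
Proof.
elim: m f => [|m IH] f x /=; first exact: cvg_cst.
apply: cvgD; apply: cvgM; [exact: cvg_id|exact: IH| |exact: IH].
by apply: cvgB; [exact: cvg_cst|exact: cvg_id].
Qed.

Lemma bernw_real m k : exists (f : unit_itv R -> R) (cf : continuous f),
  (forall t, 0 <= f t) /\ bernw R n m k = C01M_real n cf.
Proof.
pose f (t : unit_itv R) := bernR m (itv_val t) (fun l => (l == k)%:R).
have cf : continuous f.
  move=> t; apply: (@continuous_comp _ _ _ (@itv_val R) (fun x => bernR m x _)).
    exact: continuous_unit_itv_val.
  exact: continuous_bernR.
exists f, cf; split; first by move=> t; apply: bernR_ge0 => //; exact: unit_itvP.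
by apply: C01MP => t; rewrite bernw_eval.
Qed.

Lemma normc_ntrace (X : 'M[R[i]]_n.+1) : normc (\tr X / n.+1%:R) <= opnorm X.
Proof.
rewrite normcM normcV -(rmorph_nat (real_complex R)) normc_real ger0_norm//.
rewrite ler_pdivrMr ?ltr0n//; apply: le_trans (normc_sum _) _.
rewrite mulr_natr -[X in _ *+ X]card_ord -sumr_const; apply: ler_sum => i _.
exact: normc_le_opnorm.
Qed.

(* [tau] of the Bernstein weights provides the masses of a discrete approximation of [tau]. *)
Lemma trace_discretize (I : finType) (F : I -> C) (e : R) : 0 < e ->
  exists m (w : 'I_m.+1 -> R), [/\ forall k, 0 <= w k, \sum_k w k = 1 &
  forall i, normc (tau (F i) -
    \sum_k (w k)%:C * (\tr (F i (grid R m k)) / n.+1%:R)) <= e].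
Proof.
move=> e0; have [tau1 tau_pos tauC] := tau_trace.
have e160 : 0 < e / 16 by rewrite divr_gt0.
have : \forall m \near \oo, forall i, cnorm (F i - bernstein m (F i)) <= e / 16.
  by apply: filter_forall => i; exact: bernstein_cvg.
move=> /filter_ex[m mF].
have wC (k : 'I_m.+1) : 0 <= tau (bernw R n m k).
  by have [f [cf [f0 ->]]] := bernw_real m k; exact: tau_real_ge0.
have wE (k : 'I_m.+1) : (complex.Re (tau (bernw R n m k)))%:C = tau (bernw R n m k).
  by apply/eqP; rewrite RRe_real// ger0_real.
exists m, (fun k => complex.Re (tau (bernw R n m k))); split.
- by move=> k; rewrite -lecR wE.
- apply: (@complexI R); rewrite rmorph_sum/= rmorph1; under eq_bigr do rewrite wE.
  by rewrite -raddf_sum bernw_sum.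
move=> i; have -> : \sum_(k < m.+1) (complex.Re (tau (bernw R n m k)))%:C *
    (\tr (F i (grid R m k)) / n.+1%:R) = tau (bernstein m (F i)).
  rewrite bernstein_weights raddf_sum; apply: eq_bigr => k _.
  have [f [cf [_ E]]] := bernw_real m k.
  (* The weights are central, so [tau] of a weight times a constant matrix factors through the
     normalized matrix trace. *)
  rewrite wE; apply: esym; apply: (tau_real_cst tauC) => b.
  by rewrite E C01M_real_comm.
rewrite -raddfB; apply: le_trans (positive_bounded tau1 tau_pos _) _.
by have := mF i; lra.
Qed.

End TraceApproximation.

Section ApproximateModels.
Variables (R : realType) (M : cstarAlgType R) (k : nat -> nat).
Variable phi : forall j, {lrmorphism 'M[R[i]]_((k j).+1) -> M}.
Hypothesis ephi : forall j, matrix_embedding (phi j).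
Hypothesis nest : forall j X, exists Y, phi j.+1 Y = phi j X.
Hypothesis dense : forall a (e : R), 0 < e -> exists j X, cnorm (a - phi j X) < e.
Variable nu : supernatural R.
Hypothesis nuM : forall n, formally_divides n.+1 nu <->
    exists phi : {lrmorphism 'M[R[i]]_n.+1 -> M}, matrix_embedding phi.
Variables (tr : {scalar M}).
Hypothesis tr_trace : is_trace tr.

Lemma ex_eval_at (n : nat) (t : unit_itv R) :
  exists2 ev : {lrmorphism C01M R n -> 'M[R[i]]_n.+1},
    starhom ev & forall a, ev a = a t.
Proof.
have [||||ev evE] := @ex_lrmorphism R (C01M R n) 'M[R[i]]_n.+1 (fun a => a t) => //.
by exists ev => // a; rewrite !evE.
Qed.

Lemma ex_starhom_constants (n : nat) : formally_divides n.+1 nu ->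
  exists2 pi : {lrmorphism C01M R n -> M}, starhom pi &
    exists2 psi : {lrmorphism 'M[R[i]]_n.+1 -> M}, matrix_embedding psi &
      forall X, pi (C01M_cst X) = psi X.
Proof.
move=> /nuM[psi epsi]; have [ev sev evE] := ex_eval_at n (unit_itv0 R).
exists (psi \o ev : {lrmorphism _ -> _}).
  by move=> a /=; rewrite sev (matrix_embedding_starhom epsi).
by exists psi => // X; rewrite /= evE.
Qed.

(** A matrix embedding, precomposed with evaluation at 0, is modelled in every late stage; only the
    frame of the model is kept. *)
Lemma frames_eventually (n : nat) : formally_divides n.+1 nu -> \forall j \near \oo,
  exists r (T : 'I_r -> 'M[R[i]]_((k j).+1, n.+1)), frame T.
Proof.
move=> /ex_starhom_constants[pi spi _].
have := approx_generators ephi nest dense spi (ltr01 : (0 : R) < 1).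
by apply: filterS => j [r [T [s [fT _ _ _]]]]; exists r, T.
Qed.

(** By [frame_size], a large formal divisor divides the size of every late stage. *)
Lemma stages_unbounded (B : nat) : \forall j \near \oo, (B <= (k j).+1)%N.
Proof.
have [n [nnu Bn]] := large_divisor nu B.
have := frames_eventually nnu; apply: filterS => j [r [T fT]].
apply: leq_trans Bn _; rewrite -(frame_size fT) leq_pmulr//.
by rewrite lt0n; apply/eqP => r0; have := frame_size fT; rewrite r0 muln0.
Qed.

Variables (n : nat) (tau : {scalar C01M R n}).
Hypothesis nnu : formally_divides n.+1 nu.
Hypothesis tau_trace : is_trace tau.

Lemma ex_approximate_model (I : finType) (F : I -> C01M R n) (e : R) : 0 < e ->
  exists2 pi : {lrmorphism C01M R n -> M}, starhom pi &
    forall i, normc (tr (pi (F i)) - tau (F i)) < e.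
Proof.
move=> e0; have e40 : 0 < e / 4 by rewrite divr_gt0.
have [m [w [w0 w1 wF]]] := trace_discretize tau_trace F e40.
pose G := \sum_i cnorm (F i).
have G0 : 0 <= G by apply: sumr_ge0 => i _; exact: cnorm_ge0.
have FG i : cnorm (F i) <= G.
  by rewrite /G (bigD1 i)//= lerDl; apply: sumr_ge0 => l _; exact: cnorm_ge0.
(* Once r >= c, the rounding error 2 (m+1) G / r is at most e/4. A stage of size at least [B]
   guarantees this, since its size is (n+1) r. *)
pose c := 2 * m.+1%:R * G / (e / 4).
have c0 : 0 <= c by rewrite divr_ge0 ?mulr_ge0// ltW.
pose B := (n.+1 * (Num.truncn c).+1)%N.
have [j [[r [T fT]] jB]] := @filter_ex _ \oo _ _
  (filterI (frames_eventually nnu) (stages_unbounded B)).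
have rc : c <= r%:R.
  have /truncn_itv/andP[_ /ltW cc] := c0; apply: le_trans cc _; rewrite ler_nat.
  by rewrite -(leq_pmul2l (ltn0Sn n)) (frame_size fT).
have r0 : 0 < r%:R :> R.
  rewrite ltr0n lt0n; apply/eqP => r0; have := frame_size fT; by rewrite r0 muln0.
have [kappa kP] := ex_rounding r w0 w1.
have [ev sev evE] := ex_pointeval (fun i => grid R m (kappa i)) fT.
exists (phi j \o ev : {lrmorphism _ -> _}).
  by move=> a /=; rewrite sev (matrix_embedding_starhom (ephi j)).
move=> i /=; rewrite evE (trace_pointeval phi tr_trace)//.
pose g l := \tr (F i (grid R m l)) / n.+1%:R.
have gG l : normc (g l) <= G.
  apply: le_trans (normc_ntrace _) _; apply: le_trans (FG i).
  exact: opnorm_le_supnorm.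
have := kP (fun l => g l) G gG; have := wF i.
rewrite -/(g _); set S1 := \sum_k _; set S2 := \sum_i _; set S3 := \sum_k _ => h1 h2.
have rC : (r%:R : R[i]) != 0 by rewrite pnatr_eq0 -lt0n -(ltr0n R).
have E : S2 / r%:R - tau (F i) = (S2 - S3) / r%:R - (tau (F i) - S1).
  have -> : S3 = r%:R * S1.
    rewrite /S3 mulr_sumr; apply: eq_bigr => l _.
    by rewrite rmorphM/= rmorph_nat -mulrA.
  by rewrite mulrBl mulrAC divff// mul1r opprB addrA subrK.
rewrite E; apply: le_lt_trans (le_normcD _ _) _; rewrite normcN.
have : normc ((S2 - S3) / r%:R) <= e / 4.
  rewrite normcM normcV -(rmorph_nat (real_complex R)) normc_real ger0_norm//.
  rewrite ler_pdivrMr//; apply: le_trans h2 _.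
  by rewrite [leRHS]mulrC -ler_pdivrMr.
lra.
Qed.

End ApproximateModels.

(** * The Fraisse properties *)

Section Conjugation.
Variables (R : realType) (M : cstarAlgType R).

Lemma ex_conjugation (u : M) : star u * u = 1 -> u * star u = 1 ->
  exists2 alpha : {lrmorphism M -> M}, starhom alpha & forall x, alpha x = u * x * star u.
Proof.
move=> u1 u2; have [||||alpha aE] := @ex_lrmorphism R M M (fun x => u * x * star u).
- by move=> x y /=; rewrite mulrDr mulrDl.
- by move=> z x /=; rewrite -scalerAr -scalerAl.
- by rewrite mulr1.
- by move=> x y /=; rewrite !mulrA -(mulrA _ (star u) u) u1 mulr1.
by exists alpha => // x; rewrite !aE !starM starK mulrA.
Qed.

Lemma conjugation_automorphism (tr : {scalar M}) (tr_trace : is_trace tr) (u : M)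
    (alpha : {lrmorphism M -> M}) : star u * u = 1 -> u * star u = 1 ->
  starhom alpha -> (forall x, alpha x = u * x * star u) ->
  automorphism (M := TracialAlg tr_trace) alpha.
Proof.
move=> u1 u2 sa aE; have [_ _ trC] := tr_trace; split; last first.
  by move=> b; exists (star u * b * u); rewrite aE !mulrA u2 mul1r -mulrA u2 mulr1.
split=> // [x y|a].
  rewrite !aE => /(congr1 (fun z => star u * z * u)).
  by rewrite !mulrA u1 !mul1r -!mulrA u1 !mulr1.
by rewrite /= aE trC mulrA u1 mul1r.
Qed.

End Conjugation.

Section Universality.
Variables (R : realType) (M : cstarAlgType R) (k : nat -> nat).
Variable phi : forall j, {lrmorphism 'M[R[i]]_((k j).+1) -> M}.
Hypothesis ephi : forall j, matrix_embedding (phi j).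
Hypothesis nest : forall j X, exists Y, phi j.+1 Y = phi j X.
Hypothesis dense : forall a (e : R), 0 < e -> exists j X, cnorm (a - phi j X) < e.
Variable nu : supernatural R.
Hypothesis nuM : forall n, formally_divides n.+1 nu <->
    exists phi : {lrmorphism 'M[R[i]]_n.+1 -> M}, matrix_embedding phi.
Variables (tr : {scalar M}) (n : nat) (tau : {scalar C01M R n}).
Hypothesis tr_trace : is_trace tr.
Hypothesis nnu : formally_divides n.+1 nu.
Hypotheses (tau_trace : is_trace tau) (tau_faithful : faithful tau).
Local Notation C := (C01M R n).
Local Notation hom := {lrmorphism C -> M}.
Local Notation unit a b := (C01M_cst (delta_mx a b : 'M[R[i]]_n.+1)).

(* Two traces agreeing on all the Bernstein weights are equal, so that controlling countably
   many values of [tr \o rho] is enough. *)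
Definition traces_close (K : nat -> nat) (d : nat -> R) (j : nat) (rho : hom) : Prop :=
  [/\ starhom rho, forall i, (i <= j)%N -> ramps_close tr tau (K i) (d i) rho &
      forall m l, (m <= j)%N -> (l <= j)%N ->
        normc (tr (rho (bernw R n m l)) - tau (bernw R n m l)) < 2^-1 ^+ j].

Lemma ex_traces_close K d j : (forall i, 0 < d i) -> exists rho, traces_close K d j rho.
Proof.
move=> d0; pose L := (\sum_(i < j.+1) K i)%N.
pose F (x : 'I_j.+1 * 'I_L.+1 + 'I_j.+1 * 'I_j.+1) : C :=
  match x with inl il => ramp R n (K il.1) il.2 | inr ml => bernw R n ml.1 ml.2 end.
pose e := Num.min (\big[Num.min/1]_(i < j.+1) d i) (2^-1 ^+ j).
have e0 : 0 < e.
  rewrite lt_min exprn_gt0// andbT.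
  by apply: (big_ind (fun x => 0 < x)) => // x y x0 y0; rewrite lt_min x0.
have [rho srho rhoF] := ex_approximate_model ephi nest dense nuM tr_trace nnu tau_trace F e0.
exists rho; split=> // [i ij l lK|m l mj lj].
  have lL : (l < L.+1)%N.
    rewrite ltnS; apply: leq_trans lK _.
    by rewrite /L (bigD1 (Ordinal (ij : (i < j.+1)%N)))//= leq_addr.
  have := rhoF (inl (Ordinal (ij : (i < j.+1)%N), Ordinal lL)); rewrite /F/= => /lt_le_trans; apply.
  rewrite /e ge_min; apply/orP; left.
  have : \big[Num.min/1]_(i < j.+1) d i <= d (Ordinal (ij : (i < j.+1)%N)).
    exact: (bigmin_le_cond 1 (fun i : 'I_j.+1 => d i)).
  exact.
have := rhoF (inr (Ordinal (mj : (m < j.+1)%N), Ordinal (lj : (l < j.+1)%N))).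
by rewrite /F/= => /lt_le_trans; apply; rewrite /e ge_min lexx orbT.
Qed.

(** Each new model is conjugated to lie near its predecessor; conjugation leaves the trace
    unchanged, so the estimates on traces survive the correction. *)
Lemma ex_cauchy_models : exists rho : nat -> hom, [/\ forall j, starhom (rho j),
  forall j, gen_close (2^-1 ^+ j) (rho j.+1) (rho j) &
  forall m l j, (m <= j)%N -> (l <= j)%N ->
    normc (tr (rho j (bernw R n m l)) - tau (bernw R n m l)) < 2^-1 ^+ j].
Proof.
have e0 j : 0 < 2^-1 ^+ j :> R by rewrite exprn_gt0.
(* All thresholds are fixed beforehand: the model of index j+1 must meet threshold j, to be matched
   with its predecessor, and threshold j+1, for the next step. *)
have /choice[Kd KdP] : forall j, exists Kd : nat * R, 0 < Kd.2 /\
    forall pi pi' : hom, starhom pi -> starhom pi' ->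
    ramps_close tr tau Kd.1 Kd.2 pi -> ramps_close tr tau Kd.1 Kd.2 pi' ->
    exists u, ad_close (2^-1 ^+ j) u pi pi'.
  move=> j; have [K [d [d0 H]]] :=
    unitary_equivalence ephi nest dense tr_trace tau_trace tau_faithful (e0 j).
  by exists (K, d).
pose K i := (Kd i).1; pose d i := (Kd i).2.
have d0 i : 0 < d i by have [] := KdP i.
have [_ _ trC] := tr_trace.
have step (p : nat * hom) : exists rho', traces_close K d p.1 p.2 ->
    traces_close K d p.1.+1 rho' /\ gen_close (2^-1 ^+ p.1) rho' p.2.
  (* Keeping [rho] when its traces are not close makes the step total, as [choice] demands; the
     recursion never reaches this case. *)
  case: p => j rho /=; have [[srho rr rb]|nr] := pselect (traces_close K d j rho);
    last by exists rho.
  have [rho' [srho' rr' rb']] := ex_traces_close K j.+1 d0.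
  have [_ /(_ rho' rho srho' srho)] := KdP j.
  move=> /(_ (rr' j (leqnSn j)) (rr j (leqnn j)))[u [u1 u2 uu uc]].
  have [alpha sa aE] := ex_conjugation u1 u2.
  have tra (a : C) : tr ((alpha \o rho') a) = tr (rho' a).
    by rewrite /= aE trC mulrA u1 mul1r.
  exists (alpha \o rho' : {lrmorphism _ -> _}) => _; split; split.
  - by move=> a /=; rewrite srho' sa.
  - by move=> i ij l lK; rewrite tra; exact: rr'.
  - by move=> m l mj lj; rewrite tra; exact: rb'.
  - by move=> a b; rewrite /= aE.
  - by rewrite /= aE.
have /choice[f fP] := step.
have [rho0 rho0P] := ex_traces_close K 0 d0.
pose rho := fix rho j := if j is j'.+1 then f (j', rho j') else rho0.
have rhoP j : traces_close K d j (rho j).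
  by elim: j => [//|j IH]; have [] := fP (j, rho j) IH.
exists rho; split.
- by move=> j; have [] := rhoP j.
- by move=> j; have [] := fP (j, rho j) (rhoP j).
- by move=> m l j; have [_ _] := rhoP j; exact.
Qed.

Lemma cauchy_models_cvg (rho : nat -> hom) : (forall j, starhom (rho j)) ->
  (forall j, gen_close (2^-1 ^+ j) (rho j.+1) (rho j)) ->
  forall a, exists l, cvgc (fun j => rho j a) l.
Proof.
move=> srho crho a.
have cu i j : exists l, cvgc (fun p => rho p (unit i j)) l.
  by apply: cvgc_geometric => p; have [/(_ i j)/ltW] := crho p.
have [lc cc] : exists l, cvgc (fun p => rho p (coord R n)) l.
  by apply: cvgc_geometric => p; have [_ /ltW] := crho p.
have [lu cu'] := choice (fun ij : 'I_n.+1 * 'I_n.+1 => cu ij.1 ij.2).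
have [l lP] : exists l, forall e : R, 0 < e -> exists N, forall p,
    (N <= p)%N -> cnorm (rho p a - l) < e.
  apply: (@cnorm_complete R M (fun p => rho p a)) => e e0; have [d d0 da] := gen_controlledT M a e0.
  have d20 : 0 < d / 2 by rewrite divr_gt0.
  have A : \forall p \near \oo, forall ij : 'I_n.+1 * 'I_n.+1,
      cnorm (rho p (unit ij.1 ij.2) - lu ij) < d / 2.
    by apply: filter_forall => ij; exact: cu'.
  have [N _ NP] := filterI A (cc _ d20).
  exists N => p q Np Nq.
  have [pu pc] := NP p Np; have [qu qc] := NP q Nq.
  apply: da => //; split=> [i j|].
    apply: le_lt_trans (cnorm_triangle (lu (i, j)) _ _) _.
    by rewrite [d]splitr ltrD ?(cnormB (lu _))//; [exact: (pu (i, j))|exact: (qu (i, j))].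
  apply: le_lt_trans (cnorm_triangle lc _ _) _.
  by rewrite [d]splitr ltrD// cnormB.
by exists l => e /lP[N NP]; exists N.
Qed.

Lemma ex_embedding : exists psi : hom,
  [/\ injective psi, starhom psi & forall a, tr (psi a) = tau a].
Proof.
have [rho [srho crho trho]] := ex_cauchy_models.
have /choice[f fP] := cauchy_models_cvg srho crho.
have [||||psi psiE] := @ex_lrmorphism R C M f.
- move=> a b; apply: cvgc_unique (fP _) _; apply: cvgc_near (cvgcD (fP a) (fP b)).
  by apply: nearW => j; rewrite raddfD.
- move=> z a; apply: cvgc_unique (fP _) _; apply: cvgc_near (cvgcZ z (fP a)).
  by apply: nearW => j; rewrite linearZ.
- apply: cvgc_unique (fP _) _; apply: cvgc_near (cvgc_cst 1).
  by apply: nearW => j; rewrite rmorph1.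
- move=> a b; apply: cvgc_unique (fP _) _; apply: cvgc_near (cvgcM (fP a) (fP b)).
  by apply: nearW => j; rewrite rmorphM.
have spsi : starhom psi.
  move=> a; rewrite !psiE; apply: cvgc_unique (fP _) _; apply: cvgc_near (cvgc_star (fP a)).
  by apply: nearW => j; rewrite srho.
have [tr1 tr_pos trC] := tr_trace; have [tau1 tau_pos tauC] := tau_trace.
pose t' : {scalar C} := tr \o psi.
have t'C a b : t' (a * b) = t' (b * a) by rewrite /t'/= !rmorphM trC.
have t'b m l : t' (bernw R n m l) = tau (bernw R n m l).
  apply/eqP; rewrite -subr_eq0; apply/eqP/eq0_normc/eqP.
  rewrite eq_le normc_ge0 andbT; apply/ler_addgt0Pr => e e0; rewrite add0r.
  (* The factor 16 of [positive_bounded] makes this e/2; the other half comes from 2^-j < e/2. *)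
  have e320 : 0 < e / 32 by rewrite divr_gt0.
  have e20 : 0 < e / 2 by rewrite divr_gt0.
  near \oo => j.
  have h1 : cnorm (rho j (bernw R n m l) - f (bernw R n m l)) < e / 32.
    by near: j; exact: fP.
  have mj : (m <= j)%N by near: j; exists m.
  have lj : (l <= j)%N by near: j; exists l.
  have h2 : 2^-1 ^+ j < e / 2.
    near: j; have /cvgrPdist_lt/(_ _ e20) : (GRing.exp (2^-1 : R)) @ \oo --> 0.
      by apply: cvg_expr; rewrite ger0_norm ?invr_ge0// invf_lt1// ltr1n.
    by apply: filterS => j; rewrite sub0r normrN ger0_norm// exprn_ge0.
  have h3 := trho m l j mj lj.
  have := positive_bounded tr1 tr_pos (rho j (bernw R n m l) - f (bernw R n m l)).
  rewrite raddfB/= /t' /= psiE; set A := tr (f _); set B := tr (rho j _) => h4.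
  have -> : A - tau (bernw R n m l) = - (B - A) + (B - tau (bernw R n m l)) by ring.
  by apply: le_trans (le_normcD _ _) _; rewrite normcN /B; lra.
(* Both functionals are tracial and the weights central, so agreement on the weights extends to all
   Bernstein sums, which are dense. *)
have tB m a : t' (bernstein m a) = tau (bernstein m a).
  rewrite bernstein_weights !raddf_sum; apply: eq_bigr => l _.
  have [g [cg [_ E]]] := bernw_real R n m l.
  have comm b : bernw R n m l * b = b * bernw R n m l by rewrite E C01M_real_comm.
  apply: etrans (tau_real_cst t'C _ comm) _; rewrite t'b; apply: esym.
  exact: (tau_real_cst tauC _ comm).
have trpsi a : tr (psi a) = tau a.
  apply/eqP; rewrite -subr_eq0; apply/eqP/eq0_normc/eqP.
  rewrite eq_le normc_ge0 andbT; apply/ler_addgt0Pr => e e0; rewrite add0r.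
  have e320 : 0 < e / 32 by rewrite divr_gt0.
  have [m am] := @filter_ex _ \oo _ _ (bernstein_cvg a e320).
  have h1 := positive_bounded tau1 tau_pos (a - bernstein m a).
  have h2 := positive_bounded tr1 tr_pos (psi (a - bernstein m a)).
  have h3 := starhom_contractive spsi (a - bernstein m a).
  have -> : tr (psi a) - tau a = tr (psi (a - bernstein m a)) - tau (a - bernstein m a).
    have e1 : tr (psi (a - bernstein m a)) = tr (psi a) - tau (bernstein m a).
      by rewrite -tB (raddfB psi) (raddfB tr).
    by rewrite e1 (raddfB tau) opprB subrKA.
  by apply: le_trans (le_normcD _ _) _; rewrite normcN; lra.
exists psi; split=> //.
(* A limit of homomorphisms need not be injective; here preserving a faithful trace kills the
   kernel. *)
suff inj0 a : psi a = 0 -> a = 0.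
  move=> a b /eqP; rewrite -subr_eq0 -raddfB => /eqP/inj0/eqP.
  by rewrite subr_eq0 => /eqP.
move=> a0; apply: tau_faithful; rewrite -trpsi.
have -> : psi (star a * a) = psi (star a) * psi a by exact: rmorphM.
by rewrite a0 mulr0 raddf0.
Unshelve. all: by end_near. Qed.

End Universality.

(** * Existence of a faithful trace on C([0,1], M_n) *)

Section FaithfulTrace.
Variables (R : realType) (n : nat).
Local Notation C := (C01M R n).
Local Notation Mn := 'M[R[i]]_n.+1.

(** Runs through all grid points by decoding pairs; a number that codes no pair yields the point
    [grid R 0 0]. *)
Definition grid_enum (k : nat) : unit_itv R :=
  let ml := odflt (0, 0)%N (unpickle k : option (nat * nat)) in grid R ml.1 ml.2.

Lemma grid_enum_surj m l : exists k, grid_enum k = grid R m l.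
Proof. by exists (pickle (m, l)); rewrite /grid_enum pickleK. Qed.

(** The weights 2^-(k+1) sum to 1. Summing matrices and taking the normalized trace of the limit
    reuses convergence in the C*-algebra of matrices. *)
Definition grid_sum (f : C) (p : nat) : Mn :=
  \sum_(k < p) ((2^-1 : R) ^+ k.+1)%:C *: f (grid_enum k).

Lemma grid_sum_cvg f : exists l, cvgc (grid_sum f) l.
Proof.
(* Dividing by [c] brings the increments below 2^-p, as [cvgc_geometric] requires; the added 1 keeps
   [c] positive for [f = 0]. *)
pose c := cnorm f + 1; have c0 : 0 < c by rewrite ltr_wpDl ?cnorm_ge0.
have [l cl] : exists l, cvgc (fun p => (c^-1)%:C *: grid_sum f p : Mn) l.
  apply: cvgc_geometric => p; rewrite -scalerBr /grid_sum big_ord_recr/= addrAC subrr add0r.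
  rewrite !cnormZr !ger0_norm ?invr_ge0 ?exprn_ge0 ?invr_ge0 ?(ltW c0)//.
  rewrite -[cnorm _]/(opnorm (f (grid_enum p))) mulrCA -[leRHS]mulr1.
  apply: ler_pM; rewrite ?exprn_ge0 ?mulr_ge0 ?opnorm_ge0 ?invr_ge0 ?(ltW c0)//.
    by rewrite exprS ler_piMl ?exprn_ge0// invf_le1// ler1n.
  rewrite mulrC ler_pdivrMr// mul1r /c; apply: le_trans (opnorm_le_supnorm f _) _.
  by rewrite lerDl.
exists (c%:C *: l); apply: cvgc_near (cvgcZ c%:C cl).
by apply: nearW => p; rewrite scalerA -rmorphM divff ?lt0r_neq0// scale1r.
Qed.

Definition ntrace (X : Mn) : R[i] := \tr X / n.+1%:R.

Lemma ntraceB X Y : ntrace (X - Y) = ntrace X - ntrace Y.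
Proof. by rewrite /ntrace raddfB mulrBl. Qed.

Lemma Re_ntrace_dist X Y :
  `|complex.Re (ntrace X) - complex.Re (ntrace Y)| <= opnorm (X - Y).
Proof.
rewrite -ReB -ntraceB; apply: le_trans (Re_le_normc _) _; exact: normc_ntrace.
Qed.

Lemma Im_ntrace_dist X Y :
  `|complex.Im (ntrace X) - complex.Im (ntrace Y)| <= opnorm (X - Y).
Proof.
rewrite -ImB -ntraceB; apply: le_trans (Im_le_normc _) _; exact: normc_ntrace.
Qed.

Lemma ntrace_cvgc_eq (u v : nat -> Mn) l m : cvgc u l -> cvgc v m ->
  (forall p, ntrace (u p) = ntrace (v p)) -> ntrace l = ntrace m.
Proof.
move=> ul vm uv; apply/eqP; rewrite -subr_eq0; apply/eqP/eq0_normc/eqP.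
rewrite eq_le normc_ge0 andbT; apply/ler_addgt0Pr => e e0; rewrite add0r.
have e20 : 0 < e / 2 by rewrite divr_gt0.
have [p [up vp]] := @filter_ex _ \oo _ _ (filterI (ul _ e20) (vm _ e20)).
have -> : ntrace l - ntrace m = - ntrace (u p - l) + ntrace (v p - m).
  by rewrite !ntraceB uv opprB addrA subrK.
apply: le_trans (le_normcD _ _) _; rewrite normcN [e]splitr; apply: lerD.
  by apply: le_trans (normc_ntrace _) _; exact: ltW.
by apply: le_trans (normc_ntrace _) _; exact: ltW.
Qed.

Lemma Re_ntrace_cvgc_ge (u : nat -> Mn) l (c : R) : cvgc u l ->
  (\forall p \near \oo, c <= complex.Re (ntrace (u p))) -> c <= complex.Re (ntrace l).
Proof.
move=> ul uc; apply/ler_addgt0Pr => e e0.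
have [p [up cp]] := @filter_ex _ \oo _ _ (filterI (ul _ e0) uc).
have := Re_ntrace_dist (u p) l; rewrite ler_norml => /andP[_ h].
by move: up; rewrite -[cnorm _]/(opnorm (u p - l)) => up; lra.
Qed.

Lemma Im_ntrace_cvgc0 (u : nat -> Mn) l : cvgc u l ->
  (forall p, complex.Im (ntrace (u p)) = 0) -> complex.Im (ntrace l) = 0.
Proof.
move=> ul u0; apply/eqP; rewrite -normr_eq0 eq_le normr_ge0 andbT.
apply/ler_addgt0Pr => e e0; rewrite add0r.
have [p up] := @filter_ex _ \oo _ _ (ul _ e0).
have := Im_ntrace_dist (u p) l; rewrite u0 sub0r normrN => h.
by apply: le_trans h _; exact: ltW.
Qed.

Lemma ntrace_star (X : Mn) : exists2 y : R, ntrace (star X * X) = y%:C & 0 <= y /\ (y = 0 -> X = 0).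
Proof.
pose y := (\sum_i \sum_j (normc (X j i)) ^+ 2) / n.+1%:R.
have s0 : 0 <= \sum_i \sum_j (normc (X j i)) ^+ 2.
  by do 2 apply: sumr_ge0 => ? _; exact: sqr_ge0.
exists y; last split.
- rewrite /ntrace /y rmorphM/= fmorphV/= rmorph_nat; congr (_ / _).
  rewrite rmorph_sum; apply: eq_bigr => i _; rewrite rmorph_sum mxE.
  by apply: eq_bigr => j _; rewrite !mxE mulrC -normCK rmorphXn.
- by rewrite divr_ge0.
move=> /eqP; rewrite mulf_eq0 invr_eq0 pnatr_eq0 orbF.
rewrite psumr_eq0 => [/allP h|i _]; last by apply: sumr_ge0 => j _; exact: sqr_ge0.
apply/matrixP => j i; have := h i (mem_index_enum i).
rewrite psumr_eq0 => [/allP/(_ j (mem_index_enum j))|l _]; last exact: sqr_ge0.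
by rewrite sqrf_eq0 mxE => /eqP/eq0_normc.
Qed.

(* The points [grid_enum k] are dense: the Bernstein approximations of [f] only involve them. *)
Lemma C01M_eq0_grid (f : C) : (forall k, f (grid_enum k) = 0) -> f = 0.
Proof.
move=> f0; apply: cnorm_eq0; apply/eqP; rewrite eq_le cnorm_ge0 andbT.
apply/ler_addgt0Pr => e e0; rewrite add0r.
have [m fm] := @filter_ex _ \oo _ _ (bernstein_cvg f e0).
suff b0 : bernstein m f = 0 by rewrite b0 subr0 in fm.
rewrite bernstein_weights big1// => k _.
have [l <-] := grid_enum_surj m k; rewrite f0.
have -> : C01M_cst (0 : Mn) = 0 :> C by exact: C01MP.
by rewrite mulr0.
Qed.

Lemma ex_faithful_trace : exists tau : {scalar C}, is_trace tau /\ faithful tau.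
Proof.
have [E EP] := choice grid_sum_cvg.
have ED f g : E (f + g) = E f + E g.
  apply: cvgc_unique (EP _) _; apply: cvgc_near (cvgcD (EP f) (EP g)).
  apply: nearW => p; rewrite /grid_sum -big_split; apply: eq_bigr => k _.
  by apply: esym; exact: scalerDr.
have EZ z f : E (z *: f) = z *: E f.
  apply: cvgc_unique (EP _) _; apply: cvgc_near (cvgcZ z (EP f)).
  apply: nearW => p; rewrite /grid_sum scaler_sumr; apply: eq_bigr => k _.
  by rewrite scalerA mulrC -scalerA.
pose t (f : C) := ntrace (E f).
have lt : scalar t.
  move=> z f g; rewrite /t /ntrace ED EZ raddfD/= mulrDl; congr (_ + _).
  by rewrite mxtraceZ mulrA.
pose lin := GRing.isLinear.Build R[i] C R[i] *%R t lt.
pose tau : {scalar C} := HB.pack t lin.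
exists tau; have tE f : tau f = ntrace (E f) by [].
have geo p : \sum_(k < p) (2^-1 : R) ^+ k.+1 = 1 - 2^-1 ^+ p.
  elim: p => [|p IH]; first by rewrite big_ord0 expr0 subrr.
  by rewrite big_ord_recr/= IH exprS; lra.
have E1 : E 1 = 1.
  apply: cvgc_unique (EP _) _ => e e0.
  have /cvgrPdist_lt/(_ _ e0) : (GRing.exp (2^-1 : R)) @ \oo --> 0.
    by apply: cvg_expr; rewrite ger0_norm ?invr_ge0// invf_lt1// ltr1n.
  apply: filterS => p; rewrite sub0r normrN => ep.
  rewrite /grid_sum -scaler_suml -rmorph_sum/= geo rmorphB/= rmorph1 scalerBl scale1r.
  rewrite addrC addKr cnormN cnormZr.
  by rewrite -[cnorm _]/(@cnorm R 'M[R[i]]_n.+1 1) cnorm1 mulr1.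
have sums f p : ntrace (grid_sum (star f * f) p) =
    (\sum_(k < p) 2^-1 ^+ k.+1 * complex.Re (ntrace (star (f (grid_enum k)) * f (grid_enum k))))%:C.
  rewrite /ntrace /grid_sum raddf_sum/= mulr_suml rmorph_sum/=; apply: eq_bigr => k _.
  have [y yE _] := ntrace_star (f (grid_enum k)).
  by rewrite mxtraceZ -mulrA -/(ntrace _) yE rmorphM.
have pos f k : 0 <= complex.Re (ntrace (star (f (grid_enum k)) * f (grid_enum k))).
  by have [y -> []] := ntrace_star (f (grid_enum k)).
(* Every single term bounds the trace from below: the term k = 0 gives positivity, and all of them
   together give faithfulness. *)
have taupos f : complex.Im (tau (star f * f)) = 0 /\
    forall k, 2^-1 ^+ k.+1 * complex.Re (ntrace (star (f (grid_enum k)) * f (grid_enum k)))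
      <= complex.Re (tau (star f * f)).
  rewrite tE; split.
    by apply: (Im_ntrace_cvgc0 (EP _)) => p; rewrite sums.
  move=> k; apply: (Re_ntrace_cvgc_ge (EP _)).
  exists k.+1 => // p /= kp; rewrite sums/= (bigD1 (Ordinal kp))//= lerDl.
  by apply: sumr_ge0 => l _; rewrite mulr_ge0 ?exprn_ge0.
split; first split.
- by rewrite tE E1 /ntrace -[1]/(1%:M) mxtrace1 divff// pnatr_eq0.
- move=> f; have [im re] := taupos f; rewrite lecE im eqxx/=.
  by apply: le_trans (re 0%N); rewrite mulr_ge0 ?exprn_ge0.
- move=> f g; rewrite !tE; apply: (ntrace_cvgc_eq (EP _) (EP _)) => p.
  rewrite /ntrace /grid_sum !raddf_sum/= !mulr_suml; apply: eq_bigr => k _.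
  by rewrite !mxtraceZ; congr (_ * _ / _); exact: mxtrace_mulC.
move=> f f0; apply: C01M_eq0_grid => k.
have [_ /(_ k)] := taupos f; rewrite f0/=.
have [y -> [y0 yX]] := ntrace_star (f (grid_enum k)) => /= h; apply: yX.
apply/eqP; rewrite eq_le y0 andbT.
by move: h; rewrite pmulr_rle0// exprn_gt0.
Qed.

End FaithfulTrace.

(** * Separability through matrices with rational entries *)

Section Separability.
Variables (R : realType) (M : cstarAlgType R) (k : nat -> nat).
Variable phi : forall j, {lrmorphism 'M[R[i]]_((k j).+1) -> M}.
Hypothesis ephi : forall j, matrix_embedding (phi j).
Hypothesis dense : forall a (e : R), 0 < e -> exists j X, cnorm (a - phi j X) < e.

Definition rational_matrix N (Q : 'M[rat * rat]_N) : 'M[R[i]]_N :=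
  \matrix_(i, j) (ratr (Q i j).1 +i* ratr (Q i j).2).

Lemma rational_matrix_dense N (X : 'M[R[i]]_N) (e : R) : 0 < e ->
  exists Q, opnorm (X - rational_matrix Q) <= e.
Proof.
move=> e0; pose d := e / ((N * N).*2%:R + 1).
have d0 : 0 < d by rewrite divr_gt0// ltr_wpDl.
have approx (x : R) : exists q : rat, `|x - ratr q| <= d.
  have /rat_in_itvoo[q] : x < x + d by rewrite ltrDl.
  by rewrite in_itv/= => /andP[q1 q2]; exists q; rewrite ltr0_norm; lra.
have /choice[f fP] : forall z : R[i], exists q : rat * rat,
    normc (z - (ratr q.1 +i* ratr q.2)) <= d + d.
  move=> z; have [q hq] := approx (complex.Re z); have [q' hq'] := approx (complex.Im z).
  exists (q, q'); apply: le_trans (normc_le_Re_Im _) _.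
  by rewrite ReB ImB /=; exact: lerD.
exists (\matrix_(i, j) f (X i j)); apply: le_trans (opnorm_le_mxsum _) _.
apply: (@le_trans _ _ (\sum_(i < N) \sum_(j < N) (d + d))).
  by do 2 apply: ler_sum => ? _; rewrite !mxE; exact: fP.
rewrite !sumr_const !card_ord -mulrnA -mulr2n -mulrnA mul2n -mulr_natl /d.
by rewrite mulrCA ger_pMr// ler_pdivrMr ?ltr_wpDl// mul1r lerDl.
Qed.

Lemma uhf_separable : separable M.
Proof.
pose g (x : {j : nat & 'M[rat * rat]_((k j).+1)}) : M :=
  phi (tag x) (rational_matrix (tagged x)).
exists (range g); split.
  exact: card_le_trans (card_image_le _ _) (countableP _).
move=> a e e0; have e20 : 0 < e / 2 by rewrite divr_gt0.
have [j [X aX]] := dense a e20.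
have [Q XQ] := rational_matrix_dense X e20.
exists (g (Tagged (fun j => 'M[rat * rat]_((k j).+1)) Q)).
  by exists (Tagged (fun j => 'M[rat * rat]_((k j).+1)) Q).
apply: le_lt_trans (cnorm_triangle (phi j X) _ _) _.
by rewrite [e]splitr ltr_leD// -raddfB matrix_embedding_isometric.
Qed.

End Separability.

Section FraisseLimit.
Variables (R : realType) (nu : supernatural R) (M : cstarAlgType R).
Variables (tr : {scalar M}) (tr_trace : is_trace tr) (k : nat -> nat).
Variable phi : forall j, {lrmorphism 'M[R[i]]_((k j).+1) -> M}.
Hypothesis ephi : forall j, matrix_embedding (phi j).
Hypothesis nest : forall j X, exists Y, phi j.+1 Y = phi j X.
Hypothesis dense : forall a (e : R), 0 < e -> exists j X, cnorm (a - phi j X) < e.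
Hypothesis nuM : forall n, formally_divides n.+1 nu <->
    exists phi : {lrmorphism 'M[R[i]]_n.+1 -> M}, matrix_embedding phi.
Local Notation Mt := (TracialAlg tr_trace).

Lemma uhf_universal (A : tracialAlg R) : interval_class nu A ->
  exists psi : {lrmorphism A -> Mt}, embedding psi.
Proof.
case=> n tau tauP nnu ftau.
have [psi [ipsi spsi tpsi]] :=
  ex_embedding ephi nest dense nuM tr_trace nnu tauP ftau.
by exists psi.
Qed.

Lemma uhf_homogeneous (A : tracialAlg R) : interval_class nu A ->
  forall (m : nat) (a : 'I_m -> A) (psi psi' : {lrmorphism A -> Mt}) (e : R),
  embedding psi -> embedding psi' -> 0 < e ->
  exists2 alpha : {lrmorphism Mt -> Mt}, automorphism alpha &
    forall i, cnorm (alpha (psi (a i)) - psi' (a i)) < e.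
Proof.
case=> n tau tauP nnu ftau m a psi psi' e [_ sp tp] [_ sp' tp'] e0.
have [d d0 da] := @gen_controlled_fin R M n 'I_m a e e0.
have [K [c [c0 cP]]] := unitary_equivalence ephi nest dense tr_trace tauP ftau d0.
have close (pi : {lrmorphism C01M R n -> M}) : (forall b, tr (pi b) = tau b) ->
    ramps_close tr tau K c pi.
  by move=> tpi l _; rewrite tpi subrr normc0.
have [u [u1 u2 uu uc]] := cP psi psi' sp sp' (close _ tp) (close _ tp').
have [alpha sa aE] := ex_conjugation u1 u2.
exists alpha; first exact: conjugation_automorphism u1 u2 sa aE.
have sap : starhom (alpha \o psi) by move=> b /=; rewrite sp sa.
apply: (da (alpha \o psi : {lrmorphism C01M R n -> M}) psi' sap sp').
by split=> [b b'|]; rewrite /= aE.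
Qed.

Lemma uhf_structure (F : set M) (e : R) : finite_set F -> 0 < e ->
  exists (A : tracialAlg R) (psi : {lrmorphism A -> Mt}),
  [/\ interval_class nu A, embedding psi & forall x, F x -> exists a, cnorm (x - psi a) < e].
Proof.
move=> /finite_seqP[s ->] e0; have e20 : 0 < e / 2 by rewrite divr_gt0.
have [J FJ] : exists J, forall x, x \in s -> exists X, cnorm (x - phi J X) < e / 2.
  elim: s => [|x s [J IH]]; first by exists 0%N.
  have [j [X xX]] := dense x e20; exists (maxn J j) => y.
  rewrite inE => /orP[/eqP ->|/IH[Y yY]].
    by have [Z ZX] := nested_le nest X (leq_maxr J j); exists Z; rewrite ZX.
  by have [Z ZY] := nested_le nest Y (leq_maxl J j); exists Z; rewrite ZY.
have [tau [tauP ftau]] := ex_faithful_trace R (k J).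
have nnu : formally_divides (k J).+1 nu by apply/nuM; exists (phi J).
have [psi [ipsi spsi tpsi]] :=
  ex_embedding ephi nest dense nuM tr_trace nnu tauP ftau.
have [ev sev evE] := ex_eval_at (k J) (unit_itv0 R).
(* This is no embedding, but on constants it reproduces [phi J]. Conjugating [psi] towards it on
   constants moves the image of [psi] near the given finite set. *)
pose sigma : {lrmorphism C01M R (k J) -> M} := phi J \o ev.
have ssigma : starhom sigma.
  by move=> a /=; rewrite sev (matrix_embedding_starhom (ephi J)).
have /choice[X XP] : forall i : 'I_(size s), exists X : 'M[R[i]]_((k J).+1),
    cnorm (nth 0 s i - phi J X) < e / 2.
  by move=> i; apply: FJ; exact: mem_nth.
pose G i : C01M R (k J) := C01M_cst (X i).
(* Three errors e/6 in [cnorm_conj_triangle] make e/2; the other e/2 is the distance to the stage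
   [J]. *)
have e60 : 0 < e / 6 by rewrite divr_gt0.
have [j [[r [T [t [fT _ Tt]]]] [r' [T' [t' [fT' _ T't]]]]]] := @filter_ex _ \oo _ _
  (filterI (approx_pointeval ephi nest dense G spsi e60)
           (approx_pointeval ephi nest dense G ssigma e60)).
have rr : r' = r.
  by have /eqP := frame_size fT'; rewrite -(frame_size fT) eqn_pmul2l// => /eqP.
subst r'; have [u [u1 u2 uT]] := frame_conj ephi fT fT'.
have [alpha sa aE] := ex_conjugation u1 u2.
have [[ia _ ta] _] := conjugation_automorphism tr_trace u1 u2 sa aE.
exists (TracialAlg tauP), (alpha \o psi : {lrmorphism _ -> _}); split.
- exact: IntervalClass.
- split=> [a b /= /ia/ipsi//|a|a] /=; first by rewrite spsi sa.
  by rewrite -tpsi; exact: ta.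
move=> x /= xs; have xi : (index x s < size s)%N by rewrite index_mem.
exists (G (Ordinal xi)).
have xX := XP (Ordinal xi); rewrite /= nth_index// in xX.
apply: le_lt_trans (cnorm_triangle (phi J (X (Ordinal xi))) _ _) _.
rewrite [e]splitr ltrD// cnormB aE.
have -> : phi J (X (Ordinal xi)) = sigma (G (Ordinal xi)) by rewrite /sigma/= evE.
have -> : e / 2 = e / 6 + e / 6 + e / 6 by field.
apply: (cnorm_conj_triangle u1 u2 (Tt _) (T't _)); rewrite uT.
have -> : blockmx2 T' T' (fun i => G (Ordinal xi) (t i) - G (Ordinal xi) (t' i)) = 0.
  apply: big1 => i _.
  by rewrite -[X in _ *m X *m _]/(X (Ordinal xi) - X (Ordinal xi)) subrr mulmx0 mul0mx.
by rewrite raddf0 cnorm0 ltW.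
Qed.

End FraisseLimit.

Theorem theorem3p10 (R : realType) (nu : supernatural R)
  (M : cstarAlgType R) (tr : {scalar M}) (tr_trace : is_trace tr) :
  is_uhf_of nu M ->
  is_fraisse_limit (interval_class nu) (TracialAlg tr_trace).
Proof.
move=> [[k [phi [ephi nest dense]]] nuM]; split.
- exact: uhf_separable ephi dense.
- by move=> F e; exact: uhf_structure.
- exact: uhf_universal ephi nest dense nuM.
- exact: uhf_homogeneous ephi nest dense.
Qed.
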